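(* Let $d\ge 1$. Let $V\in C^2(\mathbb{R}^d;\mathbb{R})$ satisfy $V\ge 0$, $V(x)\to+\infty$ as $x\to\infty$, and $\nabla V(x)=o\left(V(x)^{3/4}\right)$ as $x\to\infty$. Let $b\in L^\infty(\mathbb{R}^d)$ be a non-negative function such that the damped wave equation $$\partial_t^2u+Pu+b(x)\partial_tu=0,\qquad P=V(x)-\tfrac12\Delta,$$ is uniformly stable. Then $b$ satisfies both of the following conditions. (Uniform Geometric Control Condition) There exist $T>0$ and $c>0$ such that for all $(x_0,\nu_0)\in\mathbb{R}^d\times S^{d-1}$ and all $r>0$, $$\frac{1}{2T}\int_{-T}^T (b*\kappa_r)(x_0+t\nu_0)\,dt\ \ge\ c.$$ (Turning Point Condition) There exists $R>0$ such that $$\liminf_{x\to\infty}\ \frac{1}{|B_{R/V(x)^{1/4}}(x)|}\int_{B_{R/V(x)^{1/4}}(x)} b(y)\,dy\ >\ 0.$$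
   Context: $B_r(x)$ is the open Euclidean ball of radius $r$ centred at $x$, $|A|$ is the $d$-dimensional Lebesgue measure of $A$, $\kappa:=\frac{1}{|B_1(0)|}\mathbf{1}_{B_1(0)}$ and $\kappa_r(x):=r^{-d}\kappa(x/r)$ for $r>0$. Operator and equation: $P=V-\frac12\Delta$ with domain $\mathrm{dom}\,P=\{u\in L^2(\mathbb{R}^d): (V-\frac12\Delta)u\in L^2(\mathbb{R}^d)\}$ is self-adjoint and positive definite. Let $\mathfrak{H}=\mathrm{dom}\,P^{1/2}\oplus L^2(\mathbb{R}^d)$ be the Hilbert space with inner product $((u_1,v_1),(u_2,v_2))_{\mathfrak H}=(P^{1/2}u_1,P^{1/2}u_2)_{L^2}+(v_1,v_2)_{L^2}$. The damped wave operator is $$\mathscr{A}_b=\begin{pmatrix}0&1\\-P&-b\end{pmatrix},\qquad \mathrm{dom}\,\mathscr{A}_b=\mathrm{dom}\,P\oplus\mathrm{dom}\,P^{1/2},$$ acting on $\mathfrak{H}$; it generates a strongly continuous semigroup $(e^{t\mathscr{A}_b})_{t\ge0}$ on $\mathfrak H$, which solves the damped wave equation $\partial_t^2u+Pu+b\,\partial_tu=0$ with $U=(u,\partial_tu)$. Uniform stability: the damped wave equation is uniformly stable if there exist $C>0$, $\tau>0$ such that $\|e^{t\mathscr{A}_b}\|_{\mathcal{B}(\mathfrak{H})}\le Ce^{-t/\tau}$ for all $t\ge0$. *)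

(* Defs.v *)
From HB Require Import structures.
From mathcomp Require Import all_boot all_order all_algebra.
From mathcomp Require Import generic_quotient ring_quotient.
From mathcomp Require Import all_classical all_reals all_analysis.
From mathcomp Require Import complex.

Set Implicit Arguments.
Unset Strict Implicit.
Unset Printing Implicit Defensive.

Import Order.TTheory GRing.Theory Num.Theory.
Import numFieldNormedType.Exports.

Local Open Scope classical_set_scope.
Local Open Scope ring_scope.
Local Open Scope quotient_scope.

(* 'rV[R]_n carries the sigma-algebra generated by the coordinates (the Borel
   one), and [lebesgue_rV] is the n-fold product of [lebesgue_measure]. *)
Definition measure_rV_display : measure_display -> measure_display.
Proof. exact. Qed.

Section measurable_rV.
Context (R : realType) (n : nat).

Let coors : 'I_n -> 'rV[R]_n -> measurableTypeR R := fun i x => x ord0 i.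

Let rV_set0 : g_sigma_preimage coors set0.
Proof. exact: sigma_algebra0. Qed.

Let rV_setC A : g_sigma_preimage coors A -> g_sigma_preimage coors (~` A).
Proof. exact: sigma_algebraC. Qed.

Let rV_bigcup (F : (set 'rV[R]_n)^nat) :
  (forall i, g_sigma_preimage coors (F i)) ->
  g_sigma_preimage coors (\bigcup_i (F i)).
Proof. exact: sigma_algebra_bigcup. Qed.

HB.instance Definition _ := @isMeasurable.Build
  (measure_rV_display default_measure_display) 'rV[R]_n
  (g_sigma_preimage coors) rV_set0 rV_setC rV_bigcup.

Lemma measurable_coord (i : 'I_n) :
  measurable_fun [set: 'rV[R]_n] (fun x => x ord0 i : measurableTypeR R).
Proof.
move=> _ Y mY; rewrite setTI; apply: sub_sigma_algebra => /=.
rewrite -bigcup_seq/=; exists i => /=; first by rewrite mem_index_enum.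
by exists Y => //; rewrite setTI.
Qed.

Lemma measurable_fun_rV d (T : measurableType d) (f : T -> 'rV[R]_n) :
  (forall i, measurable_fun setT (fun x => f x ord0 i : measurableTypeR R)) ->
  measurable_fun setT f.
Proof.
move=> mf _ A mA; rewrite setTI.
suff : g_sigma_preimage coors `<=` [set A | measurable (f @^-1` A)] by exact.
apply: smallest_sub => /=.
  split => /= [|B mB|F mF].
  - by rewrite preimage_set0.
  - by rewrite setTD -preimage_setC; exact: measurableC.
  - by rewrite preimage_bigcup; exact: bigcupT_measurable.
rewrite -bigcup_seq => B [i _] [C mC <-] /=.
by rewrite setTI; have := mf i measurableT C mC; rewrite setTI.
Qed.

End measurable_rV.

Section lebesgue_rV.
Context (R : realType).

Definition cons_rV n (p : measurableTypeR R * 'rV[R]_n) : 'rV[R]_n.+1 :=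
  \row_(i < n.+1) oapp (p.2 ord0) p.1 (unlift ord0 i).

Definition uncons_rV n (x : 'rV[R]_n.+1) : measurableTypeR R * 'rV[R]_n :=
  (x ord0 ord0, \row_(i < n) x ord0 (lift ord0 i)).

Lemma cons_rVK n : cancel (@cons_rV n) (@uncons_rV n).
Proof.
move=> [a v]; rewrite /uncons_rV /cons_rV mxE unlift_none; congr pair.
by apply/rowP => i; rewrite !mxE liftK.
Qed.

Lemma uncons_rVK n : cancel (@uncons_rV n) (@cons_rV n).
Proof.
move=> x; apply/rowP => i; rewrite mxE.
by case: unliftP => [j ->|->] //=; rewrite mxE.
Qed.

Lemma measurable_cons_rV n : measurable_fun setT (@cons_rV n).
Proof.
apply: measurable_fun_rV => i; under eq_fun do rewrite mxE.
case: unliftP => [j _|_] /=; last exact: measurable_fst.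
exact: (measurableT_comp (measurable_coord j) measurable_snd).
Qed.

Lemma measurable_uncons_rV n : measurable_fun setT (@uncons_rV n).
Proof.
apply: measurable_fun_pair => /=; first exact: measurable_coord.
by apply: measurable_fun_rV => i; under eq_fun do rewrite mxE;
  exact: measurable_coord.
Qed.

Section lebesgue_step.
Context (n : nat) (mu : {sigma_finite_measure set 'rV[R]_n -> \bar R}).

Definition lebesgue_step : set 'rV[R]_n.+1 -> \bar R :=
  pushforward (lebesgue_measure \x mu)%E (@cons_rV n).

HB.instance Definition _ := Measure.copy lebesgue_step
  (measure_function_pushforward__canonical__measure_function_Measure
    (lebesgue_measure \x mu)%E (@measurable_cons_rV n)).

Let step_sigma_finite : sigma_finite setT lebesgue_step.
Proof.
have /sigma_finiteP[F [FT ndF Foo]] := sigma_finiteT (@lebesgue_measure R).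
have /sigma_finiteP[G [GT ndG Goo]] := sigma_finiteT mu.
exists (fun k => @uncons_rV n @^-1` (F k `*` G k)).
  apply/seteqP; split=> // x _.
  have [i _ Fi] : (\bigcup_i F i) (uncons_rV x).1 by rewrite -FT.
  have [j _ Gj] : (\bigcup_i G i) (uncons_rV x).2 by rewrite -GT.
  exists (maxn i j) => //; split.
    by move: Fi; exact/subsetPset/ndF/leq_maxl.
  by move: Gj; exact/subsetPset/ndG/leq_maxr.
move=> k; have [mF Fk] := Foo k; have [mG Gk] := Goo k; split.
  rewrite -[X in measurable X]setTI; apply: measurable_uncons_rV => //.
  exact: measurableX.
rewrite /lebesgue_step /pushforward -comp_preimage.
rewrite (_ : _ @^-1` _ = F k `*` G k).
  by rewrite product_measure1E// lte_mul_pinfty// ge0_fin_numE.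
by rewrite (_ : _ \o _ = id) ?preimage_id//; exact/funext/cons_rVK.
Qed.

HB.instance Definition _ :=
  Measure_isSigmaFinite.Build _ _ _ lebesgue_step step_sigma_finite.

End lebesgue_step.


Fixpoint lebesgue_rV n : {sigma_finite_measure set 'rV[R]_n -> \bar R} :=
  if n is m.+1 then lebesgue_step (lebesgue_rV m) else \d_(0 : 'rV[R]_0).

End lebesgue_rV.

(* [L2 R d] is L^2(R^d; C): square-integrable functions modulo a.e. equality.
   [repr u] is a function representing the class [u]. *)
Section L2.
Context (R : realType) (d : nat).
Local Notation mu := (@lebesgue_rV R d).

Definition sqint : {pred 'rV[R]_d -> R[i]} := [pred f |
  (@complex.Re R \o f \in Lfun mu 2%:E) && (@complex.Im R \o f \in Lfun mu 2%:E)].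

Let Lfun2_submod := Lfun_submod_closed mu (lee1n 2 : (1 <= 2%:E)%E).

Fact sqint_submod_closed : submod_closed sqint.
Proof.
have [L0 LD] := Lfun2_submod.
have LZ a f : f \in Lfun mu 2%:E -> a *: f \in Lfun mu 2%:E.
  by move=> Lf; have := LD a f 0 Lf L0; rewrite addr0.
have LA f g : f \in Lfun mu 2%:E -> g \in Lfun mu 2%:E ->
    f + g \in Lfun mu 2%:E.
  by move=> Lf Lg; have := LD 1 f g Lf Lg; rewrite scale1r.
pose re (f : 'rV[R]_d -> R[i]) : 'rV[R]_d -> R := @complex.Re R \o f.
pose im (f : 'rV[R]_d -> R[i]) : 'rV[R]_d -> R := @complex.Im R \o f.
split; first by apply/andP; split; exact: L0.
move=> a f g /andP[fR fI] /andP[gR gI]; apply/andP; split.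
  have /= -> : @complex.Re R \o (a *: f + g) =
      complex.Re a *: re f + (- complex.Im a *: im f + re g).
    apply/funext => x; rewrite /re /im /= !fctE /=.
    by case: a (f x) (g x) => [? ?] [? ?] [? ?]; rewrite /GRing.scale /= addrA mulNr.
  by rewrite !LA ?LZ.
have /= -> : @complex.Im R \o (a *: f + g) =
    complex.Re a *: im f + (complex.Im a *: re f + im g).
  apply/funext => x; rewrite /re /im /= !fctE /=.
  by case: a (f x) (g x) => [? ?] [? ?] [? ?]; rewrite /GRing.scale /= addrA.
by rewrite !LA ?LZ.
Qed.

HB.instance Definition _ := GRing.isSubmodClosed.Build R[i] ('rV[R]_d -> R[i])
  sqint sqint_submod_closed.

Record sqint_fun :=
  SqintFun { sqint_val :> 'rV[R]_d -> R[i] ; _ : sqint_val \in sqint }.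

HB.instance Definition _ := [isSub for sqint_val].
HB.instance Definition _ := [Choice of sqint_fun by <:].
HB.instance Definition _ := [SubChoice_isSubLmodule of sqint_fun by <:].

Definition ae_null : {pred sqint_fun} :=
  [pred f : sqint_fun | `[< {ae mu, forall x, f x = 0} >] ].

Fact ae_null_zmod_closed : zmod_closed ae_null.
Proof.
split; first by apply/asboolP; apply: aeW.
move=> f g /asboolP f0 /asboolP g0; apply/asboolP.
by apply: filterS2 f0 g0 => x; rewrite /= !fctE => -> ->; rewrite subrr.
Qed.

HB.instance Definition _ :=
  GRing.isZmodClosed.Build sqint_fun ae_null ae_null_zmod_closed.

Definition L2 := Quotient.quot ae_null.
HB.instance Definition _ := GRing.Zmodule.on L2.
HB.instance Definition _ := @EqQuotient.on L2.

Let L2_scale (a : R[i]) (u : L2) : L2 := \pi_L2 (a *: repr u).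

Let pi_scale a (f : sqint_fun) :
  L2_scale a (\pi_L2 f) = \pi_L2 (a *: f : sqint_fun).
Proof.
apply/eqP; rewrite /L2_scale piE Quotient.equivE.
rewrite -scalerBr; have : repr (\pi_L2 f) - f \in ae_null.
  by rewrite Quotient.idealrBE reprK.
move=> /asboolP f0; apply/asboolP; apply: filterS f0 => x fx.
by transitivity (a * (repr (\pi_L2 f) - f) x); [|rewrite fx mulr0].
Qed.

Let piD (f g : sqint_fun) : \pi_L2 (f + g) = \pi_L2 f + \pi_L2 g.
Proof. exact: Quotient.pi_add. Qed.

Let piP (u : L2) : exists f : sqint_fun, u = \pi_L2 f.
Proof. by exists (repr u); rewrite reprK. Qed.

Let L2_scaleA a b u : L2_scale a (L2_scale b u) = L2_scale (a * b) u.
Proof. by have [f ->] := piP u; rewrite !pi_scale scalerA. Qed.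

Let L2_scale1 : left_id 1 L2_scale.
Proof. by move=> u; have [f ->] := piP u; rewrite pi_scale scale1r. Qed.

Let L2_scaleDr : right_distributive L2_scale +%R.
Proof.
move=> a u v; have [f ->] := piP u; have [g ->] := piP v.
by rewrite -piD !pi_scale scalerDr piD.
Qed.

Let L2_scaleDl u : {morph L2_scale^~ u : a b / a + b}.
Proof.
by move=> a b; have [f ->] := piP u; rewrite !pi_scale scalerDl piD.
Qed.

HB.instance Definition _ := GRing.Zmodule_isLmodule.Build R[i] L2
  L2_scaleA L2_scale1 L2_scaleDr L2_scaleDl.

End L2.

Section euclidean_space.
Context (R : realType) (d : nat).
Implicit Types (x y : 'rV[R]_d) (f : 'rV[R]_d -> R).

(* The norm that MathComp-Analysis puts on 'rV[R]_d is the sup norm, hence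
   these Euclidean versions. *)
Definition eucl_norm x : R := Num.sqrt (\sum_i x ord0 i ^+ 2).

Definition eucl_ball x (r : R) : set 'rV[R]_d :=
  [set y | eucl_norm (y - x) < r].

Definition infty_nbhs : set_system 'rV[R]_d :=
  filter_from [set: R] (fun M => [set x | M < eucl_norm x]).

Global Instance infty_nbhs_filter : Filter infty_nbhs.
Proof.
apply: filter_from_filter; first by exists 0.
move=> M N _ _; exists (Num.max M N) => // x /=.
by rewrite gt_max => /andP[].
Qed.

Canonical infty_nbhs_filter_on := FilterType infty_nbhs infty_nbhs_filter.

Definition partial (i : 'I_d) f : 'rV[R]_d -> R := fun x => 'D_('e_i) f x.

Fixpoint cont_diff (k : nat) f : Prop :=
  continuous f /\
  if k is m.+1 then
    forall i, (forall x, derivable f x 'e_i) /\ cont_diff m (partial i f)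
  else True.

Definition grad f : 'rV[R]_d -> 'rV[R]_d := fun x => \row_i partial i f x.

Definition laplacian f : 'rV[R]_d -> R :=
  fun x => \sum_i partial i (partial i f) x.

Definition test_function f : Prop :=
  (forall k, cont_diff k f) /\ compact (closure [set x | f x != 0]).

Local Notation mu := (@lebesgue_rV R d).

Definition mean_value f (A : set 'rV[R]_d) : R :=
  (fine (mu A))^-1 * \int[mu]_(y in A) f y.

Definition kappa x : R :=
  (fine (mu (eucl_ball 0 1)))^-1 * \1_(eucl_ball 0 1) x.

Definition kappa_ (r : R) x : R := r ^- d * kappa (r^-1 *: x).

Definition convolution f g x : R := \int[mu]_y (f y * g (x - y)).

End euclidean_space.

Arguments infty_nbhs : clear implicits.

Section L2_inner_product.
Context (R : realType) (d : nat).
Local Notation mu := (@lebesgue_rV R d).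

Definition complex_integral (f : 'rV[R]_d -> R[i]) : R[i] :=
  Complex (\int[mu]_x complex.Re (f x)) (\int[mu]_x complex.Im (f x)).

Definition L2_dot (u v : L2 R d) : R[i] :=
  complex_integral (fun x => repr u x * (repr v x)^*%C).

End L2_inner_product.

(* Unbounded operators: [op] is only meaningful on [dom]. *)
Record operator (H : Type) := Operator { dom : set H ; op :> H -> H }.

Section hilbert_operators.
Context (R : realType) (H : lmodType R[i]) (dot : H -> H -> R[i]).
Implicit Types A S : operator H.

Definition hnorm (x : H) : R := Num.sqrt (complex.Re (dot x x)).

Definition linear_operator A : Prop :=
  forall (a : R[i]) x y, dom A x -> dom A y ->
    dom A (a *: x + y) /\ A (a *: x + y) = a *: A x + A y.

Definition densely_defined A : Prop :=
  forall x (e : R), 0 < e -> exists2 y, dom A y & hnorm (x - y) < e.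

Definition adjoint_graph A (x z : H) : Prop :=
  forall y, dom A y -> dot (A y) x = dot y z.

Definition self_adjoint A : Prop :=
  [/\ linear_operator A, densely_defined A &
      forall x z, adjoint_graph A x z <-> dom A x /\ A x = z].

Definition nonneg_operator A : Prop := forall x, dom A x -> 0 <= dot (A x) x.

Definition is_operator_sqrt A S : Prop :=
  [/\ self_adjoint S, nonneg_operator S,
      dom A = [set x | dom S x /\ dom S (S x)] &
      forall x, dom A x -> A x = S (S x)].

(* A normed space is given here by a subspace [D] of [H] (which need not carry
   the norm of [H]) together with a norm [N] on [D]. *)
Definition op_norm (D : set H) (N : H -> R) (F : H -> H) : \bar R :=
  ereal_sup [set (N (F x))%:E | x in [set x | D x /\ N x <= 1]].

Record C0_semigroup (D : set H) (N : H -> R) (T : R -> H -> H) : Prop := {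
  semigroup_stable : forall t x, 0 <= t -> D x -> D (T t x) ;
  semigroup_linear : forall t (a : R[i]) x y, 0 <= t -> D x -> D y ->
    T t (a *: x + y) = a *: T t x + T t y ;
  semigroup_bounded : forall t, 0 <= t -> (op_norm D N (T t) < +oo)%E ;
  semigroup0 : forall x, D x -> T 0 x = x ;
  semigroupD : forall s t x, 0 <= s -> 0 <= t -> D x ->
    T (s + t) x = T s (T t x) ;
  semigroup_cont : forall x, D x -> N (T t x - x) @[t --> 0^'+] --> (0 : R) }.

Definition is_generator (D : set H) (N : H -> R) (T : R -> H -> H) A : Prop :=
  forall x y, (dom A x /\ A x = y) <->
    [/\ D x, D y &
        N ((t^-1)%:C%C *: (T t x - x) - y) @[t --> 0^'+] --> (0 : R)].

End hilbert_operators.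

Section damped_wave.
Context (R : realType) (d : nat).
Local Notation mu := (@lebesgue_rV R d).
Local Notation L2 := (L2 R d).
Implicit Types (V b : 'rV[R]_d -> R) (S : operator L2).

(* (V - 1/2 Delta) u = f in the sense of distributions. Real test functions
   suffice, by linearity. This determines f as an element of L2. *)
Definition weak_schrodinger V (u f : L2) : Prop :=
  forall phi : 'rV[R]_d -> R, test_function phi ->
    complex_integral (fun x =>
      repr u x * (V x * phi x - 2^-1 * laplacian phi x)%:C%C) =
    complex_integral (fun x => repr f x * (phi x)%:C%C).

Definition schrodinger V : operator L2 :=
  Operator [set u | exists f, weak_schrodinger V u f]
           (fun u => xget 0 [set f : L2 | weak_schrodinger V u f]).

(* For b in L^oo there is exactly one such class. *)
Definition mul_op b (v : L2) : L2 :=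
  xget 0 [set f : L2 | {ae mu, forall x, repr f x = (b x)%:C%C * repr v x}].

Definition energy_space S : set (L2 * L2)%type := [set U | dom S U.1].

Definition energy_dot S (U W : L2 * L2) : R[i] :=
  L2_dot (S U.1) (S W.1) + L2_dot U.2 W.2.

Definition energy_norm S (U : L2 * L2) : R := hnorm (energy_dot S) U.

Definition damped_wave_op V b S : operator (L2 * L2)%type :=
  Operator [set U | dom (schrodinger V) U.1 /\ dom S U.2]
           (fun U => (U.2, - schrodinger V U.1 - mul_op b U.2)).

(* [S] is P^{1/2} and [T t] is e^{t A_b}. For V >= 0 tending to infinity and b
   in L^oo both exist, and the conditions imposed on them determine S, as well
   as T t for t >= 0 on the energy space. *)
Definition uniformly_stable V b : Prop :=
  exists (S : operator L2) (T : R -> L2 * L2 -> L2 * L2),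
    [/\ is_operator_sqrt (@L2_dot R d) (schrodinger V) S,
        C0_semigroup (energy_space S) (energy_norm S) T,
        is_generator (energy_space S) (energy_norm S) T (damped_wave_op V b S) &
        exists C tau : R, [/\ 0 < C, 0 < tau & forall t, 0 <= t ->
          (op_norm (energy_space S) (energy_norm S) (T t) <=
           (C * expR (- t / tau))%:E)%E]].

Definition uniform_geometric_control b : Prop :=
  exists T c : R, [/\ 0 < T, 0 < c &
    forall (x0 nu0 : 'rV[R]_d) (r : R), eucl_norm nu0 = 1 -> 0 < r ->
      c <= (2 * T)^-1 * \int[lebesgue_measure]_(t in `[- T, T])
                          convolution b (kappa_ r) (x0 + t *: nu0)].

Definition turning_point_condition V b : Prop :=
  exists2 r : R, 0 < r &
    (0 < limf_einf (fun x : 'rV[R]_d =>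
       (mean_value b (eucl_ball x (r / V x `^ 4^-1)))%:E) (infty_nbhs R d))%E.

End damped_wave.

(* Main.v *)
(* Summing backward Euler steps against the exponential decay of the semigroup
   gives a bound of the energy norm of [U] by that of [(A_b - i l) U], uniformly
   in the real number [l]. Taking for [U] a quasimode [u = a(x) exp(i th.x)] with
   velocity [i l u] yields, with a constant [K] independent of [l], [th] and of
   the real compactly supported amplitude [a],
     l^2 |a|^2 <= K (|(V + |th|^2/2 - l^2) a - (Laplacian a)/2|^2
                     + 2 l^2 |b a|^2 + 2 |th . grad a|^2)       (norms of L^2).
   Geometric control: for [th = sqrt 2 l nu] and l -> oo only [b a] and
   [nu . grad a] survive; a bump on an ellipsoid of axis [nu], long in that
   direction and of arbitrary width, makes the latter negligible. So [b] has
   mass comparable to the volume of each such ellipsoid, and by Tonelli's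
   theorem the line average of [b * kappa_r] bounds this mass from above.
   Turning points: for [th = 0], [l^2 = V x0] and a bump on the ball of radius
   R / V(x0)^(1/4) about x0, the Laplacian contributes V(x0) / R^4 and
   V - V(x0) contributes o(V(x0)); for R and x0 large only [b a] survives. *)
From HB Require Import structures.
Require Import Defs.
From mathcomp Require Import all_boot all_order all_algebra.
From mathcomp Require Import generic_quotient ring_quotient.
From mathcomp Require Import all_classical all_reals all_analysis.
From mathcomp Require Import measurable_realfun ess_sup_inf complex ring lra.
Import Order.TTheory GRing.Theory Num.Theory.
Import numFieldNormedType.Exports.

Set Implicit Arguments.
Unset Strict Implicit.
Unset Printing Implicit Defensive.

Local Open Scope classical_set_scope.
Local Open Scope ring_scope.
Local Open Scope quotient_scope.

(** * Resolvent bound for exponentially stable semigroups *)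

(** The point that shapes the proof is uniformity. In the limit l -> oo the amplitude stays fixed,
    so the sizes of V a and of its Laplacian do not matter and the limiting constant keeps no memory
    of the width of a. Only the length L of the ellipsoid must exceed a threshold, and this is what
    gives control for every r > 0 with the same T and c. Ellipsoids are preferred to cylinders
    because their defining function is a quadratic polynomial: the bump is one function of one real
    variable composed with it, and its derivative along the axis involves L only. For L = rho they
    are balls, so one construction also serves at turning points. Volumes of ellipsoids are
    estimated by Tonelli's theorem along the axis, with no linear change of variables; constants
    depending only on the dimension are not tracked sharply. Since b is bounded and non-negative
    only almost everywhere, it is replaced by a version b' bounded everywhere before any pointwise
    estimate. *)

Section semigroup_resolvent.
Context (R : realType) (H : lmodType R[i]) (D : set H) (N : H -> R).
Hypothesis D_lin : forall (a : R[i]) x y, D x -> D y -> D (a *: x + y).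
Hypothesis D0 : D 0.
Hypothesis N_ge0 : forall x, 0 <= N x.
Hypothesis ND : forall x y, D x -> D y -> N (x + y) <= N x + N y.
Hypothesis NZ : forall (a : R[i]) x, D x -> N (a *: x) = complex.Re `|a| * N x.

Let DZ a x : D x -> D (a *: x).
Proof. by move=> Dx; rewrite -[_ *: _]addr0; exact: D_lin. Qed.

Let DD x y : D x -> D y -> D (x + y).
Proof. by move=> Dx Dy; rewrite -[x]scale1r; exact: D_lin. Qed.

Let DB x y : D x -> D y -> D (x - y).
Proof. by move=> Dx Dy; rewrite -scaleN1r; apply: DD => //; exact: DZ. Qed.

Let NZr (s : R) x : 0 <= s -> D x -> N (s%:C%C *: x) = s * N x.
Proof. by move=> s0 Dx; rewrite NZ// normc_def /= expr0n /= addr0 sqrtr_sqr ger0_norm. Qed.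

Variables (T : R -> H -> H).
Hypothesis HT : C0_semigroup D N T.

Let T0 t : 0 <= t -> T t 0 = 0.
Proof.
move=> t0; have := semigroup_linear HT 1 t0 D0 D0.
by rewrite !scale1r addr0 => /eqP; rewrite -subr_eq0 opprD addNKr oppr_eq0 => /eqP.
Qed.

Let TZ t a x : 0 <= t -> D x -> T t (a *: x) = a *: T t x.
Proof.
move=> t0 Dx; have := semigroup_linear HT a t0 Dx D0.
by rewrite !addr0 T0// addr0.
Qed.

Lemma op_norm_bound t M x : 0 <= t -> (op_norm D N (T t) <= M%:E)%E -> D x ->
  N (T t x) <= M * N x.
Proof.
move=> t0 TM Dx.
have le (s : R) : 0 <= s -> s * N x <= 1 -> s * N (T t x) <= M.
  move=> s0 sN; rewrite -NZr//; last exact: (semigroup_stable HT).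
  rewrite -TZ// -lee_fin; apply: le_trans TM; apply: ereal_sup_ubound.
  by exists (s%:C%C *: x) => //; split; [exact: DZ|rewrite NZr].
(* [N] is only a seminorm here. If [N x = 0], every multiple of [x] lies in the unit ball, so all
   multiples of [N (T t x)] stay below [M]. *)
have [Nx0|Nx0] := eqVneq (N x) 0.
  rewrite Nx0 mulr0 leNgt; apply/negP => NT.
  have := le ((`|M| + 1) / N (T t x)) _ _.
  rewrite Nx0 mulr0 divfK ?gt_eqF// => /(_ _ _) h.
  have : `|M| + 1 <= M by apply: h; rewrite ?ler01// divr_ge0// addr_ge0.
  by apply/negP; rewrite -ltNge (le_lt_trans (ler_norm M))// ltrDl.
have := le (N x)^-1 _ _; rewrite mulVf// invr_ge0 N_ge0 => /(_ isT (lexx _)).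
by rewrite mulrC ler_pdivrMr// lt_neqAle eq_sym Nx0 N_ge0.
Qed.

Variables (A : operator H) (C tau : R).
Hypothesis HA : is_generator D N T A.
Hypothesis C_gt0 : 0 < C.
Hypothesis tau_gt0 : 0 < tau.
Hypothesis TC : forall t, 0 <= t ->
  (op_norm D N (T t) <= (C * expR (- t / tau))%:E)%E.

Let TN t x : 0 <= t -> D x -> N (T t x) <= C * expR (- t / tau) * N x.
Proof. by move=> t0; apply: op_norm_bound => //; exact: TC. Qed.

Let TNC t x : 0 <= t -> D x -> N (T t x) <= C * N x.
Proof.
move=> t0 Dx; apply: le_trans (TN t0 Dx) _; apply: ler_wpM2r => //.
rewrite ger_pMr// expR_le1 mulNr oppr_le0 divr_ge0//; exact: ltW.
Qed.

(* Backward Euler factor (1 + i l d)^-1 in place of exp(- i l d): it suffices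
   for a telescoping sum, and needs no integral. *)
Let z (l del : R) : R[i] := (Complex 1 (l * del))^-1.

Let z_norm l del : complex.Re `|z l del| <= 1.
Proof.
rewrite /z normfV normc_def /= expr1n.
set s := Num.sqrt _.
have s1 : 1 <= s by rewrite -[leLHS]sqrtr1 ler_wsqrtr// lerDl sqr_ge0.
have s0 : 0 < s by exact: lt_le_trans s1.
by rewrite expr0n /= addr0 expr2 invfM mulrA divff ?gt_eqF// mul1r invf_le1.
Qed.

Let z_neq0 (l del : R) : Complex 1 (l * del) != 0 :> R[i].
Proof. by rewrite eq_complex /= oner_eq0. Qed.

Let NzX l del k x : D x -> N (z l del ^+ k *: x) <= N x.
Proof.
move=> Dx; elim: k => [|k IH]; first by rewrite expr0 scale1r.
rewrite exprS -scalerA NZ; last exact: DZ.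
by apply: le_trans IH; rewrite ler_piMl.
Qed.

(** Each new term is [z ^+ n *: T (n * del)] applied to the one-step increment, an operator of norm
    at most [C] because [z] has modulus at most 1. *)
Let telescope l del n x : 0 <= del -> D x ->
  N (z l del ^+ n *: T (n%:R * del) x - x) <=
  n%:R * (C * N (z l del *: T del x - x)).
Proof.
move=> del0 Dx; elim: n => [|n IH].
  rewrite expr0 scale1r !mul0r (semigroup0 HT)// subrr.
  by rewrite -(scale0r (0 : H)) NZ// normr0 mul0r.
have nd0 : 0 <= n%:R * del by rewrite mulr_ge0.
have DT t y : 0 <= t -> D y -> D (T t y).
  by move=> t0 Dy; exact: (semigroup_stable HT).
have -> : n.+1%:R * del = n%:R * del + del by rewrite -natr1 mulrDl mul1r.
have -> : z l del ^+ n.+1 *: T (n%:R * del + del) x - x =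
    z l del ^+ n *: T (n%:R * del) (z l del *: T del x - x) +
    (z l del ^+ n *: T (n%:R * del) x - x).
  rewrite (@semigroup_linear _ _ _ _ _ HT (n%:R * del) (z l del) (T del x) (- x) nd0); last 2 first.
  - exact: DT.
  - by rewrite -[- _]sub0r; exact: DB.
  have TNx : T (n%:R * del) (- x) = - T (n%:R * del) x.
    by rewrite -scaleN1r TZ// scaleN1r.
  rewrite TNx (semigroupD HT)// scalerBr scalerA -exprSr.
  by rewrite addrA subrK.
rewrite -natr1 mulrDl addrC mul1r; apply: le_trans (ND _ _) _.
- by apply: DB => //; apply: DZ; exact: DT.
- by apply: DZ; apply: (DT) => //; apply: DB => //; apply: DZ; exact: DT.
apply: lerD => //; apply: le_trans (NzX _ _ _ _) _.
  by apply: (DT) => //; apply: DB => //; apply: DZ; exact: DT.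
by apply: TNC => //; apply: DB => //; apply: DZ; exact: DT.
Qed.

(** Since 1/z = 1 + i l del, the increment is z (T x - x - i l del x) = z del (y + w), where [y] is
    the error of the difference quotient and [w] is (A - i l) x. *)
Let one_step l del x : 0 < del -> dom A x ->
  N (z l del *: T del x - x) <= del * (N ((del^-1)%:C%C *: (T del x - x) - A x)
     + N (A x - (Complex 0 l) *: x)).
Proof.
move=> del0 Ax; have [Dx DAx _] := (HA x (A x)).1 (conj Ax erefl).
have DTx : D (T del x) by apply: (semigroup_stable HT) => //; exact: ltW.
set y := _ - A x; set w := A x - _.
have Dy : D y by apply: DB => //; apply: DZ; exact: DB.
have Dw : D w by apply: DB => //; exact: DZ.
have -> : z l del *: T del x - x = z l del *: (del%:C%C *: (y + w)).
  rewrite /y /w addrA subrK scalerBr !scalerA.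
  have -> : del%:C%C * (del^-1)%:C%C = 1 :> R[i].
    by rewrite -rmorphM /= divff ?gt_eqF.
  have -> : del%:C%C * Complex 0 l = Complex 1 (l * del) - 1 :> R[i].
    by apply/eqP; rewrite eq_complex /= !mul0r mulr0 !subr0 addr0 subrr mulrC !eqxx.
  rewrite scale1r scalerBl scale1r opprB addrA subrK.
  by rewrite scalerBr scalerA mulVf// scale1r.
rewrite NZ; last by apply: DZ; exact: DD.
apply: (@le_trans _ _ (N (del%:C%C *: (y + w)))).
  by rewrite ler_piMl.
rewrite (NZr (ltW del0)); last exact: DD.
by rewrite ler_pM2l// ND.
Qed.

(** Take t with C exp(- t / tau) <= 1/2. Then z^n T(t) x has norm at most N x / 2 and is absorbed,
    while the n steps of length t/n add up to at most C t (N ((A - i l) x) + o(1)). The modulus of z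
    being at most 1 makes this uniform in l. *)
Lemma resolvent_bound : exists2 K : R, 0 < K & forall (l : R) x, dom A x ->
  N x <= K * N (A x - (Complex 0 l) *: x).
Proof.
pose t := Num.max 1 (tau * ln (2 * C)).
have t0 : 0 < t by rewrite lt_max ltr01.
have Ct : C * expR (- t / tau) <= 2^-1.
  have : tau * ln (2 * C) <= t by rewrite le_max lexx orbT.
  rewrite -ler_pdivlMl// [tau^-1 * _]mulrC => h.
  have : expR (ln (2 * C)) <= expR (t / tau) by rewrite ler_expR.
  rewrite lnK ?posrE ?mulr_gt0// mulNr expRN => h2.
  rewrite ler_pdivrMr ?expR_gt0//; lra.
exists (2 * C * t); first by rewrite !mulr_gt0.
move=> l x Ax; have [Dx DAx lim] := (HA x (A x)).1 (conj Ax erefl).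
set w := N (_ - _); apply/ler_addgt0Pr => e e0.
have e'0 : 0 < e / (2 * C * t) by rewrite divr_gt0// !mulr_gt0.
move/cvgrPdist_lt : lim => /(_ _ e'0) /=.
rewrite near_withinE => -[del1 /= del10 hdel].
have [n nt] : exists n : nat, t / n.+1%:R < del1.
  exists (Num.trunc (t / del1)).
  have := truncnS_gt (t / del1).
  by rewrite ltr_pdivrMr// ltr_pdivrMr ?ltr0n// mulrC.
set del := t / n.+1%:R in nt.
have del0 : 0 < del by rewrite divr_gt0.
have tn : n.+1%:R * del = t by rewrite mulrC divfK// pnatr_eq0.
have := hdel del; rewrite /ball_ /= !sub0r !normrN gtr0_norm// => /(_ nt del0).
rewrite ger0_norm// => small.
have DT : D (T t x) by apply: (semigroup_stable HT) => //; exact: ltW.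
have h1 := telescope l n.+1 (ltW del0) Dx.
rewrite tn in h1.
have h2 := one_step l del0 Ax.
have h3 : N x <= N (z l del ^+ n.+1 *: T t x) +
   N (z l del ^+ n.+1 *: T t x - x).
  have -> : N (z l del ^+ n.+1 *: T t x - x) =
      N (x - z l del ^+ n.+1 *: T t x).
    by rewrite -[in LHS](opprB x) -[in LHS](scaleN1r (x - _)) NZ ?normrN1 ?mul1r//; apply: DB => //; exact: DZ.
  have := ND (DZ (z l del ^+ n.+1) DT) (DB Dx (DZ (z l del ^+ n.+1) DT)).
  by rewrite addrC subrK.
have h4 : N (z l del ^+ n.+1 *: T t x) <= 2^-1 * N x.
  apply: le_trans (NzX _ _ _ DT) _; apply: le_trans (TN (ltW t0) Dx) _.
  by rewrite ler_wpM2r.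
have h5 : n.+1%:R * (C * N (z l del *: T del x - x)) <=
    C * t * (e / (2 * C * t) + w).
  rewrite mulrCA -mulrA ler_pM2l// -[leRHS]mulrC -tn.
  rewrite [leRHS]mulrC -[leRHS]mulrA ler_pM2l ?ltr0n//.
  apply: le_trans h2 _; rewrite ler_pM2l// lerD2r tn; exact: ltW.
have h6 : C * t * (e / (2 * C * t)) = e / 2.
  by field; rewrite !gt_eqF.
rewrite mulrDr h6 in h5.
have h7 : N x <= 2^-1 * N x + (e / 2 + C * t * w).
  apply: le_trans h3 _; apply: lerD => //; exact: le_trans h1 h5.
rewrite -!mulrA -/w in h7 *; lra.
Qed.

End semigroup_resolvent.

(** * Lebesgue measure on row vectors *)

Section boxes.
Context (R : realType).
Local Notation mu := (@lebesgue_rV R _).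

Definition box n (a b : 'rV[R]_n) : set 'rV[R]_n :=
  [set x | forall i, x ord0 i \in `]a ord0 i, b ord0 i]].

Lemma measurable_box n (a b : 'rV[R]_n) : measurable (box a b).
Proof.
have -> : box a b = \bigcap_(i in [set: 'I_n])
    ((fun x : 'rV[R]_n => x ord0 i : measurableTypeR R) @^-1`
      [set` `]a ord0 i, b ord0 i]]).
  by apply/seteqP; split => [x xab i _|x xab i]; exact: xab.
apply: fin_bigcap_measurable => //.
move=> i _; rewrite -[X in measurable X]setTI; apply: measurable_coord => //.
Qed.

Lemma mu_box n (a b : 'rV[R]_n) :
  mu (box a b) = (\prod_(i < n) Num.max 0 (b ord0 i - a ord0 i))%:E.
Proof.
elim: n a b => [|n IH] a b.
  by rewrite big_ord0 /= diracE mem_set// => -[].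
pose tl (x : 'rV[R]_n.+1) : 'rV[R]_n := \row_i x ord0 (lift ord0 i).
rewrite /= /lebesgue_step /pushforward.
have -> : @cons_rV R n @^-1` box a b =
    [set` `]a ord0 ord0, b ord0 ord0]] `*` box (tl a) (tl b).
  apply/seteqP; split => [[x y]|[x y] [/= xab yab] i].
    move=> h; split => /=; first by have := h ord0; rewrite mxE unlift_none.
    by move=> i; have := h (lift ord0 i); rewrite !mxE liftK.
  by rewrite !mxE; case: unliftP => [j ->|->] //=; have := yab j; rewrite !mxE.
rewrite product_measure1E//; last exact: measurable_box.
rewrite IH big_ord_recl EFinM; congr (_ * _)%E.
  rewrite -[LHS]/(lebesgue_measure `]a ord0 ord0, b ord0 ord0]%classic) lebesgue_measure_itv /= lte_fin.
  case: ltP => ab; last by rewrite max_l// subr_le0.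
  by rewrite max_r ?subr_ge0 ?ltW// EFinB.
by congr EFin; apply: eq_bigr => i _; rewrite !mxE.
Qed.

Lemma boxI n (a b a' b' : 'rV[R]_n) : box a b `&` box a' b' =
  box (\row_i Num.max (a ord0 i) (a' ord0 i))
      (\row_i Num.min (b ord0 i) (b' ord0 i)).
Proof.
apply/seteqP; split => [x [xab xab'] i|x h].
  have := xab i; have := xab' i; rewrite !in_itv /= !mxE.
  by rewrite gt_max le_min => /andP[-> ->] /andP[-> ->].
by split => i; have := h i; rewrite !in_itv /= !mxE gt_max le_min;
  move=> /andP[/andP[? ?] /andP[? ?]]; apply/andP.
Qed.

Definition cube n (c : 'rV[R]_n) (r : R) : set 'rV[R]_n :=
  box (\row_i (c ord0 i - r)) (\row_i (c ord0 i + r)).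

Lemma in_cube n (c : 'rV[R]_n) r x :
  cube c r x <-> forall i, c ord0 i - r < x ord0 i <= c ord0 i + r.
Proof. by split => h i; have := h i; rewrite in_itv /= !mxE. Qed.

Lemma cube_cover n : \bigcup_k cube (0 : 'rV[R]_n) k%:R = setT.
Proof.
apply/seteqP; split => // x _.
exists (Num.trunc (\sum_i `|x ord0 i|)).+1 => //; apply/in_cube => i.
rewrite mxE sub0r add0r.
have : `|x ord0 i| < (Num.trunc (\sum_i `|x ord0 i|)).+1%:R.
  apply: le_lt_trans (truncnS_gt _).
  by rewrite (bigD1 i)//= lerDl sumr_ge0.
by rewrite ltr_norml => /andP[-> /ltW].
Qed.

Lemma mu_cube n (c : 'rV[R]_n) r : 0 <= r -> mu (cube c r) = ((2 * r) ^+ n)%:E.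
Proof.
move=> r0; rewrite mu_box; congr EFin.
rewrite -[in RHS](card_ord n) -prodr_const; apply: eq_bigr => i _.
by rewrite !mxE opprB addrC subrKA -mulr2n mulr_natl max_r// mulrn_wge0.
Qed.

Lemma rV_measurableE n :
  measurable = <<s [set box a b | a in [set: 'rV[R]_n] & b in setT] >>.
Proof.
apply/seteqP; split; last first.
  apply: smallest_sub; first exact: sigma_algebra_measurable.
  by move=> _ [a _ [b _ <-]]; exact: measurable_box.
apply: smallest_sub; first exact: smallest_sigma_algebra.
rewrite -bigcup_seq => _ [i _] [C mC <-] /=; rewrite setTI.
set G := [set box a b | a in _ & b in _].
have : @measurable _ (measurableTypeR R) `<=`
   [set A | <<s G >> ((fun x : 'rV[R]_n => x ord0 i) @^-1` A)]; last exact.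
have sG := smallest_sigma_algebra setT G.
apply: smallest_sub => /=.
  split => [|A|F mF] /=.
  - by rewrite preimage_set0; exact: sigma_algebra0.
  - by rewrite setTD preimage_setC; exact: sigma_algebraC.
  - by rewrite preimage_bigcup; exact: sigma_algebra_bigcup.
move=> _ [[u v] uv <-] /=.
(* The slab is exhausted by boxes with fixed i-th side and all other sides growing. *)
have -> : (fun x : 'rV[R]_n => x ord0 i) @^-1` `]u, v]%classic = \bigcup_k
   box (\row_j if j == i then u else - k%:R) (\row_j if j == i then v else k%:R).
  apply/seteqP; split => x /=.
    move=> xi; have : (\bigcup_k cube (0 : 'rV[R]_n) k%:R) x by rewrite cube_cover.
    move=> [k _ /in_cube xk]; exists k => // j; have := xk j; rewrite !mxE.
    by case: eqVneq => [->|_] //; rewrite in_itv/= !sub0r !add0r.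
  by move=> [k _ h]; have := h i; rewrite !mxE eqxx.
apply: sigma_algebra_bigcup => k; apply: sub_sigma_algebra.
by do 2 eexists => //.
Qed.

(** Half-open boxes are stable under intersection, generate the sigma-algebra and contain cubes of
    finite measure that exhaust the space. *)
Lemma rV_measure_unique n (m1 m2 : {measure set 'rV[R]_n -> \bar R}) :
  (forall a b, m1 (box a b) = m2 (box a b)) ->
  (forall k : nat, m1 (cube 0 k%:R) < +oo)%E ->
  forall A, measurable A -> m1 A = m2 A.
Proof.
move=> m12 fin A mA.
apply: (measure_unique _ (fun k => cube (0 : 'rV[R]_n) k%:R) (rV_measurableE n)) => //.
- by move=> _ _ [a _ [b _ <-]] [a' _ [b' _ <-]]; rewrite boxI; do 2 eexists.
- by move=> k; do 2 eexists.
- exact: cube_cover.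
- by move=> _ [a _ [b _ <-]].
Qed.

Lemma measurable_shift n (v : 'rV[R]_n) : measurable_fun setT (fun x : 'rV[R]_n => x + v).
Proof.
apply: measurable_fun_rV => i; under eq_fun do rewrite mxE.
by apply: measurable_realfun.measurable_funD => //; exact: measurable_coord.
Qed.

Lemma mu_shift n (v : 'rV[R]_n) A : measurable A ->
  mu ((fun x : 'rV[R]_n => x + v) @^-1` A) = mu A.
Proof.
move=> mA; apply/esym.
pose m := measure_function_pushforward__canonical__measure_function_Measure
   (@lebesgue_rV R n) (measurable_shift v).
rewrite -[RHS]/(m A).
apply: (@rV_measure_unique n (@lebesgue_rV R n) m) => //; last first.
  by move=> k; rewrite [X in (X < _)%E](mu_cube 0 (ler0n R k)) ltry.
move=> a b; rewrite /m /= /pushforward.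
have -> : (fun x => x + v) @^-1` box a b = box (a - v) (b - v).
  by apply/seteqP; split => x h i; have := h i;
    rewrite !in_itv/= !mxE ltrBlDr lerBrDr.
rewrite !mu_box; congr EFin; apply: eq_bigr => i _; rewrite !mxE.
by rewrite opprB addrA subrK.
Qed.

End boxes.

(** * Continuous functions of bounded support and their integrals *)

Section continuous_functions_rV.
Context (R : realType) (n : nat).
Local Notation mu := (@lebesgue_rV R n).
Implicit Types (f g : 'rV[R]_n -> R) (x v : 'rV[R]_n).

Lemma measurable_cube x r : measurable (cube x r).
Proof. exact: measurable_box. Qed.

(** The sigma-algebra comes from the coordinates and not from the topology. The link is that an open
    set is a countable union of cubes with rational centre and radius 1/(k+1). *)
Lemma measurable_open_rV (U : set 'rV[R]_n) : open U -> measurable U.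
Proof.
move=> oU.
pose F (qk : 'rV[rat]_n * nat) : set 'rV[R]_n :=
  let C := cube (map_mx ratr qk.1) qk.2.+1%:R^-1 in
  if `[< C `<=` U >] then C else set0.
have -> : U = \bigcup_qk F qk.
  apply/seteqP; split => [x Ux|x [qk _]]; last first.
    by rewrite /F; case: asboolP => // CU /CU.
  have [e /= e0 eU] := (nbhs_ballP _ _).1 (open_nbhs_nbhs (conj oU Ux)).
  have [k ke] : exists k : nat, k.+1%:R^-1 < e / 4.
    exists (Num.trunc (4 / e)).
    rewrite -(invf_div 4 e) ltf_pV2 ?posrE ?divr_gt0//; exact: truncnS_gt.
  pose r : R := k.+1%:R^-1.
  have r0 : 0 < r by rewrite invr_gt0 ltr0n.
  have qx i : exists q : rat, (ratr q : R) \in `]x ord0 i - r, x ord0 i + r[.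
    by apply: rat_in_itvoo; lra.
  pose q : 'rV[rat]_n := \row_i sval (cid (qx i)).
  have hq i : x ord0 i - r < ratr (q ord0 i) < x ord0 i + r.
    by rewrite mxE; case: cid => /= y; rewrite in_itv.
  exists (q, k) => //; rewrite /F /= -/r.
  have xC : cube (map_mx ratr q) r x.
    by apply/in_cube => i; rewrite mxE; have /andP[h1 h2] := hq i; apply/andP; split; lra.
  rewrite asboolT// => y yC; apply: eU; split=> // i j; rewrite ord1.
  have /in_cube/(_ j)/andP[] := yC; rewrite mxE => h1 h2.
  have /in_cube/(_ j)/andP[] := xC; rewrite mxE => h3 h4.
  rewrite /ball /= ltr_norml; apply/andP; split; rewrite -/r in ke; lra.
apply: countable_bigcupT_measurable => // qk.
by rewrite /F; case: ifP => // _; exact: measurable_cube.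
Qed.

Lemma continuous_measurable_rV f : continuous f -> measurable_fun setT f.
Proof.
move=> /continuousP cf; apply: (measurability _ (measurable_realfun.RGenOpens.measurableE R)).
move=> _ [_ [a [b ->] <-]]; rewrite setTI; apply: measurable_open_rV.
exact/cf/interval_open.
Qed.

(* Vanishing outside some cube: for continuous functions, compact support. *)
Definition bsupp (T : nmodType) (f : 'rV[R]_n -> T) : Prop :=
  exists M : nat, forall x, f x != 0 -> cube 0 M%:R x.

Lemma integrable_cube x r : mu.-integrable setT (EFin \o \1_(cube x r)).
Proof.
apply/integrableP; split.
  by apply/measurable_EFinP; apply: measurable_indic; exact: measurable_cube.
rewrite (_ : (fun y => _) = EFin \o \1_(cube x r)); last first.
  by apply/funext => y /=; rewrite ger0_norm// indicE.
rewrite integral_indic ?setIT//; last exact: measurable_cube.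
have /le_lt_trans -> // : (mu (cube x r) <= mu (cube x `|r|))%E.
  apply: le_measure; rewrite ?inE//; try exact: measurable_cube.
  move=> y /in_cube h; apply/in_cube => i; have /andP[h1 h2] := h i.
  have := ler_norm r; move=> h3; apply/andP; split; lra.
by rewrite mu_cube// ltry.
Qed.

Lemma bsupp_integrable f B : measurable_fun setT f ->
  (forall x, `|f x| <= B) -> bsupp f -> mu.-integrable setT (EFin \o f).
Proof.
move=> mf fB [M fM].
apply: (@le_integrable _ _ _ mu setT _ _ (EFin \o (fun x => B * \1_(cube 0 M%:R) x))) => //.
- exact/measurable_EFinP.
- move=> x _ /=; rewrite lee_fin.
  have B0 : 0 <= B by exact: le_trans (fB x).
  have [->|fx] := eqVneq (f x) 0; first by rewrite normr0.
  by rewrite indicE mem_set ?mulr1; [exact: le_trans (fB x) (ler_norm _)|exact: fM].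
- exact: (integrableZl measurableT B (integrable_cube 0 M%:R)).
Qed.

Lemma bsupp_bounded f : continuous f -> bsupp f ->
  exists2 B, 0 < B & forall x, `|f x| <= B.
Proof.
move=> cf [M fM].
pose K : set 'rV[R]_n := [set v | forall i, `[- M%:R, M%:R]%classic (v ord0 i)].
have cK : compact K.
  apply: (@rV_compact R n (fun _ => `[- M%:R, M%:R]%classic)) => i.
  exact: segment_compact.
have /compact_bounded[B [_ hB]] : compact (f @` K).
  by apply: continuous_compact => //; exact: continuous_subspaceT.
exists (`|B| + 1); first by rewrite ltr_wpDl.
move=> x; have [->|fx] := eqVneq (f x) 0; first by rewrite normr0 addr_ge0.
apply: (hB _ _ (f x)); first by rewrite (le_lt_trans (ler_norm B))// ltrDl.
exists x => // i; have /in_cube/(_ i) := fM _ fx; rewrite mxE sub0r add0r.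
by rewrite /= in_itv /= => /andP[/ltW -> ->].
Qed.

Definition Cc f := continuous f /\ bsupp f.

Lemma Cc_integrable f : Cc f -> mu.-integrable setT (EFin \o f).
Proof.
move=> [cf sf]; have [B _ fB] := bsupp_bounded cf sf.
by apply: (bsupp_integrable _ fB) => //; exact: continuous_measurable_rV.
Qed.

Lemma bsuppMl (T : pzRingType) (f g : 'rV[R]_n -> T) :
  bsupp f -> bsupp (fun x => f x * g x).
Proof.
move=> [M fM]; exists M => x fg; apply: fM; apply: contra_neq fg => ->.
by rewrite mul0r.
Qed.

Lemma bsuppMr (T : pzRingType) (f g : 'rV[R]_n -> T) :
  bsupp g -> bsupp (fun x => f x * g x).
Proof.
move=> [M fM]; exists M => x fg; apply: fM; apply: contra_neq fg => ->.
by rewrite mulr0.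
Qed.

Lemma cubeS (M N : nat) : (M <= N)%N -> cube (0 : 'rV[R]_n) M%:R `<=` cube 0 N%:R.
Proof.
move=> MN x /in_cube h; apply/in_cube => i; have /andP[h1 h2] := h i.
have : (M%:R : R) <= N%:R by rewrite ler_nat.
move=> h3; apply/andP; split; lra.
Qed.

Lemma bsuppD (T : nmodType) (f g : 'rV[R]_n -> T) :
  bsupp f -> bsupp g -> bsupp (fun x => f x + g x).
Proof.
move=> [M fM] [N gN]; exists (maxn M N) => x fg.
have [f0|/fM] := eqVneq (f x) 0; last by apply/cubeS/leq_maxl.
have [g0|/gN] := eqVneq (g x) 0; last by apply/cubeS/leq_maxr.
by move: fg; rewrite f0 g0 addr0 eqxx.
Qed.

Lemma bsuppN (T : zmodType) (f : 'rV[R]_n -> T) :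
  bsupp f -> bsupp (fun x => - f x).
Proof. by move=> [M fM]; exists M => x; rewrite oppr_eq0 => /fM. Qed.

Lemma bsupp_sum (T : nmodType) I (r : seq I) (f : I -> 'rV[R]_n -> T) :
  (forall i, bsupp (f i)) -> bsupp (fun x => \sum_(i <- r) f i x).
Proof.
move=> h; elim: r => [|i r IH].
  by exists 0%N => x; rewrite big_nil eqxx.
by under eq_fun do rewrite big_cons; apply: bsuppD.
Qed.

Lemma CcD f g : Cc f -> Cc g -> Cc (fun x => f x + g x).
Proof.
move=> [cf sf] [cg sg]; split; last exact: bsuppD.
by move=> x; exact: (cvgD (cf x) (cg x)).
Qed.

Lemma CcMl f g : Cc f -> continuous g -> Cc (fun x => f x * g x).
Proof.
move=> [cf sf] cg; split; last exact: bsuppMl.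
by move=> x; exact: (cvgM (cf x) (cg x)).
Qed.

Lemma CcMr f g : continuous f -> Cc g -> Cc (fun x => f x * g x).
Proof.
by move=> cf cg; under eq_fun do rewrite mulrC; exact: CcMl.
Qed.

Lemma CcN f : Cc f -> Cc (fun x => - f x).
Proof. by move=> [cf sf]; split; [move=> x; exact: (cvgN (cf x))|exact: bsuppN]. Qed.

Lemma Cc_sum I (r : seq I) (f : I -> 'rV[R]_n -> R) :
  (forall i, Cc (f i)) -> Cc (fun x => \sum_(i <- r) f i x).
Proof.
move=> h; elim: r => [|i r IH].
  split; last by exists 0%N => x; rewrite big_nil eqxx.
  by under eq_fun do rewrite big_nil; exact: cst_continuous.
by under eq_fun do rewrite big_cons; apply: CcD.
Qed.

Lemma Cc_shift f v : Cc f -> Cc (fun x => f (x + v)).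
Proof.
move=> [cf [M fM]]; split.
  move=> x; apply: (cvg_comp (fun x : 'rV[R]_n => x + v) f); last exact: cf.
  exact: (cvgD (@cvg_id _ (nbhs x)) (@cvg_cst _ v _ (nbhs x) _)).
have [k _ /in_cube vk] : (\bigcup_k cube (0 : 'rV[R]_n) k%:R) v by rewrite cube_cover.
exists (M + k.+1)%N => x /fM /in_cube h; apply/in_cube => i.
have := h i; have := vk i; rewrite !mxE natrD -natr1.
by move=> /andP[? ?] /andP[? ?]; apply/andP; split; lra.
Qed.

Lemma Rintegral_shift f v : Cc f -> \int[mu]_x f (x + v) = \int[mu]_x f x.
Proof.
move=> cf; rewrite /Rintegral; congr fine.
have ms := @measurable_shift R n v.
have mf : measurable_fun setT (EFin \o f).
  by apply/measurable_EFinP; apply: continuous_measurable_rV; case: cf.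
have cfv := Cc_shift v cf.
pose m := measure_function_pushforward__canonical__measure_function_Measure mu ms.
have := @integral_pushforward _ _ _ _ _ _ ms mu setT (EFin \o f) mf.
rewrite preimage_setT => /(_ (Cc_integrable cfv) measurableT) <-.
apply: (@eq_measure_integral _ _ _ setT mu m) => A mA _; exact: mu_shift.
Qed.

Lemma is_derive_line f x v (t df : R) : is_derive (t *: v + x) v f df ->
  is_derive t 1 (fun s : R => f (s *: v + x)) df.
Proof.
move=> [d1 d2].
have E : (fun h : R => h^-1 *: (((fun s : R => f (s *: v + x)) \o shift t) (h *: (1:R)) - f (t *: v + x))) =
   (fun h : R => h^-1 *: ((f \o shift (t *: v + x)) (h *: v) - f (t *: v + x))).
  by apply/funext => h /=; rewrite scalerDl scaler1 addrA.
split; first by rewrite /derivable /= in E *; rewrite E.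
by rewrite /derive /= in E d2 *; rewrite E.
Qed.

Lemma bsupp_derive f v : bsupp f -> bsupp ('D_v f).
Proof.
(* One unit of margin: the unit ball about a point outside the enlarged cube misses the support of
   [f], so [f] vanishes near that point. *)
move=> [M fM]; exists (M + 1)%N => x; apply: contraPP => nx; apply/negP; rewrite negbK.
apply/eqP.
have <- : 'D_v (cst (0 : R)) x = 0 by rewrite derive_cst.
apply: near_eq_derive.
apply/nbhs_ballP; exists 1 => //= y [_ xy]; apply: contraPP nx => /eqP /fM /in_cube h; apply.
apply/in_cube => i; have := h i; have := xy ord0 i; rewrite !mxE natrD.
by rewrite /ball /= ltr_norml => /andP[? ?] /andP[? ?]; apply/andP; split; lra.
Qed.

(** By translation invariance the integral of f(h v + x) does not depend on h; differentiate under
    the integral sign at h = 0. *)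
Lemma integral_derive f v : Cc f -> (forall x, derivable f x v) ->
  continuous ('D_v f) -> \int[mu]_x 'D_v f x = 0.
Proof.
move=> cf df cdf.
have [M fM] := bsupp_derive v cf.2.
have [B B0 fB] := bsupp_bounded cdf (bsupp_derive v cf.2).
have [k _ /in_cube vk] : (\bigcup_k cube (0 : 'rV[R]_n) k%:R) v by rewrite cube_cover.
pose F (h : R) (y : 'rV[R]_n) : R := f (h *: v + y).
have dF (h : R) (y : 'rV[R]_n) : is_derive h (1 : R) (F^~ y) ('D_v f (h *: v + y)).
  by apply: is_derive_line; apply: derivableP; exact: df.
(* Dominates the derivative for |h| < 1: the translation by h v moves its support by at most k in
   each coordinate. *)
pose G (y : 'rV[R]_n) : R := B * \1_(cube 0 (M + k)%:R) y.
have := @differentiation_under_integral R _ _ mu F setT measurableT 0 (-1) 1 _ _ _ G _ _ _.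
rewrite (_ : (fun x' : R => _) = cst (\int[mu]_x f x)); last first.
  apply/funext => h; rewrite /F -(Rintegral_shift (h *: v) cf).
  by apply: eq_Rintegral => y _; rewrite addrC.
rewrite derive1_cst => ->.
- apply: eq_Rintegral => y _; rewrite partial1of2E.
  by rewrite (@derive_val _ _ _ _ _ _ _ (dF 0 y)) scale0r add0r.
- by rewrite /= in_itv /= ltrN10 ltr01.
- move=> h _; rewrite (_ : EFin \o F h = EFin \o (fun y => f (y + h *: v))); last first.
    by apply/funext => y; rewrite /F /= addrC.
  exact/Cc_integrable/Cc_shift.
- by move=> h y _ _; apply: ex_derive.
- by move=> y; rewrite mulr_ge0// ltW.
- exact: (integrableZl measurableT B (integrable_cube 0 _)).
- move=> h y; rewrite /= in_itv /= => /andP[h1 h2] _; rewrite partial1of2E.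
  rewrite (@derive_val _ _ _ _ _ _ _ (dF h y)).
  have [->|/fM /in_cube yc] := eqVneq ('D_v f (h *: v + y)) 0.
    by rewrite normr0 mulr_ge0// ltW.
  rewrite /G indicE mem_set ?mulr1//; apply/in_cube => i; have := yc i.
  have /andP[v1 v2] := vk i; rewrite !mxE natrD => /andP[h3 h4].
  rewrite mxE sub0r add0r in v1 v2.
  have : `|h * v ord0 i| <= k%:R.
    rewrite normrM -[leRHS]mul1r ler_pM//; first by rewrite ler_norml; apply/andP; split; lra.
    by rewrite ler_norml; apply/andP; split; lra.
  by rewrite ler_norml => /andP[? ?]; apply/andP; split; lra.
Qed.

End continuous_functions_rV.

(** * Smooth compactly supported functions *)

Section smooth1.
Context (R : realType).
Implicit Types (h : R -> R) (p : {poly R}).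

Lemma cvg_is_derive (V W : normedModType R) (f : V -> W) (x v : V) (df : W) :
  (fun h : R => h^-1 *: (f (h *: v + x) - f x)) @ 0^' --> df ->
  is_derive x v f df.
Proof.
move=> fdf; have E : (fun h : R => h^-1 *: ((f \o shift x) (h *: v) - f x)) @ 0^' --> df.
  exact: fdf.
by split; [apply/cvg_ex; exists df|exact/cvg_lim].
Qed.

(* Infinitely differentiable: [h] lies in a class closed under differentiation. *)
Definition smooth1 h : Prop := exists2 C : set (R -> R), C h &
  forall f, C f -> exists2 g, C g & forall s : R, is_derive s 1 f (g s).

Lemma smooth1_derive h : smooth1 h ->
  exists2 h', smooth1 h' & forall s : R, is_derive s 1 h (h' s).
Proof.
by move=> [C Ch hC]; have [h' Ch' hh'] := hC _ Ch; exists h' => //; exists C.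
Qed.

Lemma smooth1_continuous h : smooth1 h -> continuous h.
Proof.
move=> /smooth1_derive[h' _ hh'] s; apply: differentiable_continuous.
by apply/derivable1_diffP; apply: ex_derive.
Qed.

Lemma smooth1_sin_cos : smooth1 sin /\ smooth1 cos.
Proof.
pose C := [set h | exists a b : R, h = a *: sin + b *: cos].
have hC f : C f -> exists2 g, C g & forall s : R, is_derive s 1 f (g s).
  move=> [a [b ->]]; exists (a *: cos + (- b) *: sin).
    by exists (- b), a; rewrite addrC.
  move=> s; apply: is_derive_eq; rewrite !fctE /=.
  by rewrite scaleNr scalerN.
split; exists C => //.
- by exists 1, 0; rewrite scale1r scale0r addr0.
- by exists 0, 1; rewrite scale1r scale0r add0r.
Qed.

Lemma smooth1N h : smooth1 h -> smooth1 (fun s => - h s).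
Proof.
move=> [C Ch hC]; exists [set f | C (fun s => - f s)] => /=.
  by under [X in C X]eq_fun do rewrite opprK.
move=> f /hC[g Cg dg]; exists (fun s => - g s).
  by under [X in C X]eq_fun do rewrite opprK.
move=> s; have := is_deriveN (dg s); rewrite (_ : - (fun s => - f s) = f)//.
by apply/funext => t; rewrite fctE opprK.
Qed.

(* p(1/s) exp(-1/s) for s > 0: this form is stable under differentiation, which
   replaces [p] by [X^2 (p - p`())]. *)
Definition flat p (s : R) : R := if 0 < s then p.[s^-1] * expR (- s^-1) else 0.

(** Coefficient by coefficient, y^(i+2) <= (i+2)! exp(y). At y = 1/s this reads |flat p s| <= C s^2
    for s > 0, whence differentiability at 0. *)
Lemma horner_expR_bound p : exists2 C : R, 0 <= C & forall y, 0 <= y ->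
  `|p.[y]| * y ^+ 2 * expR (- y) <= C.
Proof.
exists (\sum_(i < size p) `|p`_i| * (i.+2)`!%:R).
  by apply: sumr_ge0 => i _; rewrite mulr_ge0.
move=> y y0; rewrite horner_coef -mulrA.
apply: le_trans (ler_wpM2r _ (ler_norm_sum _ _ _)) _.
  by rewrite mulr_ge0 ?expR_ge0 ?sqr_ge0.
rewrite mulr_suml; apply: ler_sum => i _.
rewrite normrM -mulrA ler_wpM2l// normrX ger0_norm// mulrA -exprD addn2.
rewrite expRN ler_pdivrMr ?expR_gt0//.
have := expR_ge1Dxn i.+1 y0; rewrite -ler_pdivrMl ?ltr0n ?fact_gt0// => h.
rewrite mulrC; lra.
Qed.

Lemma is_derive_flat p (s : R) :
  is_derive s 1 (flat p) (flat ('X^2 * (p - p^`())) s).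
Proof.
have [s0|s0|->] := ltgtP s 0.
- rewrite /flat ltNge ltW//=.
  apply: (@near_eq_is_derive _ _ _ (cst 0)).
  near=> t; rewrite /flat ifF//; apply/negbTE; rewrite -leNgt ltW//.
  by near: t; exact: lt_nbhsl.
- apply: (@near_eq_is_derive _ _ _ (fun t : R => p.[t^-1] * expR (- t^-1))).
    near=> t; rewrite /flat ifT//.
    by near: t; exact: lt_nbhsr.
  have dV : is_derive s (1 : R) (fun t : R => t^-1) (- s ^- 2).
    by apply: is_derive_eq; [apply: is_deriveV; rewrite gt_eqF|rewrite scaler1].
  have dp : is_derive s (1 : R) (fun t : R => p.[t^-1]) (p^`().[s^-1] * (- s ^- 2)).
    exact: (@is_derive1_comp _ (horner p) (fun t => t^-1)).
  have dN : is_derive s (1 : R) (fun t : R => - t^-1) (s ^- 2).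
    by apply: is_derive_eq; rewrite opprK.
  have de : is_derive s (1 : R) (fun t : R => expR (- t^-1)) (expR (- s^-1) * s ^- 2).
    exact: (@is_derive1_comp _ expR (fun t => - t^-1)).
  have := is_deriveM dp de.
  set l := _ + _; suff -> : l = flat ('X^2 * (p - p^`())) s by exact.
  rewrite /l /flat s0 !hornerE /GRing.scale /= -exprVn; ring.
(* At 0 the difference quotient is bounded by C h. *)
- have [C C0 hC] := horner_expR_bound p.
  rewrite {2}/flat ltxx; apply: cvg_is_derive.
  apply/cvgrPdist_le => e e0; near=> h.
  rewrite sub0r normrN /flat ltxx addr0 subr0 scaler1.
  have hn0 : h != 0 by near: h; exact: nbhs_dnbhs_neq.
  case: ifPn => h0; last by rewrite scaler0 normr0 ltW.
  have := hC h^-1; rewrite invr_ge0 ltW// => /(_ isT) hh.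
  rewrite /GRing.scale /= !normrM (ger0_norm (expR_ge0 _)) normfV (gtr0_norm h0).
  have -> : h^-1 * (`|p.[h^-1]| * expR (- h^-1)) =
     h * (`|p.[h^-1]| * h^-1 ^+ 2 * expR (- h^-1)) by field.
  apply: le_trans (ler_wpM2l (ltW h0) hh) _.
  have : `|h| < e / (C + 1).
    near: h; apply: dnbhs0_lt; rewrite divr_gt0//; lra.
  rewrite gtr0_norm// ltr_pdivlMr; last lra.
  nra.
Unshelve. all: by end_near. Qed.

Lemma smooth1_flat p : smooth1 (flat p).
Proof.
exists (range flat) => [|_ [q _ <-]]; first by exists p.
by eexists; [exists ('X^2 * (q - q^`()))|exact: is_derive_flat].
Qed.

End smooth1.

Section smooth_functions.
Context (R : realType) (n : nat).
Local Notation mu := (@lebesgue_rV R n).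
Implicit Types (f g : 'rV[R]_n -> R) (x v : 'rV[R]_n) (h : R -> R).

(** Reduction of directional derivatives to one real variable: the chain rule with an outer function
    on R then requires no total differentiability of the inner one. *)
Lemma is_derive_lineP f x v (df : R) :
  is_derive x v f df <-> is_derive (0 : R) 1 (fun s : R => f (s *: v + x)) df.
Proof.
have E : (fun k : R => k^-1 *: (((fun s : R => f (s *: v + x)) \o shift 0) (k *: (1:R)) - f (0 *: v + x))) =
   (fun k : R => k^-1 *: ((f \o shift x) (k *: v) - f x)).
  by apply/funext => k /=; rewrite addr0 scaler1 scale0r add0r.
split => -[d1 d2]; split.
- by move: d1; rewrite /derivable -E.
- by move: d2; rewrite /derive -E.
- by move: d1; rewrite /derivable -[in X in _ -> X]E.
- by move: d2; rewrite /derive -[in X in _ -> X]E.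
Qed.

Lemma is_derive_comp1 h f x v (dh df : R) :
  is_derive (f x) 1 h dh -> is_derive x v f df ->
  is_derive x v (fun y => h (f y)) (dh * df).
Proof.
move=> hh /is_derive_lineP hf; apply/is_derive_lineP.
apply: (@is_derive1_comp _ h (fun s : R => f (s *: v + x))) => //.
by rewrite scale0r add0r.
Qed.

Lemma coord_le_norm x i : `|x ord0 i| <= `|x|.
Proof.
rewrite [leRHS](mx_normrE x).
exact: (le_bigmax _ (fun ij : 'I_1 * 'I_n => `|x ij.1 ij.2|) (ord0, i)).
Qed.

(* Not every smooth function, but a class stable under partial derivatives that
   contains bumps and plane waves. *)
Inductive smooth : ('rV[R]_n -> R) -> Prop :=
| smooth_cst c : smooth (fun=> c)
| smooth_coord i : smooth (fun x => x ord0 i)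
| smoothD f g : smooth f -> smooth g -> smooth (fun x => f x + g x)
| smoothM f g : smooth f -> smooth g -> smooth (fun x => f x * g x)
| smooth_comp h f : smooth1 h -> smooth f -> smooth (fun x => h (f x)).

Lemma smooth_continuous f : smooth f -> continuous f.
Proof.
elim=> {f} [c|i|f g _ cf _ cg|f g _ cf _ cg|h f hh _ cf] x.
- exact: cst_continuous.
- exact: (@coord_continuous R 1 n ord0 i x).
- exact: (cvgD (cf x) (cg x)).
- exact: (cvgM (cf x) (cg x)).
- apply: (@continuous_comp _ _ _ f h x (cf x)). exact: (smooth1_continuous hh).
Qed.

Lemma is_derive_coord i x v : is_derive x v (fun y : 'rV[R]_n => y ord0 i) (v ord0 i).
Proof.
apply: cvg_is_derive; apply/cvgrPdist_le => e e0; near=> k.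
rewrite !mxE addrK /GRing.scale /= mulrA mulVf ?mul1r ?subrr ?normr0 ?ltW//.
by near: k; exact: nbhs_dnbhs_neq.
Unshelve. all: by end_near. Qed.

Lemma smooth_derive f v : smooth f ->
  exists2 g, smooth g & forall x, is_derive x v f (g x).
Proof.
elim=> {f} [c|i|f g _ [f' sf' df] _ [g' sg' dg]|f g sf [f' sf' df] sg [g' sg' dg]|h f hh sf [f' sf' df]].
- by exists (fun=> 0); [exact: smooth_cst|move=> x; exact: is_derive_cst].
- exists (fun=> v ord0 i); first exact: smooth_cst.
  by move=> x; exact: is_derive_coord.
- exists (fun x => f' x + g' x); first exact: smoothD.
  by move=> x; exact: (is_deriveD (df x) (dg x)).
- exists (fun x => f x * g' x + g x * f' x).
    by apply: smoothD; apply: smoothM.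
  by move=> x; exact: (is_deriveM (df x) (dg x)).
- have [h' sh' dh] := smooth1_derive hh.
  exists (fun x => h' (f x) * f' x); first by apply: smoothM => //; exact: smooth_comp.
  by move=> x; exact: is_derive_comp1.
Qed.

Lemma smooth_derivable f v x : smooth f -> derivable f x v.
Proof. by move=> /(smooth_derive v)[g _ df]; apply: ex_derive. Qed.

Lemma smooth_D f v : smooth f -> smooth ('D_v f).
Proof.
move=> /(smooth_derive v)[g sg df].
by rewrite (_ : 'D_v f = g)//; apply/funext => x; apply: derive_val.
Qed.

Lemma smooth_partial f i : smooth f -> smooth (partial i f).
Proof. exact: smooth_D. Qed.

Lemma smooth_cont_diff k f : smooth f -> cont_diff k f.
Proof.
elim: k f => [|k IH] f sf /=; split => //; try exact: smooth_continuous.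
by move=> i; split => [x|]; [exact: smooth_derivable|exact/IH/smooth_partial].
Qed.

Lemma smooth_sum I (r : seq I) (F : I -> 'rV[R]_n -> R) :
  (forall i, smooth (F i)) -> smooth (fun x => \sum_(i <- r) F i x).
Proof.
move=> sF; elim: r => [|i r IH].
  by rewrite (_ : (fun _ => _) = fun=> 0); [exact: smooth_cst|apply/funext => x; rewrite big_nil].
rewrite (_ : (fun _ => _) = fun x => F i x + \sum_(j <- r) F j x); first exact: smoothD.
by apply/funext => x; rewrite big_cons.
Qed.

Lemma smooth_prod I (r : seq I) (F : I -> 'rV[R]_n -> R) :
  (forall i, smooth (F i)) -> smooth (fun x => \prod_(i <- r) F i x).
Proof.
move=> sF; elim: r => [|i r IH].
  by rewrite (_ : (fun _ => _) = fun=> 1); [exact: smooth_cst|apply/funext => x; rewrite big_nil].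
rewrite (_ : (fun _ => _) = fun x => F i x * \prod_(j <- r) F j x); first exact: smoothM.
by apply/funext => x; rewrite big_cons.
Qed.

Lemma smoothN f : smooth f -> smooth (fun x => - f x).
Proof.
move=> sf; rewrite (_ : (fun _ => _) = fun x => -1 * f x).
  by apply: smoothM => //; exact: smooth_cst.
by apply/funext => x; rewrite mulN1r.
Qed.

Lemma smooth_laplacian f : smooth f -> smooth (laplacian f).
Proof. by move=> sf; apply: smooth_sum => i; do 2 apply: smooth_partial. Qed.

Lemma bsupp_laplacian f : bsupp f -> bsupp (laplacian f).
Proof.
move=> sf; apply: bsupp_sum => i; do 2 apply: bsupp_derive; exact: sf.
Qed.

Lemma bsupp_compact f : bsupp f -> compact (closure [set x | f x != 0]).
Proof.
move=> [M fM].
pose K : set 'rV[R]_n := [set v | forall i, `[- M%:R, M%:R]%classic (v ord0 i)].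
have cK : compact K.
  apply: (@rV_compact R n (fun _ => `[- M%:R, M%:R]%classic)) => i.
  exact: segment_compact.
apply: (subclosed_compact _ cK); first exact: closed_closure.
have Kcl : closed K by apply: compact_closed => //; exact: norm_hausdorff.
have KE : K = closure K by exact/closure_id.
move=> x clx; rewrite KE => B /clx [y [/fM /in_cube h By]].
exists y; split=> // i; have := h i; rewrite mxE sub0r add0r.
by rewrite /= in_itv /= => /andP[/ltW -> ->].
Qed.

Lemma smooth_test f : smooth f -> bsupp f -> test_function f.
Proof.
by move=> sf bf; split; [move=> k; exact: smooth_cont_diff|exact: bsupp_compact].
Qed.

Lemma test_bsupp f : test_function f -> bsupp f.
Proof.
move=> [_ /compact_bounded[M [_ hM]]].
exists (Num.trunc (`|M| + 1)).+1 => x fx; apply/in_cube => i.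
have /= nx : `|x| <= `|M| + 1.
  apply: hM; first by rewrite (le_lt_trans (ler_norm M))// ltrDl.
  exact: subset_closure.
have : `|x ord0 i| < (Num.trunc (`|M| + 1)).+1%:R.
  apply: le_lt_trans (truncnS_gt _); apply: le_trans nx.
  exact: coord_le_norm.
by rewrite mxE sub0r add0r ltr_norml => /andP[-> /ltW].
Qed.

End smooth_functions.

(** * Integration by parts *)

Section laplacian_by_parts.
Context (R : realType) (n : nat).
Local Notation mu := (@lebesgue_rV R n).
Implicit Types (u phi : 'rV[R]_n -> R).

(** Green's identity in one coordinate: the difference of the two integrands is the i-th derivative
    of [F], which has bounded support as [u] does, so its integral vanishes. *)
Lemma by_parts2 u phi (i : 'I_n) : cont_diff 2 u -> bsupp u -> cont_diff 2 phi ->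
  \int[mu]_x (u x * partial i (partial i phi) x) =
  \int[mu]_x (partial i (partial i u) x * phi x).
Proof.
move=> [cu /(_ i)[du [cdu /(_ i)[ddu [cddu _]]]]] su.
move=> [cp /(_ i)[dp [cdp /(_ i)[ddp [cddp _]]]]].
have sdu : bsupp (partial i u) by exact: bsupp_derive.
have sddu : bsupp (partial i (partial i u)) by exact: bsupp_derive.
have Cu : Cc u by [].
have Cdu : Cc (partial i u) by [].
have Cddu : Cc (partial i (partial i u)) by [].
pose F x := u x * partial i phi x - partial i u x * phi x.
have dF x : is_derive x 'e_i F (u x * partial i (partial i phi) x - partial i (partial i u) x * phi x).
  have h1 := is_deriveM (derivableP (du x)) (derivableP (ddp x)).
  have h2 := is_deriveM (derivableP (ddu x)) (derivableP (dp x)).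
  suff -> : u x * partial i (partial i phi) x - partial i (partial i u) x * phi x =
     (u x *: 'D_'e_i (partial i phi) x + partial i phi x *: 'D_'e_i u x) -
     (partial i u x *: 'D_'e_i phi x + phi x *: 'D_'e_i (partial i u) x).
    exact: (is_deriveB h1 h2).
  by rewrite /GRing.scale /= /partial; ring.
have CF : Cc F by apply: CcD; [exact: CcMl|apply: CcN; exact: CcMl].
have I1 : mu.-integrable setT (EFin \o (fun x => u x * partial i (partial i phi) x)).
  by apply: Cc_integrable; exact: CcMl.
have I2 : mu.-integrable setT (EFin \o (fun x => partial i (partial i u) x * phi x)).
  by apply: Cc_integrable; exact: CcMl.
apply/eqP; rewrite -subr_eq0 -RintegralB//.
have dF' x : derivable F x 'e_i by have [] := dF x.
have := @integral_derive R n F 'e_i CF dF'.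
rewrite (_ : 'D_('e_i) F = fun x => u x * partial i (partial i phi) x - partial i (partial i u) x * phi x).
  move=> ->//.
  have : Cc (fun x => u x * partial i (partial i phi) x - partial i (partial i u) x * phi x).
    by apply: CcD; [exact: CcMl|apply: CcN; exact: CcMl].
  by case.
by apply/funext => x; have [_ ->] := dF x.
Qed.

Lemma laplacian_by_parts u phi : cont_diff 2 u -> bsupp u -> cont_diff 2 phi ->
  \int[mu]_x (u x * laplacian phi x) = \int[mu]_x (laplacian u x * phi x).
Proof.
move=> hu su hp.
have cc f i : cont_diff 2 f -> continuous (partial i (partial i f)).
  by move=> [_ /(_ i)[_ [_ /(_ i)[_ []]]]].
have RS (F : 'I_n -> 'rV[R]_n -> R) : (forall i, Cc (F i)) ->
    \int[mu]_x (\sum_i F i x) = \sum_i \int[mu]_x F i x.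
  move=> CF; elim: (index_enum _) => [|i r IH].
    by rewrite big_nil; under eq_Rintegral do rewrite big_nil; rewrite Rintegral_cst// mul0r.
  rewrite big_cons; under eq_Rintegral do rewrite big_cons.
  by rewrite RintegralD// ?IH//; apply: Cc_integrable => //; exact: Cc_sum.
under eq_Rintegral do rewrite mulr_sumr.
under [RHS]eq_Rintegral do rewrite mulr_suml.
rewrite !RS => [|i|i]; first by apply: eq_bigr => i _; exact: by_parts2.
- apply: CcMl; last by case: hp.
  by split; [exact: cc|do 2 apply: bsupp_derive].
- by apply: CcMl; [split => //; case: hu|exact: cc].
Qed.

End laplacian_by_parts.

(** * Test functions separate locally integrable functions *)

Section flat1.
Context (R : realType).

Lemma flat1_le0 (s : R) : s <= 0 -> flat 1 s = 0.
Proof. by move=> s0; rewrite /flat ltNge s0. Qed.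

Lemma flat1_ge0 (s : R) : 0 <= flat 1 s.
Proof. by rewrite /flat; case: ifP => // _; rewrite hornerC mul1r expR_ge0. Qed.

Lemma flat1_le1 (s : R) : flat 1 s <= 1.
Proof.
rewrite /flat; case: ifP => // s0; rewrite hornerC mul1r expR_le1.
by rewrite oppr_le0 invr_ge0 ltW.
Qed.

Lemma flat1_ge (s : R) : 0 < s -> 1 - s^-1 <= flat 1 s.
Proof. by move=> s0; rewrite /flat s0 hornerC mul1r expR_ge1Dx. Qed.

Lemma cvg_flat1 (t : R^nat) (del : R) : 0 < del ->
  (forall k, k.+1%:R * del <= t k) -> flat 1 (t k) @[k --> \oo] --> (1 : R).
Proof.
move=> del0 ht; apply/cvgrPdist_le => e e0; near=> k.
have kd : 0 < k.+1%:R * del by rewrite mulr_gt0.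
have tk : 0 < t k by exact: lt_le_trans (ht k).
have := flat1_ge tk; have := flat1_le1 (t k) => h1 h2.
rewrite ger0_norm ?subr_ge0//.
have h3 : (t k)^-1 <= (k.+1%:R * del)^-1 by rewrite lef_pV2 ?posrE.
have h4 : (k.+1%:R * del)^-1 <= e.
  rewrite -[leRHS]invrK lef_pV2 ?posrE ?invr_gt0// -ler_pdivrMr//.
  have : (e^-1 / del) <= k%:R by near: k; exact: nbhs_infty_ger.
  by move=> h; apply: le_trans h _; rewrite ler_nat.
move: h2 (le_trans h3 h4); set u := (t k)^-1; lra.
Unshelve. all: by end_near. Qed.

End flat1.

Section box_bump.
Context (R : realType) (n : nat).
Implicit Types (a b x : 'rV[R]_n).

(** With K = k + 1 the arguments are K^2 (x_i - a_i) and K^2 (b_i + 1/K - x_i). The shift by 1/K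
    puts the closed end b_i inside, where the second argument K still tends to infinity. The
    products are expanded to match the constructors of [smooth]. *)
Definition bump_factor (k : nat) a b (i : 'I_n) x : R :=
  flat 1 (k.+1%:R ^+ 2 * x ord0 i + - (k.+1%:R ^+ 2 * a ord0 i)) *
  flat 1 (- k.+1%:R ^+ 2 * x ord0 i + (k.+1%:R ^+ 2 * b ord0 i + k.+1%:R)).

(* Smooth functions converging pointwise to the indicator of the box. *)
Definition box_bump (k : nat) a b x : R := \prod_i bump_factor k a b i x.

Lemma smooth_box_bump k a b : smooth (box_bump k a b).
Proof.
apply: smooth_prod => i; apply: smoothM;
  apply: (@smooth_comp _ _ (flat 1)); try exact: smooth1_flat;
  apply: smoothD; try exact: smooth_cst;
  by apply: smoothM; [exact: smooth_cst|exact: smooth_coord].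
Qed.

Lemma bump_factor_itv k a b i x : 0 <= bump_factor k a b i x <= 1.
Proof.
rewrite mulr_ge0 ?flat1_ge0//=.
by rewrite mulr_ile1 ?flat1_ge0 ?flat1_le1.
Qed.

Lemma box_bump_itv k a b x : 0 <= box_bump k a b x <= 1.
Proof.
apply/andP; split.
  by apply: prodr_ge0 => i _; have /andP[] := bump_factor_itv k a b i x.
by apply: prodr_ile1 => i _; exact: bump_factor_itv.
Qed.

Lemma bump_factor_neq0 k a b i x : bump_factor k a b i x != 0 ->
  a ord0 i < x ord0 i < b ord0 i + k.+1%:R^-1.
Proof.
move=> h; have k0 : 0 < k.+1%:R :> R by rewrite ltr0n.
apply/andP; split; rewrite ltNge; apply: contra_neqN h => h.
  rewrite /bump_factor flat1_le0 ?mul0r// -mulrBr pmulr_rle0 ?exprn_gt0//.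
  by rewrite subr_le0.
rewrite /bump_factor [X in _ * X]flat1_le0 ?mulr0//.
rewrite [leLHS](_ : _ = k.+1%:R ^+ 2 * (b ord0 i + k.+1%:R^-1 - x ord0 i)); last first.
  by move: (k.+1%:R : R) k0 => K K0; field; rewrite gt_eqF.
by rewrite pmulr_rle0 ?exprn_gt0// subr_le0.
Qed.

Lemma box_bump_neq0 k a b x : box_bump k a b x != 0 -> forall i,
  a ord0 i < x ord0 i < b ord0 i + k.+1%:R^-1.
Proof.
move=> h i; apply: (@bump_factor_neq0 k); apply: contra_neq h => h.
by rewrite /box_bump (bigD1 i)//= h mul0r.
Qed.

Lemma box_bump_support a b : exists K : nat, forall k x,
  box_bump k a b x != 0 -> cube 0 K%:R x.
Proof.
pose s := \sum_i (`|a ord0 i| + `|b ord0 i|) + 1.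
exists (Num.trunc s).+1 => k x /box_bump_neq0 h; apply/in_cube => i.
have /andP[h1 h2] := h i; rewrite mxE sub0r add0r.
have hs := truncnS_gt s.
have hi : `|a ord0 i| + `|b ord0 i| + 1 <= s.
  rewrite lerD2r (bigD1 i)//= lerDl sumr_ge0// => j _; exact: addr_ge0.
have h3 : (k.+1%:R^-1 : R) <= 1 by rewrite invf_le1 ?ler1n.
have := ler_norm (b ord0 i); have := ler_norm (- a ord0 i); rewrite normrN.
have := normr_ge0 (a ord0 i); have := normr_ge0 (b ord0 i).
move: (k.+1%:R^-1 : R) ((Num.trunc s).+1%:R : R) h2 h3 hs => u N; clearbody s.
by move=> *; apply/andP; split; lra.
Qed.

Lemma cvg_prod I (r : seq I) (F : I -> R^nat) (l : I -> R) :
  (forall i, F i k @[k --> \oo] --> l i) ->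
  \prod_(i <- r) F i k @[k --> \oo] --> \prod_(i <- r) l i.
Proof.
move=> h; elim: r => [|i r IH].
  by rewrite big_nil; under eq_fun do rewrite big_nil; exact: cvg_cst.
by rewrite big_cons; under eq_fun do rewrite big_cons; exact: cvgM.
Qed.

Lemma cvg_box_bump a b x : box_bump k a b x @[k --> \oo] --> (\1_(box a b) x : R).
Proof.
rewrite indicE; case: (boolP (x \in box a b)) => [/set_mem xab|].
  rewrite -[X in _ --> X](_ : \prod_(i < n) (1 * 1) = 1); last first.
    by rewrite big1// => i _; rewrite mulr1.
  apply: cvg_prod => i; have := xab i; rewrite in_itv /= => /andP[h1 h2].
  apply: cvgM.
    apply: (@cvg_flat1 _ _ (x ord0 i - a ord0 i)); first by rewrite subr_gt0.
    move=> k; rewrite -mulrBr; apply: ler_wpM2r; first by rewrite subr_ge0 ltW.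
    by rewrite expr2 ler_peMl ?ler1n.
  apply: (@cvg_flat1 _ _ 1) => // k.
  rewrite mulr1 addrA lerDr mulNr addrC -mulrBr mulr_ge0 ?sqr_ge0// subr_ge0//.
move=> /negP xab; have {xab} [i hi] : exists i, ~~ (a ord0 i < x ord0 i <= b ord0 i).
  apply/existsP; rewrite -negb_forall; apply/negP => /forallP h; apply: xab.
  by apply/mem_set => i; rewrite in_itv/=; exact: h.
suff : \forall k \near \oo, box_bump k a b x = 0.
  by move=> h; apply: cvg_near_cst.
move: hi; rewrite negb_and -!leNgt -ltNge => /orP[hi|hi]; near=> k; apply/eqP.
  by apply: contraTT hi => /box_bump_neq0/(_ i)/andP[h _]; rewrite -ltNge.
have hk : k.+1%:R^-1 <= x ord0 i - b ord0 i.
  rewrite -[leRHS]invrK lef_pV2 ?posrE ?invr_gt0 ?subr_gt0//.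
  have : (x ord0 i - b ord0 i)^-1 <= k%:R by near: k; exact: nbhs_infty_ger.
  by move=> h; apply: le_trans h _; rewrite ler_nat.
apply/negP => /negP/box_bump_neq0/(_ i)/andP[_]; apply/negP; by rewrite -leNgt -lerBrDl.
Unshelve. all: by end_near. Qed.

End box_bump.

Section test_functions_separate.
Context (R : realType) (n : nat).
Local Notation mu := (@lebesgue_rV R n).
Variable g : 'rV[R]_n -> R.
Hypothesis mg : measurable_fun setT g.
Hypothesis ig : forall k : nat, mu.-integrable (cube 0 k%:R) (EFin \o g).
Hypothesis g0 : forall phi : 'rV[R]_n -> R, test_function phi ->
  \int[mu]_x (g x * phi x) = 0.

(** Dominated convergence along [box_bump]: all these bumps live in one cube, on which |g| is an
    integrable bound. *)
Lemma test_integral_box a b : (\int[mu]_(x in box a b) (g x)%:E = 0)%E.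
Proof.
have [K hK] := box_bump_support a b.
have mC : measurable (cube (0 : 'rV[R]_n) K%:R) by exact: measurable_cube.
pose dom x := (`|(g \_ (cube 0 K%:R)) x|)%:E.
have idom : mu.-integrable setT dom.
  have := (integrable_mkcond (EFin \o g) mC).1 (ig K).
  move=> /integrable_abse; apply: eq_integrable => // x _ /=.
  by rewrite /dom /= !patchE; case: ifP.
have mb k : measurable_fun setT (box_bump k a b).
  apply: continuous_measurable_rV; apply: smooth_continuous.
  exact: smooth_box_bump.
have [] := @dominated_convergence _ _ _ mu setT measurableT
   (fun k x => (g x * box_bump k a b x)%:E) (fun x => (g x * \1_(box a b) x)%:E) dom.
- by move=> k; apply/measurable_EFinP; exact: measurable_funM.
- apply/measurable_EFinP; apply: measurable_funM => //.
  by apply: measurable_indic; exact: measurable_box.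
- apply: aeW => x _; apply: cvg_EFin; first exact: nearW.
  by apply: cvgM; [exact: cvg_cst|exact: cvg_box_bump].
- exact: idom.
- apply: aeW => x k _; rewrite /dom lee_fin patchE.
  have [->|bx] := eqVneq (box_bump k a b x) 0; first by rewrite mulr0 normr0.
  rewrite mem_set; last exact: hK bx.
  rewrite normrM ler_piMr//; have /andP[h1 h2] := box_bump_itv k a b x.
  by rewrite ger0_norm.
move=> _ _; rewrite (_ : [sequence _]_k = cst 0%E); last first.
  apply/funext => k /=; have tf : test_function (box_bump k a b).
    by apply: smooth_test; [exact: smooth_box_bump|exists K => x; exact: hK].
  have e := g0 tf; rewrite /Rintegral in e; have := congr1 EFin e; rewrite fineK//.
  apply: integrable_fin_num => //.
  apply: le_integrable idom => //.
    by apply/measurable_EFinP; exact: measurable_funM.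
  move=> x _; rewrite /= normr_id lee_fin patchE.
  have [->|bx] := eqVneq (box_bump k a b x) 0; first by rewrite mulr0 normr0.
  rewrite mem_set; last exact: hK bx.
  rewrite normrM ler_piMr//; have /andP[h1 h2] := box_bump_itv k a b x.
  by rewrite ger0_norm.
move=> /(cvg_unique (@ereal_hausdorff R) (cvg_cst _)) h.
rewrite [RHS]h [LHS]integral_mkcond; apply: eq_integral => x _.
by rewrite patchE indicE; case: ifP; rewrite ?mulr1 ?mulr0.
Qed.

End test_functions_separate.

Section density.
Context (R : realType) (n : nat).
Local Notation mu := (@lebesgue_rV R n).
Variable h : 'rV[R]_n -> R.
Hypothesis mh : measurable_fun setT h.
Hypothesis h0 : forall x, 0 <= h x.

(* The two proof arguments let the measure structure be inferred. *)
Definition density of measurable_fun setT h & (forall x, 0 <= h x) :=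
  fun A : set 'rV[R]_n => (\int[mu]_(x in A) (h x)%:E)%E.

Let density0 : density mh h0 set0 = 0%E. Proof. exact: integral_set0. Qed.
Let density_ge0 A : (0 <= density mh h0 A)%E.
Proof. by apply: integral_ge0 => x _; rewrite lee_fin. Qed.
Let density_sigma : semi_sigma_additive (density mh h0).
Proof.
apply: (@semi_sigma_additive_nng_induced _ _ _ mu (EFin \o h)).
  exact/measurable_EFinP.
by move=> x; rewrite /= lee_fin.
Qed.

HB.instance Definition _ := isMeasure.Build _ _ _ (density mh h0)
  density0 density_ge0 density_sigma.

End density.

Section test_functions_separate2.
Context (R : realType) (n : nat).
Local Notation mu := (@lebesgue_rV R n).
Variable g : 'rV[R]_n -> R.
Hypothesis mg : measurable_fun setT g.
Hypothesis ig : forall k : nat, mu.-integrable (cube 0 k%:R) (EFin \o g).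
Hypothesis g0 : forall phi : 'rV[R]_n -> R, test_function phi ->
  \int[mu]_x (g x * phi x) = 0.

(** On a cube, the positive and negative parts of [g] are densities of two finite measures that
    agree on boxes by [test_integral_box], hence on all measurable sets; so the two densities agree
    almost everywhere. *)
Lemma test_functions_separate : {ae mu, forall x, g x = 0}.
Proof.
suff H k : {ae mu, forall x, cube 0 k%:R x -> g x = 0}.
  have := ae_foralln H; apply: filterS => x hx.
  have [k _ xk] : (\bigcup_k cube (0 : 'rV[R]_n) k%:R) x by rewrite cube_cover.
  exact: hx xk.
have mC : measurable (cube (0 : 'rV[R]_n) k%:R) by exact: measurable_cube.
pose gQ := g \_ (cube 0 k%:R).
have mgQ : measurable_fun setT gQ.
  by apply/(measurable_restrictT _ mC); exact: measurable_funTS.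
have igQ : mu.-integrable setT (EFin \o gQ).
  have := (integrable_mkcond (EFin \o g) mC).1 (ig k).
  by apply: eq_integrable => // x _ /=; rewrite /gQ !patchE; case: ifP.
pose gp x := Num.max (gQ x) 0.
pose gn x := Num.max (- gQ x) 0.
have mgp : measurable_fun setT gp by exact: measurable_maxr.
have mgn : measurable_fun setT gn.
  by apply: measurable_maxr => //; exact: measurableT_comp.
have gp0 x : 0 <= gp x by rewrite le_max lexx orbT.
have gn0 x : 0 <= gn x by rewrite le_max lexx orbT.
have gE x : gp x - gn x = gQ x.
  rewrite /gp /gn; case: (leP (gQ x) 0) => h.
    by rewrite max_l ?oppr_ge0// sub0r opprK.
  by rewrite max_r ?subr0// oppr_le0 ltW.
have gA x : `|gp x| <= `|gQ x| /\ `|gn x| <= `|gQ x|.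
  rewrite (ger0_norm (gp0 x)) (ger0_norm (gn0 x)) /gp /gn; split.
    by rewrite ge_max normr_ge0 andbT ler_norm.
  by rewrite ge_max normr_ge0 andbT -normrN ler_norm.
have igp : mu.-integrable setT (EFin \o gp).
  apply: le_integrable igQ => //; first exact/measurable_EFinP.
  by move=> x _; rewrite /= lee_fin; case: (gA x).
have ign : mu.-integrable setT (EFin \o gn).
  apply: le_integrable igQ => //; first exact/measurable_EFinP.
  by move=> x _; rewrite /= lee_fin; case: (gA x).
have E A : measurable A -> density mgp gp0 A = density mgn gn0 A.
  apply: rV_measure_unique => [a b|j]; last first.
    have : (density mgp gp0 (cube 0 j%:R) \is a fin_num)%E.
      apply: integrable_fin_num; first exact: measurable_cube.
      by apply: integrableS igp => //; exact: measurable_cube.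
    by rewrite ge0_fin_numE.
  have mB := measurable_box a b.
  have h : (\int[mu]_(x in box a b) (gQ x)%:E = 0)%E.
    transitivity (\int[mu]_(x in box a b `&` cube 0 k%:R) (g x)%:E)%E.
      rewrite [RHS]integral_mkcondr; apply: eq_integral => x _.
      by rewrite /gQ !patchE; case: ifP.
    by rewrite /cube boxI; exact: test_integral_box.
  have : (\int[mu]_(x in box a b) ((gp x)%:E - (gn x)%:E) = 0)%E.
    by rewrite -[RHS]h; apply: eq_integral => x _; rewrite -EFinB gE.
  have ip : mu.-integrable (box a b) (EFin \o gp) by exact: integrableS igp.
  have in' : mu.-integrable (box a b) (EFin \o gn) by exact: integrableS ign.
  rewrite integralB// => /eqP; rewrite sube_eq ?add0e; first by move/eqP.
    exact: integrable_fin_num.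
  by rewrite fin_num_adde_defl//; exact: integrable_fin_num.
have := @integral_ae_eq _ _ _ mu setT measurableT (EFin \o gn) (EFin \o gp) igp.
move=> /(_ _ _)/wrap[|A _ mA|]; [exact/measurable_EFinP|exact: E|].
apply: filterS => x /= /(_ I) [] h xC.
have := gE x; rewrite h subrr /gQ patchE mem_set// => <-//.
Qed.

End test_functions_separate2.

(** * Square-integrable functions and distributions *)

Section semi_norm.
Context (R : realType) (V : lmodType R[i]) (B : V -> V -> R).
Hypothesis BC : forall x y, B x y = B y x.
Hypothesis BDl : forall x y z, B (x + y) z = B x z + B y z.
Hypothesis BZl : forall (t : R) x y, B (t%:C%C *: x) y = t * B x y.
Hypothesis B_ge0 : forall x, 0 <= B x x.

Lemma form_cauchy_schwarz x y : B x y ^+ 2 <= B x x * B y y.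
Proof.
have P t : 0 <= B x x + 2 * t * B x y + t ^+ 2 * B y y.
  have := B_ge0 (x + t%:C%C *: y).
  rewrite BDl (BC x (x + _)) (BC (_ *: y) (x + _)) !BDl !BZl.
  by rewrite (BC x (_ *: y)) (BC y (_ *: y)) !BZl (BC y x); lra.
have [y0|y0] := eqVneq (B y y) 0.
  have [->|xy0] := eqVneq (B x y) 0; first by rewrite expr0n /= y0 mulr0.
  (* [B] may be degenerate. When [B y y = 0] the polynomial in [P] is affine, and this value of [t]
     would make it equal to -1. *)
  have := P (- (B x x + 1) / (2 * B x y)); rewrite y0 mulr0 addr0.
  have -> : 2 * (- (B x x + 1) / (2 * B x y)) * B x y = - (B x x + 1) by field.
  lra.
have := P (- B x y / B y y).
have -> : B x x + 2 * (- B x y / B y y) * B x y + (- B x y / B y y) ^+ 2 * B y y =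
   (B x x * B y y - B x y ^+ 2) / B y y by field.
by rewrite pmulr_lge0 ?subr_ge0// invr_gt0 lt_neqAle eq_sym y0 B_ge0.
Qed.

Lemma form_triangle x y :
  Num.sqrt (B (x + y) (x + y)) <= Num.sqrt (B x x) + Num.sqrt (B y y).
Proof.
have h0 : 0 <= Num.sqrt (B x x) + Num.sqrt (B y y) by rewrite addr_ge0 ?sqrtr_ge0.
rewrite -[leRHS]ger0_norm// -sqrtr_sqr ler_wsqrtr// sqrrD !sqr_sqrtr//.
rewrite BDl (BC x (x + y)) (BC y (x + y)) !BDl (BC y x).
have : B x y <= Num.sqrt (B x x) * Num.sqrt (B y y).
  rewrite -sqrtrM//; apply: le_trans (ler_norm _) _.
  by rewrite -sqrtr_sqr ler_wsqrtr// form_cauchy_schwarz.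
rewrite -mulr_natl; lra.
Qed.

End semi_norm.

Section L2_form.
Context (R : realType) (n : nat).
Local Notation mu := (@lebesgue_rV R n).
Local Notation L2 := (L2 R n).
Local Notation fn := (sqint_fun R n).
Implicit Types (f g : fn) (u v w : L2).

Lemma sqintDE f g x : (f + g : fn) x = f x + g x. Proof. by []. Qed.

Lemma sqintNE f x : (- f : fn) x = - f x. Proof. by []. Qed.

Lemma sqintZE a f x : (a *: f : fn) x = a * f x. Proof. by []. Qed.

Lemma sqint_Re f : @complex.Re R \o f \in Lfun mu 2%:E.
Proof. by case: f => f /= /andP[]. Qed.

Lemma sqint_Im f : @complex.Im R \o f \in Lfun mu 2%:E.
Proof. by case: f => f /= /andP[]. Qed.

Lemma Lfun_measurable p (h : 'rV[R]_n -> R) : h \in Lfun mu p -> measurable_fun setT h.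
Proof. by move=> /sub_Lfun_mfun; rewrite inE. Qed.

Lemma Lfun2_mul_integrable (h k : 'rV[R]_n -> R) :
  h \in Lfun mu 2%:E -> k \in Lfun mu 2%:E ->
  mu.-integrable setT (EFin \o (fun x => h x * k x)).
Proof. by move=> hh hk; apply/Lfun1_integrable; exact: Lfun2_mul_Lfun1. Qed.

Lemma ae_repr_pi f : {ae mu, forall x, repr (\pi_L2 f) x = f x}.
Proof.
have : repr (\pi_L2 f) - f \in @ae_null R n by rewrite Quotient.idealrBE reprK.
move=> /asboolP; apply: filterS => x.
by rewrite /= !fctE => /eqP; rewrite subr_eq0 => /eqP.
Qed.

Lemma pi_eq f g : {ae mu, forall x, f x = g x} -> \pi_L2 f = \pi_L2 g.
Proof.
move=> fg; apply/eqP; rewrite piE Quotient.equivE.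
apply/asboolP; apply: filterS fg => x /= fg.
by rewrite !fctE fg subrr.
Qed.

Lemma L2P u : exists f, u = \pi_L2 f.
Proof. by exists (repr u); rewrite reprK. Qed.

Lemma piZ a f : a *: \pi_L2 f = \pi_L2 (a *: f).
Proof.
have -> : a *: \pi_L2 f = \pi_L2 (a *: repr (\pi_L2 f)) by [].
apply: pi_eq; apply: filterS (ae_repr_pi f) => x /= h.
by rewrite !fctE h.
Qed.

Lemma piD f g : \pi_L2 f + \pi_L2 g = \pi_L2 (f + g).
Proof. exact/esym/Quotient.pi_add. Qed.

Lemma piN f : - \pi_L2 f = \pi_L2 (- f).
Proof. by rewrite -scaleN1r piZ scaleN1r. Qed.

(** The energy norm sees only the real part of the inner product, a symmetric real-bilinear form to
    which [form_triangle] applies. *)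
Definition rdot u v : R := complex.Re (L2_dot u v).

Lemma ae_eq_Rintegral (h k : 'rV[R]_n -> R) : measurable_fun setT h ->
  measurable_fun setT k -> {ae mu, forall x, h x = k x} ->
  \int[mu]_x h x = \int[mu]_x k x.
Proof.
move=> mh mk hk; rewrite /Rintegral; congr fine; apply: ae_eq_integral => //.
- exact/measurable_EFinP.
- exact/measurable_EFinP.
- by apply: filterS hk => x /= ->.
Qed.

Lemma measurable_Re f : measurable_fun setT (fun x => complex.Re (f x)).
Proof. exact: Lfun_measurable (sqint_Re f). Qed.

Lemma measurable_Im f : measurable_fun setT (fun x => complex.Im (f x)).
Proof. exact: Lfun_measurable (sqint_Im f). Qed.

Lemma rdot_pi f g : rdot (\pi_L2 f) (\pi_L2 g) =
  \int[mu]_x (complex.Re (f x) * complex.Re (g x) + complex.Im (f x) * complex.Im (g x)).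
Proof.
rewrite /rdot /L2_dot /complex_integral /=.
transitivity (\int[mu]_x (complex.Re (repr (\pi_L2 f) x) * complex.Re (repr (\pi_L2 g) x) + complex.Im (repr (\pi_L2 f) x) * complex.Im (repr (\pi_L2 g) x))).
  apply: eq_Rintegral => x _.
  move: (sqint_val (repr (\pi_L2 f)) x) (sqint_val (repr (\pi_L2 g)) x) => [a b] [c d] /=.
  by rewrite mulrN opprK.
apply: ae_eq_Rintegral; last first.
  by apply: filterS2 (ae_repr_pi f) (ae_repr_pi g) => x -> ->.
all: by apply: measurable_realfun.measurable_funD; apply: measurable_funM;
  first [exact: measurable_Re|exact: measurable_Im].
Qed.

Lemma rdot_integrable f g : mu.-integrable setT (EFin \o (fun x =>
  complex.Re (f x) * complex.Re (g x) + complex.Im (f x) * complex.Im (g x))).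
Proof.
exact: (integrableD measurableT
  (Lfun2_mul_integrable (sqint_Re f) (sqint_Re g))
  (Lfun2_mul_integrable (sqint_Im f) (sqint_Im g))).
Qed.

Lemma rdotC u v : rdot u v = rdot v u.
Proof.
have [f ->] := L2P u; have [g ->] := L2P v; rewrite !rdot_pi.
by apply: eq_Rintegral => x _; rewrite mulrC [_ * complex.Im (g x)]mulrC.
Qed.

Lemma rdotDl u v w : rdot (u + v) w = rdot u w + rdot v w.
Proof.
have [f ->] := L2P u; have [g ->] := L2P v; have [h ->] := L2P w.
rewrite piD !rdot_pi -RintegralD//; try exact: rdot_integrable.
apply: eq_Rintegral => x _; rewrite ?sqintDE ?sqintZE.
by case: (f x) (g x) (h x) => [? ?] [? ?] [? ?] /=; ring.
Qed.

Lemma rdotZl (t : R) u v : rdot (t%:C%C *: u) v = t * rdot u v.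
Proof.
have [f ->] := L2P u; have [g ->] := L2P v.
rewrite piZ !rdot_pi -RintegralZl//; last exact: rdot_integrable.
apply: eq_Rintegral => x _; rewrite ?sqintDE ?sqintZE.
by case: (f x) (g x) => [? ?] [? ?] /=; ring.
Qed.

Lemma rdot_ge0 u : 0 <= rdot u u.
Proof.
have [f ->] := L2P u; rewrite rdot_pi; apply: Rintegral_ge0 => x _.
by rewrite -!expr2 addr_ge0 ?sqr_ge0.
Qed.

Lemma rdotZZ (a : R[i]) u : rdot (a *: u) (a *: u) =
  (complex.Re a ^+ 2 + complex.Im a ^+ 2) * rdot u u.
Proof.
have [f ->] := L2P u.
rewrite piZ !rdot_pi -RintegralZl//; last exact: rdot_integrable.
apply: eq_Rintegral => x _; rewrite ?sqintDE ?sqintZE.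
by case: a (f x) => [? ?] [? ?] /=; ring.
Qed.

End L2_form.

(** * The energy norm is a seminorm on the energy space *)

Section energy_norm.
Context (R : realType) (n : nat) (S : operator (L2 R n)).
Local Notation N := (energy_norm S).
Hypothesis linS : linear_operator S.
Hypothesis S0 : dom S 0.

Lemma linear_operator0 : S 0 = 0.
Proof.
have [_] := linS (-1) S0 S0; rewrite scaler0 addr0 scaleN1r => /eqP.
by rewrite addNr => /eqP.
Qed.

Let form (X Y : L2 R n * L2 R n) := rdot X.1 Y.1 + rdot X.2 Y.2.

Lemma energy_normE U : N U = Num.sqrt (rdot (S U.1) (S U.1) + rdot U.2 U.2).
Proof.
rewrite /energy_norm /hnorm /energy_dot /rdot; congr Num.sqrt.
Qed.

Lemma energy_space_lin (a : R[i]) U W : energy_space S U -> energy_space S W ->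
  energy_space S (a *: U + W).
Proof. by move=> DU DW; have [] := linS a DU DW. Qed.

Lemma energy_normD U W : energy_space S U -> energy_space S W ->
  N (U + W) <= N U + N W.
Proof.
move=> DU DW; rewrite !energy_normE.
have -> : S (U + W).1 = S U.1 + S W.1.
  by have [_] := linS 1 DU DW; rewrite !scale1r.
apply: (@form_triangle R (L2 R n * L2 R n)%type form _ _ _ _ (S U.1, U.2) (S W.1, W.2)).
- by move=> X Y; rewrite /form rdotC [X in _ + X]rdotC.
- by move=> X Y Z; rewrite /form /= !rdotDl addrACA.
- by move=> t X Y; rewrite /form /= !rdotZl mulrDr.
- by move=> X; rewrite /form addr_ge0 ?rdot_ge0.
Qed.

Lemma energy_normZ (a : R[i]) U : energy_space S U ->
  N (a *: U) = complex.Re `|a| * N U.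
Proof.
move=> DU; rewrite !energy_normE.
have -> : S (a *: U).1 = a *: S U.1.
  by have [_] := linS a DU S0; rewrite linear_operator0 !addr0.
rewrite /= !rdotZZ -mulrDr sqrtrM ?addr_ge0 ?sqr_ge0//.
by congr (_ * _); case: a.
Qed.

End energy_norm.

(** * Differentiation rules and plane waves *)

Section partial_rules.
Context (R : realType) (n : nat).
Implicit Types (f g : 'rV[R]_n -> R) (h : R -> R).

Lemma partialE f i g : (forall x, is_derive x 'e_i f (g x)) -> partial i f = g.
Proof. by move=> fg; apply/funext => x; have [_ <-] := fg x. Qed.

Lemma smooth_is_derive f i x : smooth f -> is_derive x 'e_i f (partial i f x).
Proof. by move=> sf; apply: derivableP; exact: smooth_derivable. Qed.

Lemma partialD f g i : smooth f -> smooth g ->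
  partial i (fun x => f x + g x) = fun x => partial i f x + partial i g x.
Proof.
move=> sf sg; apply: partialE => x.
exact: (is_deriveD (smooth_is_derive i x sf) (smooth_is_derive i x sg)).
Qed.

Lemma partialM f g i : smooth f -> smooth g ->
  partial i (fun x => f x * g x) = fun x => f x * partial i g x + g x * partial i f x.
Proof.
move=> sf sg; apply: partialE => x.
exact: (is_deriveM (smooth_is_derive i x sf) (smooth_is_derive i x sg)).
Qed.

Lemma partial_cst (c : R) i : partial i (fun=> c) = (fun=> 0 : R) :> ('rV[R]_n -> R).
Proof. by apply: partialE => x; exact: is_derive_cst. Qed.

Lemma partial_comp h h' f i : (forall s : R, is_derive s 1 h (h' s)) -> smooth f ->
  partial i (fun x => h (f x)) = fun x => h' (f x) * partial i f x.
Proof.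
move=> hh sf; apply: partialE => x.
exact: is_derive_comp1 (smooth_is_derive i x sf).
Qed.

Definition dotr (th x : 'rV[R]_n) : R := \sum_i th ord0 i * x ord0 i.

Lemma smooth_dotr th : smooth (dotr th).
Proof.
by apply: smooth_sum => i; apply: smoothM; [exact: smooth_cst|exact: smooth_coord].
Qed.

Lemma partial_coord i j : partial i (fun x : 'rV[R]_n => x ord0 j) = fun=> (i == j)%:R.
Proof.
apply: partialE => x; have := is_derive_coord j x 'e_i.
by rewrite mxE eqxx /= eq_sym.
Qed.

Lemma partial_dotr th i : partial i (dotr th) = fun=> th ord0 i.
Proof.
apply: partialE => x; apply: cvg_is_derive; apply/cvgrPdist_le => e e0; near=> k.
have k0 : k != 0 by near: k; exact: nbhs_dnbhs_neq.
rewrite /dotr -sumrB (bigD1 i)//= big1 => [|j ji].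
  rewrite !mxE eqxx /= mulr1 addr0 -mulrBr addrK /GRing.scale /= mulrCA mulVf// mulr1.
  by rewrite subrr normr0 ltW.
by rewrite !mxE /= (negbTE ji) mulr0 add0r subrr.
Unshelve. all: by end_near. Qed.

Definition dgrad (th : 'rV[R]_n) f x : R := \sum_i th ord0 i * partial i f x.

Lemma smooth_dgrad th f : smooth f -> smooth (dgrad th f).
Proof.
move=> sf; apply: smooth_sum => i.
by apply: smoothM; [exact: smooth_cst|exact: smooth_partial].
Qed.

Lemma bsupp_dgrad th f : bsupp f -> bsupp (dgrad th f).
Proof. by move=> sf; apply: bsupp_sum => i; apply: bsuppMr; exact: bsupp_derive. Qed.

(* The function [h] is a plane wave, [h' = k] and [k' = - h]. *)
Lemma laplacian_wave (h k : R -> R) th (a : 'rV[R]_n -> R) x : smooth a ->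
  smooth1 h -> smooth1 k ->
  (forall s : R, is_derive s 1 h (k s)) -> (forall s : R, is_derive s 1 k (- h s)) ->
  laplacian (fun x => a x * h (dotr th x)) x =
  laplacian a x * h (dotr th x) + 2 * dgrad th a x * k (dotr th x) -
  (\sum_i th ord0 i ^+ 2) * a x * h (dotr th x).
Proof.
move=> sa s1h s1k dh dk.
have sd := smooth_dotr th.
have sh : smooth (fun x => h (dotr th x)) by exact: smooth_comp.
have sk : smooth (fun x => k (dotr th x)) by exact: smooth_comp.
rewrite /laplacian /dgrad mulr_sumr !mulr_suml -big_split -sumrB/=.
apply: eq_bigr => i _.
have ph : partial i (fun x => h (dotr th x)) = fun x => k (dotr th x) * th ord0 i.
  by rewrite (partial_comp i dh sd) partial_dotr.
have pk : partial i (fun x => k (dotr th x)) = fun x => - h (dotr th x) * th ord0 i.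
  by rewrite (partial_comp i dk sd) partial_dotr.
have sc : smooth (fun _ : 'rV[R]_n => th ord0 i) by exact: smooth_cst.
have ska : smooth (fun x => k (dotr th x) * th ord0 i) by exact: smoothM.
have spa : smooth (partial i a) by exact: smooth_partial.
rewrite (partialM i sa sh) ph.
rewrite (partialD i (smoothM sa ska) (smoothM sh spa)).
rewrite (partialM i sa ska) (partialM i sh spa) (partialM i sk sc) partial_cst ph pk.
ring.
Qed.

End partial_rules.

Section schrodinger_unique.
Context (R : realType) (n : nat).
Local Notation mu := (@lebesgue_rV R n).

Lemma Re_mul_real (z : R[i]) (r : R) : complex.Re (z * r%:C%C) = complex.Re z * r.
Proof. by case: z => a b /=; rewrite mulr0 subr0. Qed.

Lemma Im_mul_real (z : R[i]) (r : R) : complex.Im (z * r%:C%C) = complex.Im z * r.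
Proof. by case: z => a b /=; rewrite mulr0 add0r. Qed.

Lemma bsupp_Lfun2 (f : 'rV[R]_n -> R) B : measurable_fun setT f ->
  (forall x, `|f x| <= B) -> bsupp f -> f \in Lfun mu 2%:E.
Proof.
move=> mf fB sf; rewrite inE; apply/andP; split; rewrite inE//=.
rewrite /finite_norm unlock.
rewrite poweR_lty//.
have i2 : mu.-integrable setT (EFin \o (fun x => f x ^+ 2)).
  apply: (@bsupp_integrable _ _ _ (B ^+ 2)).
  - exact: measurable_funX.
  - by move=> x; rewrite normrX ler_sqr ?nnegrE ?(le_trans _ (fB x)).
  - by under eq_fun do rewrite expr2; exact: bsuppMl.
have /integrableP[_] := i2; apply: le_lt_trans.
rewrite le_eqVlt; apply/orP; left; apply/eqP; apply: eq_integral => x _.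
by rewrite /= (powR_mulrn 2 (normr_ge0 (f x))) normrX.
Qed.

Lemma Cc_Lfun2 (f : 'rV[R]_n -> R) : Cc f -> f \in Lfun mu 2%:E.
Proof.
move=> [cf sf]; have [B _ fB] := bsupp_bounded cf sf.
by apply: (bsupp_Lfun2 _ fB) => //; exact: continuous_measurable_rV.
Qed.

(** [schrodinger] picks its value by choice, and this identifies the value. Real and imaginary parts
    of f1 - f2 annihilate all test functions; they are integrable on cubes, as products of two L^2
    functions. *)
Lemma weak_schrodinger_unique V (u f1 f2 : L2 R n) :
  weak_schrodinger V u f1 -> weak_schrodinger V u f2 -> f1 = f2.
Proof.
move=> w1 w2; rewrite -[f1]reprK -[f2]reprK; apply: pi_eq.
have sep (g1 g2 : 'rV[R]_n -> R) : g1 \in Lfun mu 2%:E -> g2 \in Lfun mu 2%:E ->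
    (forall phi, test_function phi -> \int[mu]_x (g1 x * phi x) = \int[mu]_x (g2 x * phi x)) ->
    {ae mu, forall x, g1 x = g2 x}.
  move=> L1 L2 h.
  have m1 := Lfun_measurable L1; have m2 := Lfun_measurable L2.
  have := @test_functions_separate R n (fun x => g1 x - g2 x).
  move=> /(_ _ _ _)/wrap[||phi tphi|].
  - exact: measurable_funB.
  - move=> k; have mC := measurable_cube (0 : 'rV[R]_n) k%:R.
    apply/(integrable_mkcond _ mC).
    have Lc : (\1_(cube 0 k%:R) : 'rV[R]_n -> R) \in Lfun mu 2%:E.
      apply: (@bsupp_Lfun2 _ 1).
      - exact: measurable_indic.
      - by move=> x; rewrite ger0_norm// indicE lern1 leq_b1.
      - by exists k => x; rewrite indicE pnatr_eq0 eqb0 negbK => /set_mem.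
    have := integrableB measurableT (Lfun2_mul_integrable L1 Lc) (Lfun2_mul_integrable L2 Lc).
    apply: eq_integrable => // x _; rewrite /= patchE indicE -EFinB.
    by case: ifP => _; rewrite ?mulr1 ?mulr0 ?subr0.
  - have Lp : phi \in Lfun mu 2%:E.
      apply: Cc_Lfun2; split; last exact: test_bsupp.
      by have [/(_ 0%N)[]] := tphi.
    under eq_Rintegral do rewrite mulrBl.
    rewrite RintegralB//; try exact: Lfun2_mul_integrable.
    by rewrite h// subrr.
  - by apply: filterS => x /eqP; rewrite subr_eq0 => /eqP.
have hR : {ae mu, forall x, complex.Re (repr f1 x) = complex.Re (repr f2 x)}.
  apply: sep; [exact: sqint_Re|exact: sqint_Re|move=> phi tphi].
  have E (f : L2 R n) : complex.Re (complex_integral (fun x => repr f x * (phi x)%:C%C)) =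
      \int[mu]_x (complex.Re (repr f x) * phi x).
    by apply: eq_Rintegral => x _; exact: Re_mul_real.
  by rewrite -!E -(w1 _ tphi) -(w2 _ tphi).
have hI : {ae mu, forall x, complex.Im (repr f1 x) = complex.Im (repr f2 x)}.
  apply: sep; [exact: sqint_Im|exact: sqint_Im|move=> phi tphi].
  have E (f : L2 R n) : complex.Im (complex_integral (fun x => repr f x * (phi x)%:C%C)) =
      \int[mu]_x (complex.Im (repr f x) * phi x).
    by apply: eq_Rintegral => x _; exact: Im_mul_real.
  by rewrite -!E -(w1 _ tphi) -(w2 _ tphi).
apply: filterS2 hR hI => x.
by move: (sqint_val (repr f1) x) (sqint_val (repr f2) x) => [? ?] [? ?] /= -> ->.
Qed.

End schrodinger_unique.

(** * The quasimode estimate *)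

Section stationary_estimate.
Context (R : realType) (n : nat) (V b : 'rV[R]_n -> R).
Local Notation mu := (@lebesgue_rV R n).

(** Apply the resolvent bound to U = (u, i l u). The first component of (A_b - i l) U vanishes and
    the second is - w; of the energy of U only the part l^2 |u|^2 is kept. Squaring the norms
    squares the constant. *)
Lemma stable_resolvent : uniformly_stable V b -> exists2 K : R, 0 < K &
  forall (l : R) u w, dom (schrodinger V) u ->
    w = schrodinger V u - ((l ^+ 2)%:C%C) *: u + mul_op b (Complex 0 l *: u) ->
    l ^+ 2 * rdot u u <= K * rdot w w.
Proof.
move=> [S [T [[[linS densS _] _ domP PS] HT HA [C [tau [C0 tau0 TC]]]]]].
have S0 : dom S 0.
  have [y Sy _] := densS 0 1 ltr01.
  by have [+ _] := linS (-1) _ _ Sy Sy; rewrite scaleN1r addNr.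
have N0 U : 0 <= energy_norm S U by rewrite energy_normE sqrtr_ge0.
have [K K0 hK] := @resolvent_bound R (L2 R n * L2 R n)%type (energy_space S)
  (energy_norm S) (energy_space_lin linS) S0 N0
  (energy_normD linS) (energy_normZ linS S0) T HT
  (damped_wave_op V b S) C tau HA C0 tau0 TC.
exists (K ^+ 2); first exact: exprn_gt0.
move=> l u w Pu wE.
have Su : dom S u by move: Pu; rewrite domP => -[].
have Sil : dom S (Complex 0 l *: u).
  by have [+ _] := linS (Complex 0 l) _ _ Su S0; rewrite addr0.
have := hK l (u, Complex 0 l *: u) (conj Pu Sil).
rewrite !energy_normE /=.
have -> : (- schrodinger V u - mul_op b (Complex 0 l *: u)) - Complex 0 l *: (Complex 0 l *: u) = - w.
  rewrite wE scalerA !opprD opprK.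
  have -> : Complex 0 l * Complex 0 l = - (l ^+ 2)%:C%C.
    by apply/eqP; rewrite eq_complex /= !mul0r mulr0 sub0r addr0 expr2 oppr0 !eqxx.
  by rewrite scaleNr opprK addrAC.
rewrite subrr linear_operator0//.
have -> : rdot (- w) (- w) = rdot w w.
  by rewrite -scaleN1r rdotZZ /= oppr0 expr0n sqrrN expr1n addr0 mul1r.
have r00 : rdot (0 : L2 R n) 0 = 0.
  by rewrite -(scale0r 0) rdotZZ /= expr0n addr0 mul0r.
rewrite r00 add0r rdotZZ /= expr0n add0r => h.
have h1 : Num.sqrt (l ^+ 2 * rdot u u) <= K * Num.sqrt (rdot w w).
  apply: le_trans h; rewrite ler_wsqrtr// lerDr; exact: rdot_ge0.
have w0 := rdot_ge0 w; have u0 := rdot_ge0 u.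
have lu : 0 <= l ^+ 2 * rdot u u by rewrite mulr_ge0 ?sqr_ge0.
have Kw : 0 <= K * Num.sqrt (rdot w w) by apply: mulr_ge0; [exact: ltW|exact: sqrtr_ge0].
by rewrite -(sqr_sqrtr lu) -(sqr_sqrtr w0) -exprMn ler_sqr ?nnegrE// sqrtr_ge0.
Qed.

Lemma schrodingerE u f : weak_schrodinger V u f ->
  dom (schrodinger V) u /\ schrodinger V u = f.
Proof.
move=> wf; split; first by exists f.
rewrite /schrodinger /=; case: xgetP => [y -> /= wy|/(_ f)//].
exact: weak_schrodinger_unique wy wf.
Qed.

Lemma mul_op_pi b' (F H : sqint_fun R n) : {ae mu, forall x, b x = b' x} ->
  (forall x, H x = (b' x)%:C%C * F x) -> mul_op b (\pi_(L2 R n) F) = \pi_(L2 R n) H.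
Proof.
move=> bb' HF; rewrite /mul_op; case: xgetP => [y -> /= hy|/(_ (\pi_(L2 R n) H))].
  rewrite -[LHS]reprK; apply: pi_eq.
  apply: filterS3 hy bb' (ae_repr_pi F) => x -> -> ->.
  by rewrite HF.
case; apply: filterS3 bb' (ae_repr_pi F) (ae_repr_pi H) => x -> -> ->.
by rewrite HF.
Qed.

Lemma sqint_pair (f g : 'rV[R]_n -> R) : f \in Lfun mu 2%:E -> g \in Lfun mu 2%:E ->
  (fun x => Complex (f x) (g x)) \in @sqint R n.
Proof. by move=> Lf Lg; apply/andP; split. Qed.

Lemma continuous_laplacian (phi : 'rV[R]_n -> R) : cont_diff 2 phi ->
  continuous (laplacian phi).
Proof.
move=> cp; rewrite /laplacian; elim: (index_enum _) => [|i r IH].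
  by under eq_fun do rewrite big_nil; exact: cst_continuous.
under eq_fun do rewrite big_cons.
have h : continuous (partial i (partial i phi)).
  by case: cp => _ /(_ i)[_ [_ /(_ i)[_ []]]].
by move=> x; exact: (cvgD (h x) (IH x)).
Qed.

Hypothesis contV : continuous V.

Lemma weak_schrodinger_real (u phi : 'rV[R]_n -> R) : smooth u -> bsupp u ->
  test_function phi ->
  \int[mu]_x (u x * (V x * phi x - 2^-1 * laplacian phi x)) =
  \int[mu]_x ((V x * u x - 2^-1 * laplacian u x) * phi x).
Proof.
move=> su bu tphi.
have cp := tphi.1 2%N; have cc : continuous phi by case: cp.
have cl := continuous_laplacian cp.
have Cu : Cc u by split => //; exact: smooth_continuous.
have Clu : Cc (laplacian u).
  split; last exact: bsupp_laplacian.
  by apply: smooth_continuous; exact: smooth_laplacian.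
have i1 : mu.-integrable setT (EFin \o (fun x => V x * u x * phi x)).
  by apply: Cc_integrable; apply: CcMl => //; exact: CcMr.
have i2 : mu.-integrable setT (EFin \o (fun x => u x * laplacian phi x)).
  by apply: Cc_integrable; exact: CcMl.
have i3 : mu.-integrable setT (EFin \o (fun x => laplacian u x * phi x)).
  by apply: Cc_integrable; exact: CcMl.
have i2' : mu.-integrable setT (EFin \o (fun x => 2^-1 * (u x * laplacian phi x))).
  exact: (integrableZl measurableT 2^-1 i2).
have i3' : mu.-integrable setT (EFin \o (fun x => 2^-1 * (laplacian u x * phi x))).
  exact: (integrableZl measurableT 2^-1 i3).
transitivity (\int[mu]_x (V x * u x * phi x - 2^-1 * (u x * laplacian phi x))).
  by apply: eq_Rintegral => x _; ring.
rewrite RintegralB// RintegralZl//.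
rewrite (laplacian_by_parts (smooth_cont_diff 2 su) bu cp).
rewrite -RintegralZl// -RintegralB//.
by apply: eq_Rintegral => x _; ring.
Qed.

Lemma weak_schrodinger_pi (u1 u2 : 'rV[R]_n -> R) (F G : sqint_fun R n) :
  smooth u1 -> bsupp u1 -> smooth u2 -> bsupp u2 ->
  (forall x, F x = Complex (u1 x) (u2 x)) ->
  (forall x, G x = Complex (V x * u1 x - 2^-1 * laplacian u1 x)
                           (V x * u2 x - 2^-1 * laplacian u2 x)) ->
  weak_schrodinger V (\pi_(L2 R n) F) (\pi_(L2 R n) G).
Proof.
move=> s1 b1 s2 b2 FE GE phi tphi.
have mphi : measurable_fun setT phi.
  by apply: continuous_measurable_rV; have [/(_ 0%N)[]] := tphi.
have mc : measurable_fun setT (fun x => V x * phi x - 2^-1 * laplacian phi x).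
  apply: continuous_measurable_rV.
  have [/(_ 2%N) cp _] := tphi; have cc : continuous phi by case: cp.
  have cl := continuous_laplacian cp.
  by move=> x; exact: (cvgB (cvgM (@contV x) (cc x)) (cvgM (@cvg_cst _ (2^-1 : R) _ (nbhs x) _) (cl x))).
have T (H : sqint_fun R n) (c : 'rV[R]_n -> R) : measurable_fun setT c ->
    complex_integral (fun x => repr (\pi_(L2 R n) H) x * (c x)%:C%C) =
    Complex (\int[mu]_x (complex.Re (H x) * c x)) (\int[mu]_x (complex.Im (H x) * c x)).
  move=> mcc; rewrite /complex_integral; congr Complex.
    apply: ae_eq_Rintegral.
    - rewrite (_ : (fun x => _) = fun x => complex.Re (repr (\pi_(L2 R n) H) x) * c x).
        by apply: measurable_funM => //; exact: measurable_Re.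
      by apply/funext => x; exact: Re_mul_real.
    - by apply: measurable_funM => //; exact: measurable_Re.
    - by apply: filterS (ae_repr_pi H) => x ->; exact: Re_mul_real.
  apply: ae_eq_Rintegral.
  - rewrite (_ : (fun x => _) = fun x => complex.Im (repr (\pi_(L2 R n) H) x) * c x).
        by apply: measurable_funM => //; exact: measurable_Im.
      by apply/funext => x; exact: Im_mul_real.
  - by apply: measurable_funM => //; exact: measurable_Im.
  - by apply: filterS (ae_repr_pi H) => x ->; exact: Im_mul_real.
rewrite !T//; congr Complex.
  under eq_Rintegral do rewrite FE /=.
  under [RHS]eq_Rintegral do rewrite GE /=.
  exact: weak_schrodinger_real.
under eq_Rintegral do rewrite FE /=.
under [RHS]eq_Rintegral do rewrite GE /=.
exact: weak_schrodinger_real.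
Qed.

End stationary_estimate.

Section quasimodes.
Context (R : realType) (n : nat) (V b b' : 'rV[R]_n -> R) (B : R).
Local Notation mu := (@lebesgue_rV R n).
Hypothesis contV : continuous V.
Hypothesis bb' : {ae mu, forall x, b x = b' x}.
Hypothesis mb' : measurable_fun setT b'.
Hypothesis b'B : forall x, 0 <= b' x <= B.

Let b'_norm x : `|b' x| <= B.
Proof. by have /andP[h1 h2] := b'B x; rewrite ger0_norm. Qed.

Let b'_Lfun2 (f : 'rV[R]_n -> R) : Cc f -> (fun x => b' x * f x) \in Lfun mu 2%:E.
Proof.
move=> [cf sf]; have [C C0 fC] := bsupp_bounded cf sf.
apply: (@bsupp_Lfun2 _ _ _ (B * C)); last exact: bsuppMr.
  by apply: measurable_funM => //; exact: continuous_measurable_rV.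
by move=> x; rewrite normrM ler_pM.
Qed.

Lemma b'_sqr_integrable (a : 'rV[R]_n -> R) : Cc a ->
  mu.-integrable setT (EFin \o (fun x => b' x ^+ 2 * a x ^+ 2)).
Proof.
move=> Ca; have := Lfun2_mul_integrable (b'_Lfun2 Ca) (b'_Lfun2 Ca).
by apply: eq_integrable => // x _ /=; congr EFin; ring.
Qed.

(* The energy estimate of the quasimode [a x * exp(i th.x)]. *)
Lemma quasimode_estimate : uniformly_stable V b -> exists2 K : R, 0 < K &
  forall (l : R) (th : 'rV[R]_n) (a : 'rV[R]_n -> R), smooth a -> bsupp a ->
  l ^+ 2 * \int[mu]_x (a x ^+ 2) <=
  K * (\int[mu]_x (((V x + 2^-1 * \sum_i th ord0 i ^+ 2 - l ^+ 2) * a x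
                    - 2^-1 * laplacian a x) ^+ 2)
       + 2 * l ^+ 2 * \int[mu]_x (b' x ^+ 2 * a x ^+ 2)
       + 2 * \int[mu]_x (dgrad th a x ^+ 2)).
Proof.
move=> /stable_resolvent [K K0 hK]; exists K => // l th a sa ba.
pose c x := cos (dotr th x); pose s x := sin (dotr th x).
have [s1s s1c] := @smooth1_sin_cos R.
have sc : smooth c by apply: (@smooth_comp _ _ cos) => //; exact: smooth_dotr.
have ss : smooth s by apply: (@smooth_comp _ _ sin) => //; exact: smooth_dotr.
pose u1 x := a x * c x; pose u2 x := a x * s x.
have su1 : smooth u1 by exact: smoothM.
have su2 : smooth u2 by exact: smoothM.
have bu1 : bsupp u1 by exact: bsuppMl.
have bu2 : bsupp u2 by exact: bsuppMl.
have CS (u : 'rV[R]_n -> R) : smooth u -> bsupp u -> Cc u.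
  by move=> su bu; split => //; exact: smooth_continuous.
have LP (u : 'rV[R]_n -> R) : smooth u -> bsupp u ->
    Cc (fun x => V x * u x - 2^-1 * laplacian u x).
  move=> su bu; apply: CcD; first by apply: CcMr => //; exact: (CS _).
  apply: CcN; apply: CcMr; first exact: cst_continuous.
  by apply: (CS _); [exact: smooth_laplacian|exact: bsupp_laplacian].
pose F := SqintFun (sqint_pair (Cc_Lfun2 (CS _ su1 bu1)) (Cc_Lfun2 (CS _ su2 bu2))).
pose G := SqintFun (sqint_pair (Cc_Lfun2 (LP _ su1 bu1)) (Cc_Lfun2 (LP _ su2 bu2))).
have Lb1 : (fun x => b' x * (- l * u2 x)) \in Lfun mu 2%:E.
  by apply: b'_Lfun2; apply: CcMr; [exact: cst_continuous|exact: (CS _)].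
have Lb2 : (fun x => b' x * (l * u1 x)) \in Lfun mu 2%:E.
  by apply: b'_Lfun2; apply: CcMr; [exact: cst_continuous|exact: (CS _)].
pose H := SqintFun (sqint_pair Lb1 Lb2).
have wFG : weak_schrodinger V (\pi_(L2 R n) F) (\pi_(L2 R n) G).
  exact: (@weak_schrodinger_pi _ _ _ contV u1 u2).
have [dF PF] := schrodingerE wFG.
have HE : mul_op b (Complex 0 l *: \pi_(L2 R n) F) = \pi_(L2 R n) H.
  rewrite piZ; apply: (@mul_op_pi _ _ _ b') => // x.
  rewrite sqintZE /= /F /=; apply/eqP; rewrite eq_complex /=.
  by apply/andP; split; apply/eqP; ring.
have := hK l _ _ dF erefl; rewrite PF HE piZ piN !piD !rdot_pi.
have -> : \int[mu]_x (complex.Re (F x) * complex.Re (F x) + complex.Im (F x) * complex.Im (F x)) =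
    \int[mu]_x (a x ^+ 2).
  apply: eq_Rintegral => x _; rewrite /F /= /u1 /u2.
  have := cos2Dsin2 (dotr th x); rewrite -/(c x) -/(s x) => h.
  rewrite -[RHS]mulr1 -h; ring.
move=> h; apply: le_trans h _; rewrite ler_pM2l//.
set t2 := \sum_i _.
have CA : Cc (fun x => (V x + 2^-1 * t2 - l ^+ 2) * a x - 2^-1 * laplacian a x).
  apply: CcD.
    apply: CcMr; last exact: (CS _).
    by move=> x; exact: (cvgB (cvgD (@contV x) (@cvg_cst _ (2^-1 * t2 : R) _ (nbhs x) _)) (@cvg_cst _ (l ^+ 2 : R) _ (nbhs x) _)).
  apply: CcN; apply: CcMr; first exact: cst_continuous.
  by apply: (CS _); [exact: smooth_laplacian|exact: bsupp_laplacian].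
have CD : Cc (dgrad th a) by apply: (CS _); [exact: smooth_dgrad|exact: bsupp_dgrad].
have sqI (f : 'rV[R]_n -> R) : Cc f -> mu.-integrable setT (EFin \o (fun x => f x ^+ 2)).
  move=> Cf; apply: Cc_integrable; rewrite (_ : (fun _ => _) = fun x => f x * f x).
    by apply: CcMl => //; case: Cf.
  by apply/funext => x; rewrite expr2.
have iA := sqI _ CA; have iD := sqI _ CD.
have iD2 := integrableZl measurableT 2 iD.
have iB := b'_sqr_integrable (CS _ sa ba).
have iB2 := integrableZl measurableT (2 * l ^+ 2) iB.
rewrite -(RintegralZl (2 * l ^+ 2) measurableT iB) -(RintegralZl 2 measurableT iD).
rewrite -RintegralD// -RintegralD//; last exact: (integrableD measurableT iA iB2).
apply: le_Rintegral => //.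
- exact: rdot_integrable.
- exact: (integrableD measurableT (integrableD measurableT iA iB2) iD2).
move=> x _; rewrite !sqintDE sqintNE sqintZE /= /u1 /u2.
have ds (r : R) : is_derive r 1 (fun r : R => - sin r) (- cos r) by exact: is_deriveN.
have s1ns : smooth1 (fun r : R => - sin r) by exact: smooth1N.
rewrite (@laplacian_wave R n cos (fun r => - sin r) th a x sa s1c s1ns (@is_derive_cos R) ds).
rewrite (@laplacian_wave R n sin cos th a x sa s1s s1c (@is_derive_sin R) (@is_derive_cos R)).
have := cos2Dsin2 (dotr th x); rewrite -/(c x) -/(s x) -/t2.
move: (c x) (s x) (V x) (a x) (b' x) (laplacian a x) (dgrad th a x) => C' S' V' a' B' L' D' h.
(* Up to the phase exp(i th.x), of modulus 1, the vector w has real part (V + |th|^2/2 - l^2) a -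
   (Laplacian a)/2 and imaginary part l b a - th.grad a. The square of the latter is then split by
   (p - q)^2 <= 2 p^2 + 2 q^2. *)
rewrite [leLHS](_ : _ = (C' ^+ 2 + S' ^+ 2) * (((V' + 2^-1 * t2 - l ^+ 2) * a' - 2^-1 * L') ^+ 2 + (l * B' * a' - D') ^+ 2)); last by field.
rewrite h mul1r -[leRHS]addrA lerD2l.
have := sqr_ge0 (l * B' * a' + D'); rewrite -subr_ge0 => h2; rewrite -subr_ge0.
apply: le_trans h2 _; rewrite le_eqVlt; apply/orP; left; apply/eqP; ring.
Qed.

End quasimodes.

(** * Balls, lines and ellipsoids *)

Section euclidean_balls.
Context (R : realType) (n : nat).
Local Notation mu := (@lebesgue_rV R n).
Implicit Types (x y nu : 'rV[R]_n) (r s : R).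

Definition sqn x : R := \sum_i x ord0 i ^+ 2.

Lemma sqn_ge0 x : 0 <= sqn x.
Proof. by apply: sumr_ge0 => i _; exact: sqr_ge0. Qed.

Lemma eucl_normE x : eucl_norm x = Num.sqrt (sqn x).
Proof. by []. Qed.

Lemma in_eucl_ball x r y : 0 < r -> eucl_ball x r y <-> sqn (y - x) < r ^+ 2.
Proof.
move=> r0; rewrite /eucl_ball /= eucl_normE -{1}(gtr0_norm r0) -sqrtr_sqr.
by rewrite ltr_sqrt ?exprn_gt0.
Qed.

Lemma coord_le_sqn x i : x ord0 i ^+ 2 <= sqn x.
Proof. by rewrite /sqn (bigD1 i)//= lerDl sumr_ge0// => j _; exact: sqr_ge0. Qed.

Lemma measurable_sqn d (T : measurableType d) (f : T -> 'rV[R]_n) :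
  (forall i, measurable_fun setT (fun t => f t ord0 i)) ->
  measurable_fun setT (fun t => sqn (f t)).
Proof.
move=> mf; apply: measurable_sum => i.
by under eq_fun do rewrite expr2; exact: measurable_funM.
Qed.

Lemma measurable_sublevel d (T : measurableType d) (f : T -> R) c :
  measurable_fun setT f -> measurable [set t | f t < c].
Proof.
move=> mf; have := mf measurableT `]-oo, c[%classic (measurable_itv _).
rewrite setTI (_ : f @^-1` _ = [set t | f t < c])//.
Qed.

Lemma eucl_ballE x r : 0 < r -> eucl_ball x r = [set y | sqn (y - x) < r ^+ 2].
Proof. move=> r0; apply/seteqP; split => y h.
  exact: (in_eucl_ball x y r0).1 h.
exact: (in_eucl_ball x y r0).2 h. Qed.

Lemma measurable_eucl_ball x r : 0 < r -> measurable (eucl_ball x r).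
Proof.
move=> r0; rewrite eucl_ballE//; apply: measurable_sublevel.
apply: measurable_sqn => i; under eq_fun do rewrite !mxE.
by apply: measurable_funB => //; exact: measurable_coord.
Qed.

Lemma eucl_ball_cube x r : 0 < r -> eucl_ball x r `<=` cube x r.
Proof.
move=> r0 y /(in_eucl_ball x y r0).1 h; apply/in_cube => i.
have := le_lt_trans (coord_le_sqn (y - x) i) h; rewrite !mxE => h2.
have : `|y ord0 i - x ord0 i| < r.
  by rewrite -(gtr0_norm r0) -!sqrtr_sqr ltr_sqrt ?exprn_gt0.
by rewrite ltr_norml => /andP[? ?]; apply/andP; split; lra.
Qed.

Hypothesis n_gt0 : (0 < n)%N.
Let N0 : 0 < n%:R :> R. Proof. by rewrite ltr0n. Qed.

Lemma cube_eucl_ball x r : 0 < r -> cube x (r / (2 * n%:R)) `<=` eucl_ball x r.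
Proof.
move=> r0 y /in_cube h; apply/(in_eucl_ball x y r0).
set s := r / _ in h.
have s0 : 0 < s by rewrite divr_gt0// mulr_gt0.
have : sqn (y - x) <= n%:R * s ^+ 2.
  rewrite mulr_natl -[X in _ *+ X](card_ord n) -sumr_const; apply: ler_sum => i _.
  have /andP[h1 h2] := h i; rewrite !mxE -subr_ge0 subr_sqr.
  by apply: mulr_ge0; lra.
move=> h1; apply: le_lt_trans h1 _.
have -> : n%:R * s ^+ 2 = r ^+ 2 / (4 * n%:R) by rewrite /s; field; rewrite gt_eqF.
rewrite gtr_pMr ?exprn_gt0// invf_lt1; last by rewrite mulr_gt0.
by have : 1 <= n%:R :> R; [rewrite ler1n|lra].
Qed.

(** With [mu_eucl_ball_ge], comparison with a circumscribed and an inscribed cube gives the order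
    r^n of the volume, uniformly in the centre. *)
Lemma mu_eucl_ball_le x r : 0 < r -> (mu (eucl_ball x r) <= ((2 * r) ^+ n)%:E)%E.
Proof.
move=> r0; rewrite -(mu_cube x (ltW r0)); apply: le_measure; rewrite ?inE.
- exact: measurable_eucl_ball.
- exact: measurable_cube.
- exact: eucl_ball_cube.
Qed.

Lemma mu_eucl_ball_ge x r : 0 < r -> (((r / n%:R) ^+ n)%:E <= mu (eucl_ball x r))%E.
Proof.
move=> r0; have r1 : 0 <= r / (2 * n%:R) by rewrite divr_ge0 ?mulr_ge0// ltW.
have -> : r / n%:R = 2 * (r / (2 * n%:R)) by field; rewrite gt_eqF.
rewrite -(mu_cube x r1); apply: le_measure; rewrite ?inE.
- exact: measurable_cube.
- exact: measurable_eucl_ball.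
- exact: cube_eucl_ball.
Qed.

Lemma mu_eucl_ball_fin x r : 0 < r -> mu (eucl_ball x r) \is a fin_num.
Proof. by move=> r0; rewrite ge0_fin_numE// (le_lt_trans (mu_eucl_ball_le x r0))// ltry. Qed.

End euclidean_balls.

Section lines.
Context (R : realType) (n : nat).
Local Notation mu := (@lebesgue_rV R n).
Local Notation lam := (@lebesgue_measure R).
Variables (x0 nu : 'rV[R]_n).

(** The times at which a ball of radius [r], moving along the line through [x0] with velocity [nu],
    covers [y]. The length of this set is the weight of [y] in a line average. *)
Definition slice (S r : R) (y : 'rV[R]_n) : set (measurableTypeR R) :=
  [set s | s \in `[- S, S] /\ sqn (y - (x0 + s *: nu)) < r ^+ 2].

Let tube (S r : R) : set (measurableTypeR R * 'rV[R]_n) :=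
  [set p | p.1 \in `[- S, S]] `&` [set p | sqn (p.2 - (x0 + p.1 *: nu)) < r ^+ 2].

Let measurable_tube S r : measurable (tube S r).
Proof.
apply: measurableI.
  have := @measurable_fst _ _ (measurableTypeR R) 'rV[R]_n measurableT `[(- S)%R, S]%classic.
  by rewrite setTI; apply; exact: measurable_itv.
apply: measurable_sublevel; apply: measurable_sqn => i.
under eq_fun do rewrite !mxE.
apply: measurable_funB; first exact: (measurableT_comp (measurable_coord i) measurable_snd).
apply: measurable_realfun.measurable_funD => //.
by apply: measurable_funM => //; exact: measurable_fst.
Qed.

Let sliceE S r y : slice S r y = ysection (tube S r) y.
Proof. by apply/seteqP; split => s; rewrite /ysection /= inE. Qed.

Lemma measurable_slice S r y : measurable (slice S r y).
Proof. by rewrite sliceE; exact: measurable_ysection. Qed.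

Lemma measurable_lam_slice S r : measurable_fun setT (fun y => lam (slice S r y)).
Proof.
rewrite (_ : (fun _ => _) = lam \o ysection (tube S r)).
  exact: measurable_fun_ysection.
by apply/funext => y; rewrite sliceE.
Qed.

Section tonelli.
Variables (f : 'rV[R]_n -> R) (S r : R).
Hypotheses (r0 : 0 < r) (mf : measurable_fun setT f) (f0 : forall y, 0 <= f y).

Let G (p : measurableTypeR R * 'rV[R]_n) : \bar R := (f p.2 * \1_(tube S r) p)%:E.

Let mG : measurable_fun setT G.
Proof.
apply/measurable_EFinP; apply: measurable_funM.
  exact: (measurableT_comp mf measurable_snd).
exact: measurable_indic.
Qed.

Let G0 p : (0 <= G p)%E. Proof. by rewrite lee_fin mulr_ge0. Qed.

Let GF s : (\int[mu]_y G (s, y) =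
  ((fun s => \int[mu]_(y in eucl_ball (x0 + s *: nu) r) (f y)%:E) \_ `[(- S)%R, S]) s)%E.
Proof.
rewrite patchE; case: ifPn => [/set_mem sS|sS].
  rewrite [RHS]integral_mkcond; apply: eq_integral => y _; rewrite patchE /G.
  rewrite eucl_ballE// indicE.
  case: (boolP (y \in _)) => yB.
    by rewrite mem_set ?mulr1//; split => //; have := set_mem yB.
  rewrite memNset ?mulr0// => -[_ /= h]; move/negP: yB; apply; exact/mem_set.
rewrite integral0_eq// => y _; rewrite /G indicE memNset ?mulr0// => -[/= h _].
by move/negP: sS; apply; exact/mem_set.
Qed.

Lemma measurable_line : measurable_fun (`[(- S)%R, S]%classic : set (measurableTypeR R))
  (fun s => \int[mu]_(y in eucl_ball (x0 + s *: nu) r) (f y)%:E)%E.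
Proof.
apply/(measurable_restrictT _ (measurable_itv _)).
rewrite (_ : _ \_ _ = fun s => \int[mu]_y G (s, y))%E; last by apply/funext => s; rewrite GF.
exact: (measurable_fun_fubini_tonelli_F G mG G0).
Qed.

(** Tonelli for [f] times the indicator of the tube, whose sections are balls for fixed time and
    slices for fixed point. *)
Lemma line_tonelli :
  (\int[lam]_(s in `[(- S)%R, S]) \int[mu]_(y in eucl_ball (x0 + s *: nu) r) (f y)%:E =
   \int[mu]_y ((f y)%:E * lam (slice S r y)))%E.
Proof.
have := fubini_tonelli (m1 := lam) (m2 := mu) G mG G0.
under eq_integral do rewrite GF.
rewrite -integral_mkcond => ->; apply: eq_integral => y _.
have ms := measurable_slice S r y.
under eq_integral => s _.
  rewrite /G /= EFinM (_ : \1_(tube S r) (s, y) = \1_(slice S r y) s); last first.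
    by rewrite !indicE; congr (nat_of_bool _)%:R; apply/idP/idP => /set_mem h; apply/mem_set.
  over.
rewrite ge0_integralZl//.
- by rewrite integral_indic// setIT.
- by apply/measurable_EFinP; exact: measurable_indic.
- by rewrite lee_fin f0.
Qed.

End tonelli.

End lines.

Section ellipsoids.
Context (R : realType) (n : nat).
Local Notation mu := (@lebesgue_rV R n).
Local Notation lam := (@lebesgue_measure R).
Variables (x0 nu : 'rV[R]_n) (L rho : R).
Hypotheses (nu1 : sqn nu = 1) (rho0 : 0 < rho) (rhoL : rho <= L).

(** The component of y - x0 along the axis. Here and in the next two definitions sums and products
    are spelled out, with [+ -] and without powers of functions, to match the constructors of
    [smooth]. *)
Definition axis_coord (y : 'rV[R]_n) : R := dotr nu y + - dotr nu x0.

Definition sqdist (y : 'rV[R]_n) : R :=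
  \sum_i (y ord0 i + - x0 ord0 i) * (y ord0 i + - x0 ord0 i).

(* The quadratic form of the ellipsoid of centre [x0], with semi-axis [L] in the
   direction [nu] and [rho] in the orthogonal directions. *)
Definition ell_form (y : 'rV[R]_n) : R :=
  rho ^- 2 * sqdist y + (L ^- 2 - rho ^- 2) * (axis_coord y * axis_coord y).

Definition ellipsoid (c : R) := [set y | ell_form y < c].

Let L0 : 0 < L. Proof. exact: lt_le_trans rhoL. Qed.

Lemma sqdistE y : sqdist y = sqn (y - x0).
Proof. by apply: eq_bigr => i _; rewrite !mxE expr2. Qed.

Lemma axis_coordE y : axis_coord y = \sum_i nu ord0 i * (y ord0 i - x0 ord0 i).
Proof. by rewrite /axis_coord /dotr -sumrB; apply: eq_bigr => i _; rewrite mulrBr. Qed.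

(** Pythagoras, as [nu] is a unit vector: squared distance to the axis plus squared distance along
    it. *)
Lemma sqn_line s y : sqn (y - (x0 + s *: nu)) =
  sqdist y - axis_coord y ^+ 2 + (s - axis_coord y) ^+ 2.
Proof.
have -> : sqn (y - (x0 + s *: nu)) = sqdist y - 2 * s * axis_coord y + s ^+ 2 * sqn nu.
  rewrite axis_coordE /sqdist /sqn !mulr_sumr -sumrB -big_split /=.
  by apply: eq_bigr => i _; rewrite !mxE; ring.
rewrite nu1; ring.
Qed.

Lemma axis_coord_le y : axis_coord y ^+ 2 <= sqdist y.
Proof.
have := sqn_ge0 (y - (x0 + axis_coord y *: nu)).
by rewrite sqn_line subrr expr0n /= addr0 subr_ge0.
Qed.

Lemma ell_formE y :
  ell_form y = (sqdist y - axis_coord y ^+ 2) / rho ^+ 2 + axis_coord y ^+ 2 / L ^+ 2.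
Proof. by rewrite /ell_form; field; rewrite !gt_eqF. Qed.

Lemma ell_form_ge0 y : 0 <= ell_form y.
Proof.
rewrite ell_formE addr_ge0// divr_ge0 ?sqr_ge0// subr_ge0; exact: axis_coord_le.
Qed.

Lemma ellipsoid_axis c y : 0 < c -> ellipsoid c y -> axis_coord y ^+ 2 < c * L ^+ 2 /\
  sqdist y - axis_coord y ^+ 2 < c * rho ^+ 2.
Proof.
move=> c0; rewrite /ellipsoid /= ell_formE => h.
have h1 : 0 <= (sqdist y - axis_coord y ^+ 2) / rho ^+ 2.
  by rewrite divr_ge0 ?sqr_ge0// subr_ge0; exact: axis_coord_le.
have h2 : 0 <= axis_coord y ^+ 2 / L ^+ 2 by rewrite divr_ge0 ?sqr_ge0.
by split; rewrite -ltr_pdivrMr ?exprn_gt0//; lra.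
Qed.

Lemma smooth_axis_coord : smooth axis_coord.
Proof. by apply: smoothD; [exact: smooth_dotr|exact: smooth_cst]. Qed.

Lemma smooth_sqdist : smooth sqdist.
Proof.
apply: smooth_sum => i; apply: smoothM; apply: smoothD; try exact: smooth_cst;
  exact: smooth_coord.
Qed.

Lemma smooth_ell_form : smooth ell_form.
Proof.
apply: smoothD; apply: smoothM; try exact: smooth_cst; first exact: smooth_sqdist.
by apply: smoothM; exact: smooth_axis_coord.
Qed.

Lemma measurable_ellipsoid c : measurable (ellipsoid c).
Proof.
apply: measurable_sublevel; apply: continuous_measurable_rV.
exact: smooth_continuous smooth_ell_form.
Qed.

Lemma slice_itv S r y : slice x0 nu S r y = [set s | s \in `[- S, S] /\
  sqdist y - axis_coord y ^+ 2 + (s - axis_coord y) ^+ 2 < r ^+ 2].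
Proof. by apply/seteqP; split => s; rewrite /slice /mkset sqn_line. Qed.

Lemma lam_itv (u v : R) : u <= v -> (lam (`]u, v[%classic : set (measurableTypeR R)) = (v - u)%:E).
Proof.
move=> uv; rewrite lebesgue_measure_itv /= lte_fin; case: ltP => [_|vu]; first by rewrite EFinB.
have uvE : u = v by apply/eqP; rewrite eq_le uv vu.
by rewrite uvE subrr.
Qed.

Lemma lam_seg (S : R) : 0 < S ->
  lam (`[- S, S]%classic : set (measurableTypeR R)) = (2 * S)%:E.
Proof.
move=> S0; rewrite lebesgue_measure_itv /= lte_fin ifT; last by lra.
by rewrite -EFinB; congr EFin; ring.
Qed.

Lemma sqr_lt_itv (t c : R) : 0 < c -> t ^+ 2 < c ^+ 2 -> - c < t < c.
Proof. by move=> c0 h; rewrite -ltr_norml -(gtr0_norm c0) -!sqrtr_sqr ltr_sqrt ?exprn_gt0. Qed.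

Lemma itv_sqr_lt (t c : R) : - c < t < c -> t ^+ 2 < c ^+ 2.
Proof. by move=> /andP[h1 h2]; rewrite -subr_gt0 subr_sqr; apply: mulr_gt0; lra. Qed.

(** The point has axis coordinate |T| < L and distance less than rho to the axis. So all times
    within rho of T lie in [-2L, 2L], and then the point is at distance less than sqrt 2 rho from
    the centre of the moving ball. *)
Lemma lam_slice_ge y : ellipsoid 1 y ->
  ((2 * rho)%:E <= lam (slice x0 nu (2 * L) (2 * rho) y))%E.
Proof.
move: (rho0) (rhoL) (L0) => rho0' rhoL' L0'.
move=> /(ellipsoid_axis ltr01); rewrite !mul1r => -[/(sqr_lt_itv L0)/andP[h1 h2] h3].
set T := axis_coord y in h1 h2 h3 *.
have -> : (2 * rho)%:E = lam (`]T - rho, T + rho[%classic : set (measurableTypeR R)).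
  have h : T - rho <= T + rho by lra.
  by rewrite (lam_itv h); congr EFin; ring.
apply: le_measure; rewrite ?inE; [exact: measurable_itv|exact: measurable_slice|].
have H (s : R) : T - rho < s < T + rho -> (- (2 * L) <= s <= 2 * L) /\
    sqdist y - T ^+ 2 + (s - T) ^+ 2 < (2 * rho) ^+ 2.
  move=> /andP[s1 s2]; split; first by apply/andP; split; lra.
  have : (s - T) ^+ 2 < rho ^+ 2 by apply: itv_sqr_lt; apply/andP; split; lra.
  have := exprn_gt0 2 rho0; rewrite exprMn; lra.
by move=> s; rewrite /= in_itv slice_itv /= in_itv; exact: H.
Qed.

(** A point met at a time |s0| <= L/4 within rho/4 has |T| < L/4 + rho/4 <= L/2 and distance less
    than rho/4 to the axis, so its form is below 1/4 + 1/16 < 1/2. The times of contact lie within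
    rho/4 of T. *)
Lemma lam_slice_le y :
  (lam (slice x0 nu (L / 4) (rho / 4) y) <= (rho / 2)%:E * (\1_(ellipsoid (2^-1)) y)%:E)%E.
Proof.
move: (rho0) (rhoL) (L0) => rho0' rhoL' L0'.
have [->|/set0P[s0]] := eqVneq (slice x0 nu (L / 4) (rho / 4) y) set0.
  by rewrite measure0 mule_ge0// lee_fin// divr_ge0// ltW.
have r4 : 0 < rho / 4 by rewrite divr_gt0.
set T := axis_coord y.
have Tsub s : slice x0 nu (L / 4) (rho / 4) y s -> T - rho / 4 < s < T + rho / 4.
  rewrite slice_itv /= -/T => -[_ h].
  have : (s - T) ^+ 2 < (rho / 4) ^+ 2.
    by have := axis_coord_le y; rewrite -/T => ?; lra.
  by move=> /(sqr_lt_itv r4) /andP[? ?]; apply/andP; split; lra.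
move=> hs0; have /andP[t1 t2] := Tsub _ hs0.
rewrite slice_itv in hs0; move: hs0; rewrite /= -/T in_itv /= => -[/andP[b1 b2] h].
have P2 : sqdist y - T ^+ 2 < (rho / 4) ^+ 2.
  by have := sqr_ge0 (s0 - T); lra.
have T2 : T ^+ 2 < (L / 2) ^+ 2 by apply: itv_sqr_lt; apply/andP; split; lra.
have yE : ellipsoid 2^-1 y.
  rewrite /ellipsoid /= ell_formE -/T.
  have : (sqdist y - T ^+ 2) / rho ^+ 2 < 16^-1.
    rewrite ltr_pdivrMr ?exprn_gt0//; lra.
  have : T ^+ 2 / L ^+ 2 < 4^-1 by rewrite ltr_pdivrMr ?exprn_gt0//; lra.
  lra.
rewrite indicE mem_set// mule1.
have -> : (rho / 2)%:E = lam (`]T - rho / 4, T + rho / 4[%classic : set (measurableTypeR R)).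
  have h' : T - rho / 4 <= T + rho / 4 by lra.
  by rewrite (lam_itv h'); congr EFin; field.
apply: le_measure; rewrite ?inE; [exact: measurable_slice|exact: measurable_itv|].
by move=> s /Tsub; rewrite /= in_itv.
Qed.

Hypothesis n_gt0 : (0 < n)%N.

Let int1 A : measurable A -> (\int[mu]_(y in A) (cst (1 : R) y)%:E = mu A)%E.
Proof. by move=> mA; rewrite (eq_integral (cst 1%:E))// integral_cst// mul1e. Qed.

Let mu_line (S r : R) : 0 < r ->
  (\int[lam]_(s in `[(- S)%R, S]) mu (eucl_ball (x0 + s *: nu) r) =
   \int[mu]_y lam (slice x0 nu S r y))%E.
Proof.
move=> r0; have := @line_tonelli R n x0 nu (cst 1) S r r0 (measurable_cst _) (fun=> ler01).
under [X in _ = X -> _]eq_integral do rewrite mul1e.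
move=> <-; apply: eq_integral => s _.
by rewrite int1//; exact: measurable_eucl_ball.
Qed.

Let measurable_mu_line (S r : R) : 0 < r ->
  measurable_fun (`[(- S)%R, S]%classic : set (measurableTypeR R))
    (fun s => mu (eucl_ball (x0 + s *: nu) r)).
Proof.
move=> r0; have := @measurable_line R n x0 nu (cst 1) S r r0 (measurable_cst _) (fun=> ler01).
apply: eq_measurable_fun => s _.
by rewrite int1//; exact: measurable_eucl_ball.
Qed.

(** The volumes of the balls moving along the axis are integrated over time, and Tonelli counts each
    point of the ellipsoid for a time at least 2 rho. This yields the order L rho^(n-1);
    [mu_ellipsoid_ge] is the converse, with smaller balls. *)
Lemma mu_ellipsoid_le :
  ((2 * rho)%:E * mu (ellipsoid 1) <= (4 * L * (4 * rho) ^+ n)%:E)%E.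
Proof.
move: (rho0) (rhoL) (L0) => rho0' rhoL' L0'.
have r2 : 0 < 2 * rho by rewrite mulr_gt0.
have -> : (4 * L * (4 * rho) ^+ n)%:E =
    (\int[lam]_(s in `[(- (2 * L))%R, (2 * L)%R]) (((4 * rho) ^+ n)%:E))%E.
  rewrite integral_cst// [X in (_ * X)%E]lam_seg; last by lra.
  by rewrite -EFinM; congr EFin; ring.
apply: (@le_trans _ _ (\int[mu]_y lam (slice x0 nu (2 * L) (2 * rho) y))%E); last first.
  rewrite -mu_line//; apply: ge0_le_integral => //.
  - exact: measurable_mu_line.
  - by move=> s _; have := mu_eucl_ball_le (x0 + s *: nu) r2; rewrite mulrA -natrM.
rewrite -[X in (_ * mu X)%E]setIT -integral_indic//; last exact: measurable_ellipsoid.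
rewrite -ge0_integralZl//; last first.
- by rewrite lee_fin ltW.
- by apply/measurable_EFinP; apply: measurable_indic; exact: measurable_ellipsoid.
apply: ge0_le_integral => //.
- by move=> y _; rewrite mule_ge0// lee_fin// ltW.
- apply: emeasurable_funM => //.
  by apply/measurable_EFinP; apply: measurable_indic; exact: measurable_ellipsoid.
- exact: measurable_lam_slice.
- move=> y _; rewrite indicE; case: (boolP (y \in _)) => [/set_mem yE|_].
    by rewrite mule1; exact: lam_slice_ge.
  by rewrite mule0.
Qed.

Lemma mu_ellipsoid_ge :
  ((L / 2 * (rho / (4 * n%:R)) ^+ n)%:E <= (rho / 2)%:E * mu (ellipsoid 2^-1))%E.
Proof.
move: (rho0) (rhoL) (L0) => rho0' rhoL' L0'.
have r4 : 0 < rho / 4 by rewrite divr_gt0.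
have -> : (L / 2 * (rho / (4 * n%:R)) ^+ n)%:E =
    (\int[lam]_(s in `[(- (L / 4))%R, (L / 4)%R]) (((rho / (4 * n%:R)) ^+ n)%:E))%E.
  rewrite integral_cst// [X in (_ * X)%E]lam_seg; last by lra.
  by rewrite -EFinM; congr EFin; move: (_ ^+ n) => z; field.
apply: (@le_trans _ _ (\int[mu]_y lam (slice x0 nu (L / 4) (rho / 4) y))%E).
  rewrite -mu_line//; apply: ge0_le_integral => //.
  - by move=> s _; rewrite lee_fin exprn_ge0// divr_ge0 ?mulr_ge0// ltW.
  - exact: measurable_mu_line.
  - move=> s _; have := mu_eucl_ball_ge n_gt0 (x0 + s *: nu) r4.
    by rewrite invfM mulrA.
rewrite -[X in (_ * mu X)%E]setIT -integral_indic//; last exact: measurable_ellipsoid.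
have r2 : 0 <= rho / 2 by rewrite divr_ge0// ltW.
rewrite -ge0_integralZl//; last first.
- by apply/measurable_EFinP; apply: measurable_indic; exact: measurable_ellipsoid.
apply: ge0_le_integral => //.
- exact: measurable_lam_slice.
- apply: emeasurable_funM => //.
  by apply/measurable_EFinP; apply: measurable_indic; exact: measurable_ellipsoid.
- by move=> y _; exact: lam_slice_le.
Qed.

End ellipsoids.

(** * Bump functions on ellipsoids *)

Section flat_bounds.
Context (R : realType).

Lemma flat_bounded (p : {poly R}) :
  exists2 C : R, 0 < C & forall s, s <= 1 -> `|flat p s| <= C.
Proof.
have [C C0 hC] := horner_expR_bound p; exists (C + 1); first by lra.
move=> s s1; rewrite /flat; case: ifPn => s0; last by rewrite normr0; lra.
have := hC s^-1; rewrite invr_ge0 ltW// => /(_ isT) h.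
rewrite normrM (ger0_norm (expR_ge0 _)).
have : 1 <= s^-1 ^+ 2 by rewrite exprn_ege1// invf_ge1.
move=> h2; apply: (@le_trans _ _ C); last by lra.
apply: le_trans h; rewrite ler_wpM2r ?expR_ge0// ler_peMr//.
Qed.

Lemma flat1_homo (s t : R) : s <= t -> flat 1 s <= flat 1 t.
Proof.
move=> st; rewrite {1}/flat; case: ifPn => s0; last exact: flat1_ge0.
have t0 : 0 < t by exact: lt_le_trans st.
by rewrite /flat t0 !hornerC !mul1r ler_expR lerN2 lef_pV2.
Qed.

Lemma flat1_half_gt0 : 0 < flat 1 (2^-1 : R).
Proof. by rewrite /flat invr_gt0 ltr0n hornerC mul1r expR_gt0. Qed.

End flat_bounds.

Section ell_bump.
Context (R : realType) (n : nat).
Local Notation mu := (@lebesgue_rV R n).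
Variables (x0 nu : 'rV[R]_n) (L rho : R).
Hypotheses (nu1 : sqn nu = 1) (rho0 : 0 < rho) (rhoL : rho <= L).

Local Notation q := (ell_form x0 nu L rho).
Local Notation E := (ellipsoid x0 nu L rho).
Let L0 : 0 < L. Proof. exact: lt_le_trans rhoL. Qed.
(** By [is_derive_flat], [flat p1] and [flat p2] are the first two derivatives of [flat 1]. *)
Let p1 : {poly R} := 'X^2 * (1 - 1^`()).
Let p2 : {poly R} := 'X^2 * (p1 - p1^`()).

Definition ell_bump (y : 'rV[R]_n) : R := flat 1 (1 + - q y).

Lemma smooth_bump : smooth ell_bump.
Proof.
apply: (@smooth_comp _ _ (flat 1)); first exact: smooth1_flat.
by apply: smoothD; [exact: smooth_cst|apply: smoothN; exact: smooth_ell_form].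
Qed.

Lemma bump_out p y : ~ E 1 y -> flat p (1 + - q y) = 0.
Proof.
move=> h; rewrite /flat ifF//; apply/negbTE; rewrite -leNgt subr_le0 leNgt.
exact/negP.
Qed.

Lemma bump_le1 y : 0 <= ell_bump y <= 1.
Proof. by rewrite flat1_ge0 flat1_le1. Qed.

Lemma bump_ge y : E 2^-1 y -> flat 1 2^-1 <= ell_bump y.
Proof. by rewrite /ellipsoid /= => h; apply: flat1_homo; lra. Qed.

Lemma bsupp_bump : bsupp ell_bump.
Proof.
move: (rho0) (rhoL) (L0) => rho0' rhoL' L0'.
have [k _ /in_cube xk] : (\bigcup_k cube (0 : 'rV[R]_n) k%:R) x0 by rewrite cube_cover.
exists (k + (Num.trunc (2 * L)).+1)%N => y ay.
have yE : E 1 y by apply: contrapT => yE; move: ay; rewrite /ell_bump bump_out ?eqxx.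
have [h1 h2] := ellipsoid_axis nu1 rho0 rhoL ltr01 yE.
have h3 : sqn (y - x0) < (2 * L) ^+ 2.
  rewrite -sqdistE; have : rho ^+ 2 <= L ^+ 2.
    by rewrite ler_sqr ?nnegrE//; exact: ltW.
  rewrite exprMn; have := exprn_gt0 2 L0'; lra.
apply/in_cube => i; have := le_lt_trans (coord_le_sqn (y - x0) i) h3.
rewrite !mxE => /sqr_lt_itv; have -> : 0 < 2 * L by lra.
move=> /(_ isT)/andP[h4 h5]; have /andP[h6 h7] := xk i.
rewrite mxE in h6 h7; have := truncnS_gt (2 * L); rewrite natrD.
by move=> h8; apply/andP; split; lra.
Qed.

Lemma partial_bump i :
  partial i ell_bump = fun y => flat p1 (1 + - q y) * - partial i q y.
Proof.
have sq : smooth q by exact: smooth_ell_form.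
have s1q : smooth (fun y => 1 + - q y).
  by apply: smoothD; [exact: smooth_cst|exact: smoothN].
rewrite /ell_bump (partial_comp i (is_derive_flat 1) s1q); apply/funext => y.
congr (_ * _); rewrite (partialD i (smooth_cst _ 1) (smoothN sq)) partial_cst add0r.
have -> : (fun x => - q x) = (fun x => (-1) * q x) by apply/funext => z; rewrite mulN1r.
by rewrite (partialM i (smooth_cst _ (-1)) sq) partial_cst mulr0 addr0 mulN1r.
Qed.

Lemma partial_sqdist i y : partial i (sqdist x0) y = 2 * (y ord0 i - x0 ord0 i).
Proof.
have -> : partial i (sqdist x0) = fun y => \sum_j partial i (fun y : 'rV[R]_n =>
    (y ord0 j + - x0 ord0 j) * (y ord0 j + - x0 ord0 j)) y.
  rewrite /sqdist; elim: (index_enum _) => [|j r IH].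
    rewrite (_ : (fun _ => _) = fun=> 0); last by apply/funext => z; rewrite big_nil.
    by rewrite partial_cst; apply/funext => z; rewrite big_nil.
  rewrite (_ : (fun _ => _) = fun y : 'rV[R]_n => (y ord0 j + - x0 ord0 j) * (y ord0 j + - x0 ord0 j) +
     \sum_(j <- r) (y ord0 j + - x0 ord0 j) * (y ord0 j + - x0 ord0 j)); last first.
    by apply/funext => z; rewrite big_cons.
  have sc k : smooth (fun y : 'rV[R]_n => y ord0 k + - x0 ord0 k).
    by apply: smoothD; [exact: smooth_coord|exact: smooth_cst].
  rewrite partialD ?IH; [|exact: smoothM|by apply: smooth_sum => k; exact: smoothM].
  by apply/funext => z; rewrite big_cons.
have P j : partial i (fun y : 'rV[R]_n => y ord0 j + - x0 ord0 j) = fun=> (i == j)%:R.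
  rewrite (partialD i (smooth_coord _ j) (smooth_cst _ _)) partial_coord partial_cst.
  by apply/funext => z; rewrite addr0.
have sc k : smooth (fun y : 'rV[R]_n => y ord0 k + - x0 ord0 k).
  by apply: smoothD; [exact: smooth_coord|exact: smooth_cst].
rewrite (bigD1 i)//= big1 => [|j ji].
  by rewrite (partialM i (sc i) (sc i)) P eqxx mulr1n; ring.
by rewrite (partialM i (sc j) (sc j)) P eq_sym (negbTE ji) mulr0n; ring.
Qed.

Lemma partial_ell_form i y : partial i q y =
  2 * rho ^- 2 * (y ord0 i - x0 ord0 i) +
  2 * (L ^- 2 - rho ^- 2) * axis_coord x0 nu y * nu ord0 i.
Proof.
have sT : smooth (axis_coord x0 nu) by exact: smooth_axis_coord.
have sS : smooth (sqdist x0) by exact: smooth_sqdist.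
rewrite /ell_form (partialD i (smoothM (smooth_cst _ _) sS) (smoothM (smooth_cst _ _) (smoothM sT sT))).
rewrite (partialM i (smooth_cst _ _) sS) (partialM i (smooth_cst _ _) (smoothM sT sT)).
rewrite !partial_cst (partialM i sT sT) partial_sqdist.
have -> : partial i (axis_coord x0 nu) = fun=> nu ord0 i.
  rewrite /axis_coord (partialD i (smooth_dotr nu) (smooth_cst _ _)) partial_cst partial_dotr.
  by apply/funext => z; rewrite addr0.
ring.
Qed.

(** The terms in rho cancel because nu is a unit vector along a principal axis. As |axis_coord| < L
    on the ellipsoid, the derivative along [nu] is O(1/L) however thin the ellipsoid is. *)
Lemma dgrad_bump y : dgrad nu ell_bump y =
  - flat p1 (1 + - q y) * (2 * axis_coord x0 nu y / L ^+ 2).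
Proof.
rewrite /dgrad (_ : 2 * _ / _ = \sum_i nu ord0 i * partial i q y).
  by rewrite mulr_sumr; apply: eq_bigr => i _; rewrite partial_bump; ring.
under eq_bigr do rewrite partial_ell_form mulrDr.
rewrite big_split /=.
have -> : \sum_i nu ord0 i * (2 * rho ^- 2 * (y ord0 i - x0 ord0 i)) =
    2 * rho ^- 2 * axis_coord x0 nu y.
  by rewrite axis_coordE mulr_sumr; apply: eq_bigr => i _; ring.
have -> : \sum_i nu ord0 i * (2 * (L ^- 2 - rho ^- 2) * axis_coord x0 nu y * nu ord0 i) =
   2 * (L ^- 2 - rho ^- 2) * axis_coord x0 nu y * sqn nu.
  by rewrite /sqn mulr_sumr; apply: eq_bigr => i _; ring.
by rewrite nu1; field; rewrite !gt_eqF.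
Qed.

Lemma ellipsoid_in_ge0 y : 1 + - q y <= 1.
Proof. by have := ell_form_ge0 x0 nu1 rho0 rhoL y; lra. Qed.

Lemma dgrad_bump_le C y : (forall s, s <= 1 -> `|flat p1 s| <= C) ->
  dgrad nu ell_bump y ^+ 2 <= 4 * C ^+ 2 / L ^+ 2 * \1_(E 1) y.
Proof.
move=> hC; rewrite dgrad_bump indicE; case: (boolP (y \in E 1)) => [/set_mem yE|yE]; last first.
  rewrite bump_out ?oppr0 ?mul0r ?mulr0 ?expr0n//.
  by move=> h; move/negP: yE; apply; exact/mem_set.
have [h1 _] := ellipsoid_axis nu1 rho0 rhoL ltr01 yE; rewrite mul1r in h1.
have h2 : flat p1 (1 + - q y) ^+ 2 <= C ^+ 2.
  have := hC _ (ellipsoid_in_ge0 y) => h; rewrite -real_normK ?num_real//.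
  by rewrite ler_sqr ?nnegrE// (le_trans _ h).
rewrite mulr1; set f := flat p1 _ in h2 *; set T := axis_coord _ _ _ in h1 *.
have -> : (- f * (2 * T / L ^+ 2)) ^+ 2 = f ^+ 2 * (T ^+ 2 * (4 / L ^+ 4)).
  by field; rewrite gt_eqF.
have -> : 4 * C ^+ 2 / L ^+ 2 = C ^+ 2 * (L ^+ 2 * (4 / L ^+ 4)).
  by field; rewrite gt_eqF.
have k0 : 0 <= 4 / L ^+ 4 by rewrite divr_ge0// exprn_ge0// ltW.
apply: ler_pM => //; first exact: sqr_ge0.
  by rewrite mulr_ge0// sqr_ge0.
by rewrite ler_wpM2r// ltW.
Qed.

(** For L = rho the form is q = |y - x0|^2 / rho^2. In the chain rule the second derivative of
    [flat 1] meets |grad q|^2 <= 4 / rho^2 and the first meets the Laplacian 2 n / rho^2 of q,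
    whence 4 + 2 n. *)
Lemma laplacian_bump_le C y : L = rho ->
  (forall s, s <= 1 -> `|flat p1 s| <= C) -> (forall s, s <= 1 -> `|flat p2 s| <= C) ->
  laplacian ell_bump y ^+ 2 <= ((4 + 2 * n%:R) * C / rho ^+ 2) ^+ 2 * \1_(E 1) y.
Proof.
move=> Lr h1 h2.
have sq : smooth q by exact: smooth_ell_form.
have s1q : smooth (fun y => 1 + - q y).
  by apply: smoothD; [exact: smooth_cst|exact: smoothN].
have qE i : partial i q = fun y => 2 * rho ^- 2 * (y ord0 i + - x0 ord0 i).
  by apply/funext => z; rewrite partial_ell_form Lr subrr; ring.
have pq i : partial i (fun y => - partial i q y) y = - (2 * rho ^- 2).
  rewrite qE (_ : (fun _ => _) = fun y : 'rV[R]_n => - (2 * rho ^- 2) * (y ord0 i + - x0 ord0 i)); last first.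
    by apply/funext => z; rewrite mulNr.
  rewrite (partialM i (smooth_cst _ _) (smoothD (smooth_coord _ i) (smooth_cst _ _))).
  rewrite (partialD i (smooth_coord _ i) (smooth_cst _ _)) !partial_cst partial_coord eqxx.
  rewrite mulr1n; ring.
have LE : laplacian ell_bump y = flat p2 (1 + - q y) * (4 * rho ^- 4 * sqdist x0 y) -
    flat p1 (1 + - q y) * (n%:R * (2 * rho ^- 2)).
  have -> : n%:R * (2 * rho ^- 2) = \sum_(i < n) 2 * rho ^- 2.
    by rewrite sumr_const card_ord mulr_natl.
  rewrite /sqdist !mulr_sumr -sumrB; apply: eq_bigr => i _.
  have sp : smooth (fun y => flat p1 (1 + - q y)).
    by apply: (@smooth_comp _ _ (flat p1)) => //; exact: smooth1_flat.
  rewrite partial_bump (partialM i sp (smoothN (smooth_partial i sq))) pq.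
  rewrite (partial_comp i (is_derive_flat p1) s1q).
  rewrite (partialD i (smooth_cst _ 1) (smoothN sq)) partial_cst.
  have -> : (fun x => - q x) = (fun x => (-1) * q x) by apply/funext => z; rewrite mulN1r.
  rewrite (partialM i (smooth_cst _ (-1)) sq) partial_cst qE -/p2.
  by field; rewrite gt_eqF.
rewrite LE indicE; case: (boolP (y \in E 1)) => [/set_mem yE|yE]; last first.
  rewrite !bump_out ?mul0r ?subr0 ?expr0n ?mulr0//.
  - by move=> h; move/negP: yE; apply; exact/mem_set.
  - by move=> h; move/negP: yE; apply; exact/mem_set.
have d2 : sqdist x0 y < rho ^+ 2.
  move: yE; rewrite /ellipsoid /= /ell_form Lr subrr mul0r addr0 mulrC.
  by rewrite ltr_pdivrMr ?exprn_gt0// mul1r.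
have d0 : 0 <= sqdist x0 y by rewrite sqdistE sqn_ge0.
have g1 := h1 _ (ellipsoid_in_ge0 y); have g2 := h2 _ (ellipsoid_in_ge0 y).
have r4 : 4 * rho ^- 4 * sqdist x0 y <= 4 * rho ^- 2.
  have -> : 4 * rho ^- 2 = 4 * rho ^- 4 * rho ^+ 2 by field; rewrite gt_eqF.
  rewrite ler_wpM2l ?ltW// mulr_gt0// invr_gt0 exprn_gt0//.
have r40 : 0 <= 4 * rho ^- 4 * sqdist x0 y.
  by rewrite !mulr_ge0// invr_ge0 exprn_ge0// ltW.
have r20 : 0 <= n%:R * (2 * rho ^- 2).
  by rewrite !mulr_ge0// invr_ge0 exprn_ge0// ltW.
have C0 : 0 <= C by exact: le_trans g1.
rewrite mulr1 -real_normK ?num_real// ler_sqr ?nnegrE//; last first.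
  by rewrite divr_ge0 ?mulr_ge0 ?addr_ge0 ?mulr_ge0 ?exprn_ge0// ltW.
apply: le_trans (ler_normB _ _) _; rewrite normrM [X in _ + X <= _]normrM.
rewrite (ger0_norm r40) (ger0_norm r20).
have -> : (4 + 2 * n%:R) * C / rho ^+ 2 = C * (4 * rho ^- 2) + C * (n%:R * (2 * rho ^- 2)).
  by field; rewrite gt_eqF.
by rewrite lerD// ler_pM.
Qed.

End ell_bump.

Section bump_integrals.
Context (R : realType) (n : nat).
Local Notation mu := (@lebesgue_rV R n).

Lemma integrable_indic_fin (A : set 'rV[R]_n) : measurable A -> mu A \is a fin_num ->
  mu.-integrable setT (EFin \o \1_A).
Proof.
move=> mA fA; apply/integrableP; split.
  by apply/measurable_EFinP; exact: measurable_indic.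
rewrite (_ : (fun y => _) = EFin \o \1_A); last first.
  by apply/funext => y /=; rewrite ger0_norm// indicE.
by rewrite integral_indic ?setIT// -ge0_fin_numE.
Qed.

Lemma Rintegral_indic (A : set 'rV[R]_n) : measurable A ->
  \int[mu]_x \1_A x = fine (mu A).
Proof. by move=> mA; rewrite /Rintegral integral_indic ?setIT. Qed.

Lemma Rintegral_le_indic (f : 'rV[R]_n -> R) (A : set 'rV[R]_n) (c : R) :
  measurable A -> mu A \is a fin_num -> mu.-integrable setT (EFin \o f) ->
  (forall x, f x <= c * \1_A x) -> \int[mu]_x f x <= c * fine (mu A).
Proof.
move=> mA fA fi fc; rewrite -Rintegral_indic// -RintegralZl//; last exact: integrable_indic_fin.
apply: le_Rintegral => //.
exact: (integrableZl measurableT c (integrable_indic_fin mA fA)).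
Qed.

Lemma Rintegral_ge_indic (f : 'rV[R]_n -> R) (A : set 'rV[R]_n) (c : R) :
  measurable A -> mu A \is a fin_num -> mu.-integrable setT (EFin \o f) ->
  (forall x, c * \1_A x <= f x) -> c * fine (mu A) <= \int[mu]_x f x.
Proof.
move=> mA fA fi fc; rewrite -Rintegral_indic// -RintegralZl//; last exact: integrable_indic_fin.
apply: le_Rintegral => //.
exact: (integrableZl measurableT c (integrable_indic_fin mA fA)).
Qed.

Lemma Cc_sqr_integrable (f : 'rV[R]_n -> R) : Cc f ->
  mu.-integrable setT (EFin \o (fun x => f x ^+ 2)).
Proof.
move=> Cf; apply: Cc_integrable; rewrite (_ : (fun _ => _) = fun x => f x * f x).
  by apply: CcMl => //; case: Cf.
by apply/funext => x; rewrite expr2.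
Qed.

Lemma smooth_Cc (f : 'rV[R]_n -> R) : smooth f -> bsupp f -> Cc f.
Proof. by move=> sf bf; split => //; exact: smooth_continuous. Qed.

Hypothesis n_gt0 : (0 < n)%N.

Section one_ellipsoid.
Variables (x0 nu : 'rV[R]_n) (L rho : R).
Hypotheses (nu1 : sqn nu = 1) (rho0 : 0 < rho) (rhoL : rho <= L).
Local Notation E := (ellipsoid x0 nu L rho).

Lemma mu_ellipsoid_fin c : c <= 1 -> mu (E c) \is a fin_num.
Proof.
move=> c1; have h := mu_ellipsoid_le x0 nu1 rho0 rhoL.
have m1 : measurable (E 1) by exact: measurable_ellipsoid.
have mc : measurable (E c) by exact: measurable_ellipsoid.
have h1 : (mu (E 1) < +oo)%E.
  rewrite ltey; apply/eqP => e; move: h; rewrite e gt0_muley ?lte_fin ?mulr_gt0//.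
rewrite ge0_fin_numE//; apply: le_lt_trans h1; apply: le_measure; rewrite ?inE//.
by move=> y; rewrite /ellipsoid /= => h1; exact: lt_le_trans c1.
Qed.

(** The quotient of the two volume bounds does not depend on L and rho. It compares integrals of
    derivatives of the bump, carried by the whole ellipsoid, with that of its square, bounded below
    on the half ellipsoid. *)
Lemma ellipsoid_doubling : fine (mu (E 1)) <= 2 * (16 * n%:R) ^+ n * fine (mu (E 2^-1)).
Proof.
have N0 : 0 < n%:R :> R by rewrite ltr0n.
have f1 := mu_ellipsoid_fin (lexx 1).
have f2 : mu (E 2^-1) \is a fin_num by apply: mu_ellipsoid_fin; lra.
have h1 := mu_ellipsoid_le x0 nu1 rho0 rhoL.
have h2 := mu_ellipsoid_ge x0 nu1 rho0 rhoL n_gt0.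
rewrite -(fineK f1) -!EFinM lee_fin in h1.
rewrite -(fineK f2) -!EFinM lee_fin in h2.
set M1 := fine (mu (E 1)) in h1 *; set Mh := fine _ in h2 *.
have L0 : 0 < L by exact: lt_le_trans rhoL.
have E4 : (4 * rho) ^+ n = (16 * n%:R) ^+ n * (rho / (4 * n%:R)) ^+ n.
  by rewrite -exprMn; congr (_ ^+ _); field; rewrite gt_eqF.
rewrite -(ler_pM2l (_ : 0 < 2 * rho)) ?mulr_gt0//.
apply: le_trans h1 _; rewrite E4.
have K0 : 0 <= (16 * n%:R : R) ^+ n by rewrite exprn_ge0// mulr_ge0// ltW.
move: h2 K0; move: ((16 * n%:R : R) ^+ n) ((rho / (4 * n%:R)) ^+ n) => K z h2 K0.
have := ler_wpM2l K0 h2; lra.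
Qed.

(** The factor rho on the right stands for the exponent n - 1 on the left. *)
Lemma ellipsoid_volume_ge :
  L * (4 * n%:R) ^- n * rho ^+ n <= rho * fine (mu (E 2^-1)).
Proof.
have f2 : mu (E 2^-1) \is a fin_num by apply: mu_ellipsoid_fin; lra.
have h2 := mu_ellipsoid_ge x0 nu1 rho0 rhoL n_gt0.
rewrite -(fineK f2) -!EFinM lee_fin expr_div_n in h2.
have -> : L * (4 * n%:R) ^- n * rho ^+ n = 2 * (L / 2 * (rho ^+ n / (4 * n%:R) ^+ n)).
  have Z0 : (4 * n%:R : R) ^+ n != 0.
    by rewrite expf_neq0// mulf_neq0// ?pnatr_eq0// -lt0n.
  by move: ((4 * n%:R : R) ^+ n) (rho ^+ n) Z0 => Z w Z0; field.
by move: h2; set t := L / 2 * _; set M := fine _ => h; lra.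
Qed.

End one_ellipsoid.

Lemma bump_integrals : exists C c : R, [/\ 0 < C, 0 < c &
  forall (x0 nu : 'rV[R]_n) (L rho : R), sqn nu = 1 -> 0 < rho -> rho <= L ->
  let a := ell_bump x0 nu L rho in
  [/\ \int[mu]_x (dgrad nu a x ^+ 2) <= C / L ^+ 2 * \int[mu]_x (a x ^+ 2),
      c * L * rho ^+ n <= rho * \int[mu]_x (a x ^+ 2) &
      L = rho -> \int[mu]_x (laplacian a x ^+ 2) <= C / rho ^+ 4 * \int[mu]_x (a x ^+ 2)]].
Proof.
pose e : R := flat 1 2^-1; have e0 : 0 < e by exact: flat1_half_gt0.
pose p1 : {poly R} := 'X^2 * (1 - 1^`()).
pose p2 : {poly R} := 'X^2 * (p1 - p1^`()).
have [C1 C10 hC1] := flat_bounded p1; have [C2 C20 hC2] := flat_bounded p2.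
pose C0 := C1 + C2.
have hC0 s : s <= 1 -> `|flat p1 s| <= C0 by move=> /hC1; rewrite /C0; lra.
have hC0' s : s <= 1 -> `|flat p2 s| <= C0 by move=> /hC2; rewrite /C0; lra.
have C00 : 0 < C0 by rewrite addr_gt0.
have N0 : 0 < n%:R :> R by rewrite ltr0n.
pose D : R := 2 * (16 * n%:R) ^+ n.
have D0 : 0 < D by rewrite mulr_gt0// exprn_gt0// mulr_gt0.
(* The summands come from [dgrad_bump_le] and [laplacian_bump_le]. The factor D / e^2 is the loss in
   passing from the volume of the ellipsoid to the integral of a^2, as the bump is at least [e] on
   the half ellipsoid. *)
pose K := (4 * C0 ^+ 2 + ((4 + 2 * n%:R) * C0) ^+ 2) * D / e ^+ 2.
exists K, (e ^+ 2 * (4 * n%:R) ^- n); split.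
- by rewrite divr_gt0 ?exprn_gt0// mulr_gt0// ltr_wpDr ?sqr_ge0// mulr_gt0// exprn_gt0.
- by rewrite mulr_gt0 ?exprn_gt0// invr_gt0 exprn_gt0// mulr_gt0.
move=> x0 nu L rho nu1 rho0 rhoL a.
have L0 : 0 < L by exact: lt_le_trans rhoL.
have Ca : Cc a by apply: smooth_Cc; [exact: smooth_bump|exact: bsupp_bump].
have m1 : measurable (ellipsoid x0 nu L rho 1) by exact: measurable_ellipsoid.
have mh : measurable (ellipsoid x0 nu L rho 2^-1) by exact: measurable_ellipsoid.
have f1 : mu (ellipsoid x0 nu L rho 1) \is a fin_num by exact: mu_ellipsoid_fin.
have fh : mu (ellipsoid x0 nu L rho 2^-1) \is a fin_num.
  by apply: mu_ellipsoid_fin => //; lra.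
have lb : e ^+ 2 * fine (mu (ellipsoid x0 nu L rho 2^-1)) <= \int[mu]_x (a x ^+ 2).
  apply: Rintegral_ge_indic => //; first exact: Cc_sqr_integrable.
  move=> y; rewrite indicE; case: (boolP (y \in _)) => [/set_mem yE|_]; last first.
    by rewrite mulr0 sqr_ge0.
  have := bump_ge yE; rewrite mulr1 -/e => h.
  by rewrite ler_sqr ?nnegrE ?(ltW e0)//; apply: le_trans h; exact: ltW.
have db := ellipsoid_doubling x0 nu1 rho0 rhoL.
have ub (k : R) : 0 <= k ->
    k * fine (mu (ellipsoid x0 nu L rho 1)) <= k * D / e ^+ 2 * \int[mu]_x (a x ^+ 2).
  move=> k0; have db' : fine (mu (ellipsoid x0 nu L rho 1)) <=
      D * fine (mu (ellipsoid x0 nu L rho 2^-1)) by exact: db.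
  apply: le_trans (ler_wpM2l k0 db') _.
  have h : fine (mu (ellipsoid x0 nu L rho 2^-1)) <= \int[mu]_x (a x ^+ 2) / e ^+ 2.
    by rewrite ler_pdivlMr ?exprn_gt0// mulrC.
  have kD : 0 <= k * D by apply: mulr_ge0 => //; exact: ltW.
  rewrite mulrA -[leRHS]mulrA [_^-1 * _]mulrC.
  exact: (ler_wpM2l kD h).
split.
- apply: (@le_trans _ _ (4 * C0 ^+ 2 / L ^+ 2 * fine (mu (ellipsoid x0 nu L rho 1)))).
    apply: Rintegral_le_indic => //.
      apply: Cc_sqr_integrable; apply: smooth_Cc.
        exact/smooth_dgrad/smooth_bump.
      exact/bsupp_dgrad/bsupp_bump.
    by move=> y; exact: dgrad_bump_le.
  apply: le_trans (ub _ _) _; first by rewrite divr_ge0 ?mulr_ge0 ?sqr_ge0 ?ler0n ?exprn_ge0 ?ltW.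
  rewrite ler_wpM2r//; first by apply: Rintegral_ge0 => x _; exact: sqr_ge0.
  rewrite /K [leLHS](_ : _ = 4 * C0 ^+ 2 * (D / e ^+ 2 / L ^+ 2)); last first.
    by field; rewrite !gt_eqF.
  rewrite [leRHS](_ : _ = (4 * C0 ^+ 2 + ((4 + 2 * n%:R) * C0) ^+ 2) * (D / e ^+ 2 / L ^+ 2)); last first.
    by field; rewrite !gt_eqF.
  apply: ler_wpM2r; last by rewrite lerDl sqr_ge0.
  by rewrite !divr_ge0 ?sqr_ge0// ltW.
- have := ellipsoid_volume_ge x0 nu1 rho0 rhoL => h.
  have := ler_wpM2l (sqr_ge0 e) h; have := ler_wpM2l (ltW rho0) lb.
  set I := \int[mu]_x _; set M := fine _; set z := (4 * _) ^- n; set w := rho ^+ n.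
  lra.
- move=> Lr.
  apply: (@le_trans _ _ (((4 + 2 * n%:R) * C0 / rho ^+ 2) ^+ 2 * fine (mu (ellipsoid x0 nu L rho 1)))).
    apply: Rintegral_le_indic => //.
      apply: Cc_sqr_integrable; apply: smooth_Cc.
        exact/smooth_laplacian/smooth_bump.
      exact/bsupp_laplacian/bsupp_bump.
    by move=> y; exact: laplacian_bump_le.
  apply: le_trans (ub _ _) _; first exact: sqr_ge0.
  rewrite ler_wpM2r//; first by apply: Rintegral_ge0 => x _; exact: sqr_ge0.
  rewrite /K [leLHS](_ : _ = ((4 + 2 * n%:R) * C0) ^+ 2 * (D / e ^+ 2 / rho ^+ 4)); last first.
    by field; rewrite !gt_eqF.
  rewrite [leRHS](_ : _ = (4 * C0 ^+ 2 + ((4 + 2 * n%:R) * C0) ^+ 2) * (D / e ^+ 2 / rho ^+ 4)); last first.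
    by field; rewrite !gt_eqF.
  apply: ler_wpM2r; last by rewrite lerDr mulr_ge0// sqr_ge0.
  by rewrite !divr_ge0 ?sqr_ge0 ?exprn_ge0// ltW.
Qed.

End bump_integrals.

(** * The geometric control condition *)

Section averages.
Context (R : realType) (n : nat).
Local Notation mu := (@lebesgue_rV R n).
Local Notation lam := (@lebesgue_measure R).
Implicit Types b : 'rV[R]_n -> R.

(** The L^oo norm unfolds to an essential supremum only on a space of positive measure. *)
Lemma mu_setT_gt0 : (0 < mu setT)%E.
Proof.
apply: (@lt_le_trans _ _ (mu (cube 0 1))); last by apply: le_measure; rewrite ?inE//; exact: measurable_cube.
by rewrite mu_cube// lte_fin exprn_gt0.
Qed.

(** Truncating [b] at 0 and at an essential bound changes it on a null set only and makes the bounds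
    hold everywhere. *)
Lemma bounded_version b : b \in Lfun mu +oo%E -> {ae mu, forall x, 0 <= b x} ->
  exists b' B, [/\ 0 < B, measurable_fun setT b', (forall x, 0 <= b' x <= B) &
    {ae mu, forall x, b x = b' x}].
Proof.
move=> Lb b0; have mb := Lfun_measurable Lb.
have [B B0 bB] : exists2 B : R, 0 < B & {ae mu, forall x, `|b x| <= B}.
  have := sub_Lfun_finLfun Lb; rewrite inE /finite_norm unlock mu_setT_gt0 /=.
  have := ess_sup_ge mu (abse \o (EFin \o b)).
  case: (ess_sup _ _) => [M h _|h|h _]; last 2 first.
    by [].
    by exists 1 => //; apply: filterS h => x; rewrite leeNy_eq.
  exists (`|M| + 1); first by rewrite ltr_wpDl.
  apply: filterS h => x; rewrite /= lee_fin => h.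
  by rewrite (le_trans h)// (le_trans (ler_norm M))// lerDl.
exists (fun x => Num.min (Num.max (b x) 0) B), B; split => //.
- by apply: measurable_minr => //; exact: measurable_maxr.
- by move=> x; rewrite le_min ge_min lexx orbT le_max lexx orbT (ltW B0).
- apply: filterS2 b0 bB => x b0 bB; rewrite max_l// min_l//.
  by rewrite (le_trans (ler_norm _)).
Qed.

Lemma kappa_E (r : R) (x : 'rV[R]_n) : 0 < r ->
  (fun y => kappa_ r (x - y)) =
  (fun y => (r ^- n * (fine (mu (eucl_ball (0 : 'rV[R]_n) 1)))^-1) * \1_(eucl_ball x r) y).
Proof.
move=> r0; apply/funext => y; rewrite /kappa_ /kappa mulrA; congr (_ * _).
rewrite !indicE; congr (nat_of_bool _)%:R.
have E : eucl_ball (0 : 'rV[R]_n) 1 (r^-1 *: (x - y)) <-> eucl_ball x r y.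
  rewrite (in_eucl_ball _ _ ltr01) (in_eucl_ball _ _ r0) expr1n.
  have -> : sqn (r^-1 *: (x - y) - 0) = sqn (y - x) / r ^+ 2.
    rewrite /sqn mulr_suml; apply: eq_bigr => i _; rewrite !mxE.
    by field; rewrite gt_eqF.
  by rewrite ltr_pdivrMr ?exprn_gt0// mul1r.
by apply/idP/idP => /set_mem h; apply/mem_set; apply/E.
Qed.

Lemma convolution_kappa b (b' : 'rV[R]_n -> R) (B r : R) x : 0 < r ->
  measurable_fun setT b -> measurable_fun setT b' -> {ae mu, forall x, b x = b' x} ->
  (forall x, 0 <= b' x <= B) ->
  convolution b (kappa_ r) x =
  r ^- n * (fine (mu (eucl_ball (0 : 'rV[R]_n) 1)))^-1 * \int[mu]_(y in eucl_ball x r) b' y.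
Proof.
move=> r0 mb mb' bb' b'B; rewrite /convolution.
set h := r ^- n * _.
have kE y : kappa_ r (x - y) = h * \1_(eucl_ball x r) y.
  exact: (congr1 (@^~ y) (kappa_E x r0)).
have mB := @measurable_eucl_ball R n x r r0.
have m1 : measurable_fun setT (\1_(eucl_ball x r) : 'rV[R]_n -> R).
  exact: measurable_indic.
transitivity (\int[mu]_y (h * (b' y * \1_(eucl_ball x r) y))).
  under eq_Rintegral do rewrite kE.
  apply: ae_eq_Rintegral.
  - by apply: measurable_funM => //; apply: measurable_funM.
  - by apply: measurable_funM => //; apply: measurable_funM.
  - by apply: filterS bb' => y ->; rewrite -/h; ring.
rewrite RintegralZl//.
  rewrite [in RHS]Rintegral_mkcond; congr (_ * _); apply: eq_Rintegral => y _.
  by rewrite patchE indicE; case: ifP; rewrite ?mulr1 ?mulr0.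
apply: (@bsupp_integrable _ _ _ B).
- exact: measurable_funM.
- move=> y; have /andP[h1 h2] := b'B y; rewrite normrM ger0_norm// indicE.
  by case: (_ \in _); rewrite /= ?normr1 ?mulr1// normr0 mulr0 (le_trans h1).
- apply: bsuppMr.
  have [k hk] : exists k : nat, cube x r `<=` cube (0 : 'rV[R]_n) k%:R.
    have [k _ /in_cube xk] : (\bigcup_k cube (0 : 'rV[R]_n) k%:R) x by rewrite cube_cover.
    exists (k + (Num.trunc r).+1)%N => y /in_cube yr; apply/in_cube => i.
    have := yr i; have := xk i; rewrite !mxE natrD; have := truncnS_gt r.
    by move=> ? /andP[? ?] /andP[? ?]; apply/andP; split; lra.
  exists k => y; rewrite indicE pnatr_eq0 eqb0 negbK => /set_mem yB.
  exact/hk/eucl_ball_cube.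
Qed.

Lemma mean_value_ae b (b' : 'rV[R]_n -> R) A : measurable A ->
  measurable_fun setT b -> measurable_fun setT b' -> {ae mu, forall x, b x = b' x} ->
  mean_value b A = (fine (mu A))^-1 * \int[mu]_(y in A) b' y.
Proof.
move=> mA mb mb' bb'; rewrite /mean_value; congr (_ * _).
rewrite /Rintegral; congr fine; apply: ae_eq_integral => //.
- by apply/measurable_EFinP; exact: measurable_funTS.
- by apply/measurable_EFinP; exact: measurable_funTS.
- by apply: filterS bb' => y /= ->.
Qed.

Section line_average.
Variables (b' : 'rV[R]_n -> R) (B T r : R) (x0 nu : 'rV[R]_n).
Hypotheses (mb' : measurable_fun setT b') (b'B : forall x, 0 <= b' x <= B).
Hypotheses (r0 : 0 < r) (T0 : 0 < T).

Let b'0 x : 0 <= b' x. Proof. by have /andP[] := b'B x. Qed.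

Let ball_fin x : (\int[mu]_(y in eucl_ball x r) (b' y)%:E \is a fin_num)%E.
Proof.
rewrite ge0_fin_numE; last by apply: integral_ge0 => y _; rewrite lee_fin.
apply: (@le_lt_trans _ _ (\int[mu]_(y in eucl_ball x r) cst B%:E y)%E).
  apply: ge0_le_integral => //.
  - exact: measurable_eucl_ball.
  - by move=> y _; rewrite lee_fin.
  - by apply/measurable_EFinP; exact: measurable_funTS.
  - by move=> y _; rewrite lee_fin; have /andP[] := b'B y.
rewrite integral_cst; last exact: measurable_eucl_ball.
apply: lte_mul_pinfty => //; last exact: le_lt_trans (mu_eucl_ball_le x r0) (ltry _).
by rewrite lee_fin; have /andP[h1 h2] := b'B 0; exact: le_trans h2.
Qed.

Lemma line_average_fin :
  (\int[lam]_(s in `[(- T)%R, T]) \int[mu]_(y in eucl_ball (x0 + s *: nu) r) (b' y)%:E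
   \is a fin_num)%E.
Proof.
rewrite ge0_fin_numE; last first.
  by apply: integral_ge0 => s _; apply: integral_ge0 => y _; rewrite lee_fin.
apply: (@le_lt_trans _ _ (\int[lam]_(s in `[(- T)%R, T]) cst (B * (2 * r) ^+ n)%:E s)%E).
  apply: ge0_le_integral => //.
  - by move=> s _; apply: integral_ge0 => y _; rewrite lee_fin.
  - exact: measurable_line.
  - move=> s _ /=; apply: (@le_trans _ _ (\int[mu]_(y in eucl_ball (x0 + s *: nu) r) cst B%:E y)%E).
      apply: ge0_le_integral => //.
      + exact: measurable_eucl_ball.
      + by move=> y _; rewrite lee_fin.
      + by apply/measurable_EFinP; exact: measurable_funTS.
      + by move=> y _; rewrite lee_fin; have /andP[] := b'B y.
    rewrite integral_cst; last exact: measurable_eucl_ball.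
    rewrite EFinM lee_wpmul2l//.
      by rewrite lee_fin; have /andP[h1 h2] := b'B 0; exact: le_trans h2.
    exact: mu_eucl_ball_le.
by rewrite integral_cst// [X in (_ * X)%E]lam_seg// -EFinM ltry.
Qed.

Lemma line_averageE (h : R) : 0 <= h ->
  \int[lam]_(t in `[- T, T]) (h * \int[mu]_(y in eucl_ball (x0 + t *: nu) r) b' y) =
  h * fine (\int[mu]_y ((b' y)%:E * lam (slice x0 nu T r y)))%E.
Proof.
move=> h0; rewrite -line_tonelli// /Rintegral.
transitivity (fine (\int[lam]_(t in `[(- T)%R, T]) (h%:E * \int[mu]_(y in eucl_ball (x0 + t *: nu) r) (b' y)%:E))%E).
  congr fine; apply: eq_integral => t _; rewrite EFinM fineK//; exact: ball_fin.
rewrite ge0_integralZl//; first by rewrite fineM//; exact: line_average_fin.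
- exact: measurable_line.
- by move=> s _; apply: integral_ge0 => y _; rewrite lee_fin.
Qed.

(** After Tonelli, each point of [A] is counted for a time at least [m]. *)
Lemma line_average_ge (A : set 'rV[R]_n) (m : R) : 0 <= m -> measurable A ->
  mu.-integrable setT (EFin \o (fun y => b' y * \1_A y)) ->
  (forall y, A y -> (m%:E <= lam (slice x0 nu T r y))%E) ->
  m * \int[mu]_y (b' y * \1_A y) <= fine (\int[mu]_y ((b' y)%:E * lam (slice x0 nu T r y)))%E.
Proof.
move=> m0 mA iA hA; rewrite -RintegralZl// /Rintegral.
have mbA : measurable_fun setT (fun y => m * (b' y * \1_A y)).
  by apply: measurable_funM => //; apply: measurable_funM => //; exact: measurable_indic.
apply: fine_le.
- apply: integrable_fin_num => //; exact: (integrableZl measurableT m iA).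
- by rewrite -line_tonelli//; exact: line_average_fin.
apply: ge0_le_integral => //.
- by move=> y _; rewrite lee_fin !mulr_ge0.
- exact/measurable_EFinP.
- by apply: emeasurable_funM; [exact/measurable_EFinP|exact: measurable_lam_slice].
- move=> y _; rewrite indicE; case: (boolP (y \in A)) => [/set_mem yA|_].
    by rewrite mulr1 mulrC EFinM lee_wpmul2l ?lee_fin// hA.
  by rewrite !mulr0 mule_ge0// lee_fin.
Qed.

End line_average.

End averages.

Section geometric_control.
Context (R : realType) (n : nat) (V b b' : 'rV[R]_n -> R) (B : R).
Local Notation mu := (@lebesgue_rV R n).
Local Notation lam := (@lebesgue_measure R).
Hypothesis n_gt0 : (0 < n)%N.
Hypothesis contV : continuous V.
Hypothesis bb' : {ae mu, forall x, b x = b' x}.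
Hypothesis mb : measurable_fun setT b.
Hypothesis mb' : measurable_fun setT b'.
Hypothesis B0 : 0 < B.
Hypothesis b'B : forall x, 0 <= b' x <= B.

(* Large frequency limit: the potential and the Laplacian of the amplitude
   disappear from the quasimode estimate. *)
Lemma transport_estimate : uniformly_stable V b -> exists2 K : R, 0 < K &
  forall (nu : 'rV[R]_n) (a : 'rV[R]_n -> R), sqn nu = 1 -> smooth a -> bsupp a ->
  \int[mu]_x (a x ^+ 2) <=
  K * (\int[mu]_x (b' x ^+ 2 * a x ^+ 2) + \int[mu]_x (dgrad nu a x ^+ 2)).
Proof.
move=> /(quasimode_estimate contV bb' mb' b'B)[K K0 hK].
exists (4 * K); first by rewrite mulr_gt0.
move=> nu a nu1 sa ba.
set I := \int[mu]_x _; set Ib := \int[mu]_x _; set Id := \int[mu]_x _.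
pose W := \int[mu]_x ((V x * a x - 2^-1 * laplacian a x) ^+ 2).
have W0 : 0 <= W by apply: Rintegral_ge0 => x _; exact: sqr_ge0.
have Ib0 : 0 <= Ib by apply: Rintegral_ge0 => x _; rewrite mulr_ge0 ?sqr_ge0.
have key l : 0 < l -> l ^+ 2 * I <= K * (W + 2 * l ^+ 2 * Ib + 4 * l ^+ 2 * Id).
  move=> l0; pose th := (Num.sqrt 2 * l) *: nu.
  have th2 : \sum_i th ord0 i ^+ 2 = 2 * l ^+ 2.
    under eq_bigr do rewrite mxE exprMn.
    by rewrite -mulr_sumr exprMn sqr_sqrtr// -/(sqn nu) nu1 mulr1.
  have thd x : dgrad th a x ^+ 2 = 2 * l ^+ 2 * dgrad nu a x ^+ 2.
    rewrite (_ : dgrad th a x = Num.sqrt 2 * l * dgrad nu a x).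
      by rewrite !exprMn sqr_sqrtr.
    by rewrite /dgrad mulr_sumr; apply: eq_bigr => i _; rewrite mxE mulrA.
  have := hK l th a sa ba; rewrite th2.
  under [X in _ <= _ * (_ + _ + 2 * X) -> _]eq_Rintegral do rewrite thd.
  rewrite RintegralZl//; last first.
    by apply: Cc_sqr_integrable; apply: smooth_Cc; [exact: smooth_dgrad|exact: bsupp_dgrad].
  under [X in _ <= _ * (X + _ + _) -> _]eq_Rintegral => x _.
    rewrite (_ : V x + 2^-1 * (2 * l ^+ 2) - l ^+ 2 = V x); last by field.
    over.
  rewrite -/W -/I -/Ib -/Id => h; apply: le_trans h _.
  by rewrite ler_pM2l//; lra.
apply/ler_addgt0Pr => e e0.
(* As l >= 1, this gives l^2 e >= l e >= K W: after division by l^2 the term with the potential and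
   the Laplacian is at most e. *)
pose l := K * W / e + 1.
have l1 : 1 <= l.
  rewrite lerDr; apply: divr_ge0; last exact: ltW.
  by apply: mulr_ge0 => //; exact: ltW.
have l0 : 0 < l by exact: lt_le_trans l1.
have h := key l l0.
have KW : K * W <= l ^+ 2 * e.
  have : K * W <= l * e by rewrite /l mulrDl divfK ?gt_eqF// mul1r lerDl ltW.
  move=> h1; apply: le_trans h1 _; rewrite ler_pM2r// expr2 ler_peMr// ltW//.
rewrite -(@ler_pM2l _ (l ^+ 2)) ?exprn_gt0//; apply: le_trans h _.
have KIb : 0 <= K * (l ^+ 2 * Ib) by rewrite mulr_ge0 ?(ltW K0)// mulr_ge0// sqr_ge0.
move: KW KIb; move: (l ^+ 2) => z; lra.
Qed.

Lemma indic_damping_integrable (A : set 'rV[R]_n) : measurable A -> mu A \is a fin_num ->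
  mu.-integrable setT (EFin \o (fun x => b' x * \1_A x)).
Proof.
move=> mA fA; have := integrableZl measurableT B (integrable_indic_fin mA fA).
apply: le_integrable => //.
  by apply/measurable_EFinP; apply: measurable_funM => //; exact: measurable_indic.
move=> x _ /=; have /andP[b1 b2] := b'B x.
by rewrite lee_fin !normrM ler_wpM2r// !ger0_norm// ltW.
Qed.

(** One factor b' is bounded by B and a^2 by 1, which turns the quadratic damping term into the mass
    of b on the ellipsoid. *)
Lemma bump_damping_le (x0 nu : 'rV[R]_n) (L rho : R) : sqn nu = 1 -> 0 < rho -> rho <= L ->
  \int[mu]_x (b' x ^+ 2 * ell_bump x0 nu L rho x ^+ 2) <=
  B * \int[mu]_x (b' x * \1_(ellipsoid x0 nu L rho 1) x).
Proof.
move=> nu1 rho0 rhoL; have mE : measurable (ellipsoid x0 nu L rho 1) by exact: measurable_ellipsoid.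
have iE := indic_damping_integrable mE (mu_ellipsoid_fin x0 nu1 rho0 rhoL (lexx 1)).
rewrite -RintegralZl//; apply: le_Rintegral => //.
- by apply: (@b'_sqr_integrable _ _ _ B) => //; apply: smooth_Cc; [exact: smooth_bump|exact: bsupp_bump].
- exact: (integrableZl measurableT B iE).
move=> x _; rewrite indicE; have /andP[b1 b2] := b'B x.
case: (boolP (x \in _)) => [/set_mem xE|xE].
  rewrite mulr1 expr2 -mulrA; apply: ler_pM => //; first by rewrite mulr_ge0// sqr_ge0.
  by have /andP[a0 a1] := bump_le1 x0 nu L rho x; rewrite ler_piMr// exprn_ile1.
rewrite /ell_bump bump_out ?expr0n ?mulr0//.
by move=> h; move/negP: xE; apply; exact/mem_set.
Qed.

Lemma damping_mass : uniformly_stable V b -> exists Lmin c : R, [/\ 0 < Lmin, 0 < c &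
  forall (x0 nu : 'rV[R]_n) (L rho : R), sqn nu = 1 -> 0 < rho -> rho <= L -> Lmin <= L ->
  c * L * rho ^+ n <= rho * \int[mu]_x (b' x * \1_(ellipsoid x0 nu L rho 1) x)].
Proof.
move=> /transport_estimate[K K0 hK].
have [C [c [C0 c0 hC]]] := bump_integrals R n_gt0.
(* L >= 2 K C + 1 implies L^2 >= L >= 2 K C, so the gradient term is at most half the integral of
   a^2 and is absorbed. *)
exists (2 * K * C + 1), (c / (2 * K * B)); split.
- by rewrite ltr_wpDl// !mulr_ge0// ltW.
- by rewrite divr_gt0// !mulr_gt0.
move=> x0 nu L rho nu1 rho0 rhoL LL.
have L0 : 0 < L by exact: lt_le_trans rhoL.
pose a := ell_bump x0 nu L rho.
have sa : smooth a by exact: smooth_bump.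
have ba : bsupp a by exact: bsupp_bump.
have [h1 h2 _] := hC x0 nu L rho nu1 rho0 rhoL; rewrite -/a in h1 h2.
have h3 := hK nu a nu1 sa ba.
set I := \int[mu]_x (a x ^+ 2) in h1 h2 h3.
set J := \int[mu]_x _.
have h4 : \int[mu]_x (b' x ^+ 2 * a x ^+ 2) <= B * J by exact: bump_damping_le.
have I0 : 0 <= I by apply: Rintegral_ge0 => x _; exact: sqr_ge0.
have h5 : K * (C / L ^+ 2) <= 2^-1.
  rewrite mulrA ler_pdivrMr ?exprn_gt0//.
  have L1 : 1 <= L by apply: le_trans LL; rewrite lerDr !mulr_ge0// ltW.
  have : L <= L ^+ 2 by rewrite expr2 ler_peMr// ltW.
  move: (L ^+ 2) LL => z; lra.
have h6 : I <= 2 * K * B * J.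
  have h7 := ler_wpM2l (ltW K0) h4; have h8 := ler_wpM2l (ltW K0) h1.
  have h9 := ler_wpM2r I0 h5; rewrite -mulrA in h9.
  rewrite mulrDr in h3; lra.
have h10 : c * L * rho ^+ n <= rho * (2 * K * B * J).
  by apply: le_trans h2 _; rewrite ler_pM2l.
have KB : 0 < 2 * K * B by rewrite !mulr_gt0.
have -> : c / (2 * K * B) * L * rho ^+ n = c * L * rho ^+ n / (2 * K * B).
  by move: (2 * K * B) (rho ^+ n) => Z w; ring.
by rewrite ler_pdivrMr//; apply: le_trans h10 _; rewrite mulrCA mulrC.
Qed.

(** The ball covers [y] at all times of [-T, T] within r/2 of the axis coordinate t. Near an end of
    [-T, T] part of them is lost, but the half interval on the side of 0 remains, since r/2 <= T. *)
Let slice_case1 (x0 nu y : 'rV[R]_n) (T r : R) : sqn nu = 1 -> 0 < r -> r <= 2 * T ->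
  ellipsoid x0 nu T (r / 2) 1 y -> ((r / 2)%:E <= lam (slice x0 nu T r y))%E.
Proof.
move=> nu1 r0 rT yE.
have r20 : 0 < r / 2 by rewrite divr_gt0.
have rT2 : r / 2 <= T by lra.
have T0 : 0 < T by lra.
have [] := ellipsoid_axis nu1 r20 rT2 ltr01 yE.
rewrite !mul1r => /(sqr_lt_itv T0)/andP[t1 t2]; rewrite slice_itv//.
set t := axis_coord x0 nu y in t1 t2 * => P.
have H (u v : R) : u <= v -> v - u = r / 2 -> (forall s, u < s < v -> - T <= s <= T /\ - (r / 2) < s - t < r / 2) ->
    ((r / 2)%:E <= lam ([set s | s \in `[(- T)%R, T] /\ (sqdist x0 y - t ^+ 2 + (s - t) ^+ 2 < r ^+ 2)%R] : set (measurableTypeR R)))%E.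
  move=> uv e h; rewrite -e -(lam_itv uv); apply: le_measure; rewrite ?inE.
  - exact: measurable_itv.
  - by have := @measurable_slice R n x0 nu T r y; rewrite slice_itv.
  - have G (s : R) : u < s < v -> s \in `[(- T)%R, T] /\ (sqdist x0 y - t ^+ 2 + (s - t) ^+ 2 < r ^+ 2)%R.
      move=> /h[h1 h2]; split; first by rewrite in_itv.
      have := itv_sqr_lt h2; have := exprn_gt0 2 r20.
      have -> : r ^+ 2 = 4 * (r / 2) ^+ 2 by field.
      lra.
    by move=> s; rewrite /= in_itv; exact: G.
have [t0|t0] := leP 0 t.
  apply: (H (t - r / 2) t); [lra|lra|move=> s /andP[s1 s2]].
  by split; apply/andP; split; lra.
apply: (H t (t + r / 2)); [lra|lra|move=> s /andP[s1 s2]].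
by split; apply/andP; split; lra.
Qed.

(** A ball of radius r > 2 T moves by at most T < r/2 from x0, so it covers the ball of radius r/4
    about x0 at all times. *)
Let slice_case2 (x0 nu y : 'rV[R]_n) (T r : R) : sqn nu = 1 -> 0 < T -> 2 * T < r ->
  ellipsoid x0 nu (r / 4) (r / 4) 1 y -> ((2 * T)%:E <= lam (slice x0 nu T r y))%E.
Proof.
move=> nu1 T0 rT yE.
have r40 : 0 < r / 4 by lra.
have d2 : sqdist x0 y < (r / 4) ^+ 2.
  move: yE; rewrite /ellipsoid /= /ell_form subrr mul0r addr0 mulrC.
  by rewrite ltr_pdivrMr ?exprn_gt0// mul1r.
rewrite slice_itv// -(lam_seg T0); set t := axis_coord x0 nu y.
have t2 : t ^+ 2 <= sqdist x0 y by exact: axis_coord_le.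
apply: le_measure; rewrite ?inE.
- exact: measurable_itv.
- by have := @measurable_slice R n x0 nu T r y; rewrite slice_itv.
have G (s : R) : - T <= s <= T -> s \in `[(- T)%R, T] /\ (sqdist x0 y - t ^+ 2 + (s - t) ^+ 2 < r ^+ 2)%R.
  move=> h; split; first by rewrite in_itv.
  have s2 : s ^+ 2 <= T ^+ 2.
    by rewrite -subr_ge0 subr_sqr; move: h => /andP[? ?]; apply: mulr_ge0; lra.
  have T2 : 4 * T ^+ 2 < r ^+ 2.
    have -> : 4 * T ^+ 2 = (2 * T) ^+ 2 by ring.
    by apply: itv_sqr_lt; apply/andP; split; lra.
  have := sqr_ge0 (s + t).
  have -> : (s + t) ^+ 2 = s ^+ 2 + 2 * s * t + t ^+ 2 by ring.
  have -> : (s - t) ^+ 2 = s ^+ 2 - 2 * s * t + t ^+ 2 by ring.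
  have : (r / 4) ^+ 2 = r ^+ 2 / 16 by field.
  have := sqr_ge0 s; lra.
by move=> s; rewrite /= in_itv; exact: G.
Qed.

(** Volume times duration is of order T r^n in both regimes: for r <= 2 T, an ellipsoid of semi-axes
    T and r/2 seen for a time r/2; for r > 2 T, a ball of radius r/4 seen for the time 2 T. This
    balances the normalisation r^-n / T of the average. *)
Lemma geometric_control : uniformly_stable V b -> uniform_geometric_control b.
Proof.
move=> /damping_mass[Lmin [c [L0 c0 hc]]].
have fB1 := mu_eucl_ball_fin (0 : 'rV[R]_n) ltr01.
pose m1 := fine (mu (eucl_ball (0 : 'rV[R]_n) 1)).
have m10 : 0 < m1.
  rewrite -lte_fin fineK//; apply: lt_le_trans (mu_eucl_ball_ge n_gt0 0 ltr01).
  by rewrite lte_fin exprn_gt0// divr_gt0// ltr0n.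
(* Then both lengths used, T and r/4 when r > 2 T, are at least Lmin. *)
pose T := 2 * Lmin; have T0 : 0 < T by rewrite mulr_gt0.
exists T, (c / (4 * 4 ^+ n * m1)); split => //.
  by rewrite divr_gt0// !mulr_gt0// exprn_gt0.
move=> x0 nu r nu1 r0.
have {}nu1 : sqn nu = 1.
  have : Num.sqrt (sqn nu) = 1 by [].
  by move=> h; rewrite -[LHS](sqr_sqrtr (sqn_ge0 nu)) h expr1n.
under eq_Rintegral do rewrite (convolution_kappa _ r0 mb mb' bb' b'B).
have h0 : 0 <= r ^- n * m1^-1.
  by rewrite mulr_ge0 ?invr_ge0 ?exprn_ge0 ?(ltW m10)// ltW.
rewrite (line_averageE _ _ mb' b'B r0 T0 h0).
set J := fine _.
have lower (L rho m : R) : 0 < rho -> rho <= L -> Lmin <= L -> 0 < m ->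
    (forall y, ellipsoid x0 nu L rho 1 y -> (m%:E <= lam (slice x0 nu T r y))%E) ->
    m * (c * L * rho ^+ n) <= rho * J.
  move=> rho0 rhoL LL m0 hm.
  have mE : measurable (ellipsoid x0 nu L rho 1) by exact: measurable_ellipsoid.
  have iE := indic_damping_integrable mE (mu_ellipsoid_fin x0 nu1 rho0 rhoL (lexx 1)).
  have h1 := line_average_ge mb' b'B r0 T0 (ltW m0) mE iE hm.
  have h2 := hc x0 nu L rho nu1 rho0 rhoL LL.
  apply: le_trans (ler_wpM2l (ltW m0) h2) _.
  by rewrite mulrCA ler_pM2l.
have J0 : 0 <= J.
  apply: fine_ge0; apply: integral_ge0 => y _; rewrite mule_ge0// lee_fin.
  by have /andP[] := b'B y.
have r4n : 0 < (4 : R) ^+ n by exact: exprn_gt0.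
have rn : 0 < r ^+ n by exact: exprn_gt0.
suff key : c * T * r ^+ n <= 2 * 4 ^+ n * J.
  rewrite [leRHS](_ : _ = J / (2 * T * r ^+ n * m1)); last first.
    by move: (r ^+ n) rn => w w0; field; rewrite !gt_eqF.
  rewrite ler_pdivlMr ?mulr_gt0//.
  rewrite [leLHS](_ : _ = c * T * r ^+ n * 2 / (4 * 4 ^+ n)); last first.
    by move: (r ^+ n) (4 ^+ n : R) r4n => w z z0; field; rewrite !gt_eqF.
  rewrite ler_pdivrMr ?mulr_gt0//.
  by move: (4 ^+ n : R) key => z key; lra.
have [rT|rT] := leP r (2 * T).
  have r20 : 0 < r / 2 by rewrite divr_gt0.
  have rT2 : r / 2 <= T by lra.
  have LT : Lmin <= T by rewrite /T; lra.
  have := lower T (r / 2) (r / 2) r20 rT2 LT r20 (fun y => @slice_case1 x0 nu y T r nu1 r0 rT).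
  rewrite ler_pM2l// expr_div_n => h.
  have n24 : (2 : R) ^+ n <= 4 ^+ n by apply: lerXn2r; rewrite ?nnegrE//; lra.
  have h2 : c * T * r ^+ n <= 2 ^+ n * J.
    by move: h; rewrite mulrA ler_pdivrMr ?exprn_gt0// [J * _]mulrC.
  apply: le_trans h2 _; have := ler_wpM2r J0 n24.
  have : 0 <= 4 ^+ n * J by rewrite mulr_ge0// ltW.
  by rewrite -[2 * 4 ^+ n * J]mulrA; move: (4 ^+ n * J) (2 ^+ n * J) => z w; lra.
have r40 : 0 < r / 4 by rewrite divr_gt0.
have LT : Lmin <= r / 4 by rewrite /T in rT; lra.
have T2 : 0 < 2 * T by rewrite mulr_gt0.
have := lower (r / 4) (r / 4) (2 * T) r40 (lexx _) LT T2 (fun y => @slice_case2 x0 nu y T r nu1 T0 rT).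
rewrite (_ : 2 * T * (c * (r / 4) * (r / 4) ^+ n) = r / 4 * (2 * (c * T * (r / 4) ^+ n))); last first.
  by move: ((r / 4) ^+ n) => w; field.
rewrite ler_pM2l// expr_div_n => h.
have h2 : 2 * (c * T * r ^+ n) <= 4 ^+ n * J.
  by move: h; rewrite !mulrA ler_pdivrMr// [J * _]mulrC.
have : 0 <= 4 ^+ n * J by rewrite mulr_ge0// ltW.
by move: h2; rewrite -[2 * 4 ^+ n * J]mulrA; move: (4 ^+ n * J) (c * T * r ^+ n) => z w; lra.
Qed.

End geometric_control.

(** * The turning point condition *)

Section coordinatewise_mean_value.
Context (R : realType) (n : nat).
Implicit Types (x y z : 'rV[R]_n).

Lemma line_increment (f : R -> R) (df : R -> R) (c h : R) :
  (forall s : R, `|s| <= `|h| -> is_derive s (1 : R) f (df s) /\ `|df s| <= c) ->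
  `|f h - f 0| <= c * `|h|.
Proof.
move=> hf.
have inc (a b : R) : a <= b -> (forall s, a <= s <= b -> `|s| <= `|h|) ->
    `|f b - f a| <= c * (b - a).
  move=> ab sab.
  have [||d dab ->] := @MVT_segment _ f df a b ab.
  - move=> s; rewrite in_itv /= => /andP[s1 s2].
    by have [] := hf s (sab s _); rewrite // !ltW.
  - apply: derivable_within_continuous => s; rewrite in_itv /= => sab'.
    by have [[]] := hf s (sab s sab').
  rewrite in_itv /= in dab; have [_ dc] := hf d (sab d dab).
  by rewrite normrM (@ger0_norm _ (b - a)) ?subr_ge0// ler_wpM2r// subr_ge0.
have [h0|h0] := leP 0 h.
  have := inc 0 h h0; rewrite subr0 (ger0_norm h0); apply=> s /andP[s0 sh].
  by rewrite ger0_norm.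
have := inc h 0 (ltW h0); rewrite sub0r (ltr0_norm h0) distrC; apply=> s /andP[s0 sh].
by rewrite ler0_norm// lerN2.
Qed.

(** Pass from x to y by changing one coordinate at a time: partial derivatives suffice, bounded on
    the coordinate box spanned by x and y. *)
Lemma coordinatewise_increment (f : 'rV[R]_n -> R) (df : 'I_n -> 'rV[R]_n -> R) (c : R) x y :
  (forall p : 'rV[R]_n, (forall i, `|p ord0 i - x ord0 i| <= `|y ord0 i - x ord0 i|) ->
    forall i, is_derive p 'e_i f (df i p) /\ `|df i p| <= c) ->
  `|f y - f x| <= c * \sum_i `|y ord0 i - x ord0 i|.
Proof.
move=> hf.
pose z k : 'rV[R]_n := \row_i if (i < k)%N then y ord0 i else x ord0 i.
have z0 : z 0%N = x by apply/rowP => i; rewrite mxE.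
have zn : z n = y by apply/rowP => i; rewrite mxE ltn_ord.
have step (i : 'I_n) : `|f (z i.+1) - f (z i)| <= c * `|y ord0 i - x ord0 i|.
  pose h := y ord0 i - x ord0 i.
  have zi : z i.+1 = h *: 'e_i + z i.
    apply/rowP => j; rewrite !mxE eqxx /= ltnS leq_eqVlt.
    have [->|ji] := eqVneq j i.
      by rewrite eqxx ltnn mulr1 /h subrK.
    have jn : (nat_of_ord j == i) = false by apply/negbTE.
    by rewrite jn mulr0 add0r.
  have zi0 : f (z i) = f (0 *: 'e_i + z i) by rewrite scale0r add0r.
  rewrite zi zi0.
  apply: (@line_increment (fun s => f (s *: 'e_i + z i)) (fun s => df i (s *: 'e_i + z i))).
  move=> s sh; have [|d dc] := hf (s *: 'e_i + z i) _ i.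
    move=> j; rewrite !mxE /=.
    have [->|ji] := eqVneq j i.
      by rewrite ltnn mulr1 addrK.
    rewrite mulr0 add0r; case: ifP => _ //.
    by rewrite subrr normr0.
  split => //; exact: is_derive_line.
rewrite -{1}zn -{1}z0.
have -> : f (z n) - f (z 0%N) = \sum_(i < n) (f (z i.+1) - f (z i)).
  have := telescope_sumr (fun k => f (z k)) (leq0n n).
  by rewrite big_mkord.
apply: le_trans (ler_norm_sum _ _ _) _.
by rewrite mulr_sumr; apply: ler_sum => i _; exact: step.
Qed.

End coordinatewise_mean_value.

Section turning_points.
Context (R : realType) (n : nat) (V b b' : 'rV[R]_n -> R) (B : R).
Local Notation mu := (@lebesgue_rV R n).
Hypothesis n_gt0 : (0 < n)%N.
Hypothesis V2 : cont_diff 2 V.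
Hypothesis V_ge0 : forall x, 0 <= V x.
Hypothesis V_oo : V x @[x --> infty_nbhs R n] --> +oo.
Hypothesis V_grad : grad V =o_ (infty_nbhs R n) (fun x => V x `^ (3 / 4)).

Let W x := V x `^ 4^-1.

Let W4 x : W x ^+ 4 = V x.
Proof. by rewrite /W -powR_mulrn ?powR_ge0// -powRrM mulVf// powRr1. Qed.

Let is_derive_W i p : 0 < V p ->
  is_derive p 'e_i W (4^-1 * V p `^ (4^-1 - 1) * partial i V p).
Proof.
move=> Vp.
have dV : is_derive p 'e_i V (partial i V p).
  by apply: derivableP; have [_ /(_ i)[]] := V2.
apply: (@is_derive_comp1 _ _ (fun s => s `^ 4^-1)) => //.
have Vp' : V p \in `]0, +oo[ by rewrite in_itv /= Vp.
split; first by apply: derivable_powR; exact: Vp'.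
by rewrite -derive1E; apply: powR_derive1; exact: Vp'.
Qed.

Let infty_nbhsP (P : set 'rV[R]_n) : infty_nbhs R n P ->
  exists M, forall x, M < eucl_norm x -> P x.
Proof. by move=> [M _ h]; exists M => x; exact: h. Qed.

(* [V^(1/4)] has gradient o(1), since grad V = o(V^(3/4)); so on the ball of
   radius R0 / V(x)^(1/4) it varies by o(1) / V(x)^(1/4), and V by o(V(x)^(1/2)). *)
Lemma potential_increment (R0 eta : R) : 0 < R0 -> 0 < eta ->
  exists M, forall x, M < eucl_norm x -> 1 <= V x /\
    forall y, sqn (y - x) < (R0 / W x) ^+ 2 -> (V y - V x) ^+ 2 <= eta * V x.
Proof.
move=> R00 eta0.
have N0 : 0 < n%:R :> R by rewrite ltr0n.
(* 225 = 15^2: from W y <= 2 W x one gets (W y + W x)(W y^2 + W x^2) <= 3 * 5 * W x^3. The minimum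
   with 1 gives del^2 <= del. *)
pose del := Num.min 1 (eta / 225).
have del0 : 0 < del by rewrite lt_min ltr01 divr_gt0.
have del1 : del <= 1 by rewrite ge_min lexx.
have deleta : 225 * del ^+ 2 <= eta.
  have h1 : del <= eta / 225 by rewrite ge_min lexx orbT.
  have : del ^+ 2 <= del by rewrite expr2 ler_piMr// ltW.
  lra.
(* Each partial derivative of W is at most e/4 and each of the n coordinates of y - x at most R0 / W
   x, so W varies by at most del / W x. *)
pose e := 4 * del / (n%:R * R0).
have e0 : 0 < e by rewrite divr_gt0 ?mulr_gt0.
(* V x >= R0^4 means W x >= R0, so the ball of radius R0 / W x has radius at most 1. *)
have [M1 hM1] : exists M1, forall z, M1 < eucl_norm z -> Num.max 1 (R0 ^+ 4) <= V z.
  by apply: infty_nbhsP; move/cvgryPge : V_oo; apply.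
have [M2 hM2] : exists M2, forall z, M2 < eucl_norm z ->
    `|grad V z| <= e * `|V z `^ (3 / 4)|.
  by apply: infty_nbhsP; have /eqoP := V_grad; apply.
pose M0 := Num.max `|M1| `|M2|.
have M00 : 0 <= M0 by rewrite le_max normr_ge0.
(* Then every point within distance 1 of x still has norm above M0, where the bounds on V and its
   gradient hold. *)
exists (2 * (M0 + 1)) => x xM.
have far p : sqn (p - x) < 1 -> 1 <= V p /\ `|grad V p| <= e * V p `^ (3 / 4).
  move=> px; have sp : M0 ^+ 2 < sqn p.
    have h1 : sqn x <= 2 * sqn p + 2 * sqn (p - x).
      rewrite /sqn !mulr_sumr -big_split; apply: ler_sum => i _; rewrite !mxE /=.
      have := sqr_ge0 (2 * p ord0 i - x ord0 i); rewrite -subr_ge0 => h.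
      rewrite -subr_ge0; apply: le_trans h _; rewrite le_eqVlt; apply/orP; left; apply/eqP; ring.
    have h2 : (2 * (M0 + 1)) ^+ 2 < sqn x.
      rewrite -(sqr_sqrtr (sqn_ge0 x)) ltr_sqr ?nnegrE ?sqrtr_ge0//.
      by rewrite mulr_ge0// addr_ge0.
    have h3 : (2 * (M0 + 1)) ^+ 2 = 4 * M0 ^+ 2 + 8 * M0 + 4 by ring.
    have := sqr_ge0 M0; lra.
  have np : M0 < eucl_norm p.
    by rewrite eucl_normE -(ger0_norm M00) -sqrtr_sqr ltr_sqrt// (le_lt_trans _ sp)// sqr_ge0.
  have /hM1 : M1 < eucl_norm p.
    by apply: le_lt_trans np; rewrite (le_trans (ler_norm _))// le_max lexx.
  rewrite ge_max => /andP[Vp1 _]; split=> //.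
  have /hM2 : M2 < eucl_norm p.
    by apply: le_lt_trans np; rewrite (le_trans (ler_norm _))// le_max lexx orbT.
  by rewrite (ger0_norm (powR_ge0 _ _)).
have x0 : sqn (x - x) < 1.
  by rewrite subrr /sqn big1// => i _; rewrite mxE expr0n.
have [Vx1 _] := far x x0.
have WR : R0 <= W x.
  have /hM1 : M1 < eucl_norm x.
    apply: le_lt_trans xM; apply: (le_trans (ler_norm M1)).
    have : `|M1| <= M0 by rewrite le_max lexx.
    by move=> h; lra.
  rewrite ge_max => /andP[_]; rewrite -W4 => h.
  by rewrite -(@ler_pXn2r _ 4) ?nnegrE ?powR_ge0// ltW.
have Wx1 : 1 <= W x by rewrite -(@ler_pXn2r _ 4) ?nnegrE ?powR_ge0// expr1n W4.
have Wx0 : 0 < W x by exact: lt_le_trans Wx1.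
split=> // y hy.
have RW : R0 / W x <= 1 by rewrite ler_pdivrMr// mul1r.
have RW0 : 0 < R0 / W x by rewrite divr_gt0.
have inc : `|W y - W x| <= (e / 4) * \sum_i `|y ord0 i - x ord0 i|.
  apply: (@coordinatewise_increment _ _ W (fun i p => 4^-1 * V p `^ (4^-1 - 1) * partial i V p)).
  move=> p hp i.
  have px : sqn (p - x) < 1.
    apply: (@le_lt_trans _ _ (sqn (y - x))); last first.
      by apply: lt_le_trans hy _; rewrite exprn_ile1// ltW.
    apply: ler_sum => j _; rewrite !mxE -[leLHS]real_normK ?num_real// -[leRHS]real_normK ?num_real//.
    by rewrite ler_sqr ?nnegrE.
  have [Vp gp] := far p px.
  have Vp0 : 0 < V p by exact: lt_le_trans Vp.
  split; first exact: is_derive_W.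
  rewrite !normrM (ger0_norm (powR_ge0 _ _)) (@ger0_norm _ 4^-1)//.
  have h1 : `|partial i V p| <= e * V p `^ (3 / 4).
    by apply: le_trans gp; have := coord_le_norm (grad V p) i; rewrite mxE.
  have h2 : V p `^ (4^-1 - 1) * V p `^ (3 / 4) = 1.
    rewrite -powRD; last by apply/implyP => _; rewrite gt_eqF.
    by rewrite (_ : _ + _ = 0) ?powRr0//; field.
  apply: le_trans (ler_wpM2l _ h1) _; first by rewrite mulr_ge0 ?powR_ge0.
  rewrite (_ : _ * _ * (e * _) = e / 4 * (V p `^ (4^-1 - 1) * V p `^ (3 / 4))); last by field.
  by rewrite h2 mulr1.
have sum_le : \sum_i `|y ord0 i - x ord0 i| <= n%:R * (R0 / W x).
  rewrite mulr_natl -[X in _ *+ X](card_ord n) -sumr_const; apply: ler_sum => i _.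
  have := le_lt_trans (coord_le_sqn (y - x) i) hy; rewrite !mxE.
  by move=> /(sqr_lt_itv RW0); rewrite ler_norml => /andP[/ltW -> /ltW].
have WW : `|W y - W x| <= del / W x.
  apply: le_trans inc _; apply: le_trans (ler_wpM2l _ sum_le) _; first by rewrite divr_ge0// ltW.
  by rewrite /e le_eqVlt; apply/orP; left; apply/eqP; field; rewrite !gt_eqF.
have dW : del / W x <= W x.
  rewrite ler_pdivrMr//; apply: le_trans del1 _.
  by rewrite -[leLHS]mulr1 ler_pM.
have Wy0 : 0 <= W y by exact: powR_ge0.
have Wy2 : W y <= 2 * W x.
  have := le_trans (ler_norm _) WW; lra.
have -> : V y - V x = (W y - W x) * ((W y + W x) * (W y ^+ 2 + W x ^+ 2)) by rewrite -!W4; ring.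
have bnd : (W y + W x) * (W y ^+ 2 + W x ^+ 2) <= 15 * W x ^+ 3.
  have Wy22 : W y ^+ 2 <= 4 * W x ^+ 2.
    have -> : 4 * W x ^+ 2 = (2 * W x) ^+ 2 by ring.
    by rewrite ler_sqr ?nnegrE// mulr_ge0// ltW.
  have -> : 15 * W x ^+ 3 = (3 * W x) * (5 * W x ^+ 2) by ring.
  apply: ler_pM; rewrite ?addr_ge0 ?sqr_ge0 ?(ltW Wx0)//; lra.
have nb : `|(W y - W x) * ((W y + W x) * (W y ^+ 2 + W x ^+ 2))| <= 15 * del * W x ^+ 2.
  rewrite normrM [X in _ * X]ger0_norm; last first.
    by rewrite mulr_ge0 ?addr_ge0 ?sqr_ge0 ?(ltW Wx0).
  rewrite (_ : 15 * del * W x ^+ 2 = del / W x * (15 * W x ^+ 3)); last by field; rewrite gt_eqF.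
  by apply: ler_pM => //; rewrite mulr_ge0 ?addr_ge0 ?sqr_ge0 ?(ltW Wx0).
rewrite -real_normK ?num_real//.
have k0 : 0 <= 15 * del * W x ^+ 2 by rewrite !mulr_ge0 ?sqr_ge0// ltW.
have : `|(W y - W x) * ((W y + W x) * (W y ^+ 2 + W x ^+ 2))| ^+ 2 <= (15 * del * W x ^+ 2) ^+ 2.
  by rewrite ler_sqr ?nnegrE.
move=> h; apply: le_trans h _.
rewrite (_ : (15 * del * W x ^+ 2) ^+ 2 = 225 * del ^+ 2 * W x ^+ 4); last ring.
by rewrite W4 ler_wpM2r.
Qed.

Hypothesis bb' : {ae mu, forall x, b x = b' x}.
Hypothesis mb : measurable_fun setT b.
Hypothesis mb' : measurable_fun setT b'.
Hypothesis B0 : 0 < B.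
Hypothesis b'B : forall x, 0 <= b' x <= B.

Let contV : continuous V. Proof. by case: V2. Qed.

Lemma ell_form_ball (x nu : 'rV[R]_n) rho : 0 < rho ->
  ellipsoid x nu rho rho 1 = eucl_ball x rho.
Proof.
move=> rho0; rewrite eucl_ballE//; apply/seteqP; split => y;
  rewrite /ellipsoid /= /ell_form subrr mul0r addr0 mulrC ltr_pdivrMr ?exprn_gt0//;
  by rewrite mul1r sqdistE.
Qed.

Lemma turning_point : uniformly_stable V b -> turning_point_condition V b.
Proof.
move=> /(quasimode_estimate contV bb' mb' b'B)[K K0 hK].
have [C [c [C0 c0 hC]]] := bump_integrals R n_gt0.
(* The ellipsoid will be a ball, for which any unit vector can serve as axis. *)
pose nu : 'rV[R]_n := 'e_(Ordinal n_gt0).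
have nu1 : sqn nu = 1.
  rewrite /sqn (bigD1 (Ordinal n_gt0))//= big1 => [|i ii].
    by rewrite mxE !eqxx /= expr1n addr0.
  by rewrite mxE eqxx /= (negbTE ii) expr0n.
(* R0^4 >= R0 >= 2 K C: with rho^4 = R0^4 / V x, the Laplacian contributes at most V x / 4 times the
   integral of a^2. *)
pose R0 := K * C * 2 + 1.
have R01 : 1 <= R0 by rewrite lerDr !mulr_ge0// ltW.
have R00 : 0 < R0 by exact: lt_le_trans R01.
have KCR : K * C <= R0 ^+ 4 / 2.
  have : R0 <= R0 ^+ 4 by rewrite -[leLHS]expr1 ler_weXn2l.
  rewrite {1}/R0; lra.
(* The variation of V contributes another quarter, so half of the left-hand side survives. *)
pose eta := (8 * K)^-1.
have eta0 : 0 < eta by rewrite invr_gt0 mulr_gt0.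
have [M hM] := potential_increment R00 eta0.
exists R0 => //; rewrite limf_einfE.
apply: (@lt_le_trans _ _ (c / (2 ^+ n * (4 * K * B)))%:E).
  by rewrite lte_fin divr_gt0// !mulr_gt0// exprn_gt0.
set f := (f in [set ereal_inf (f @` _) | _ in _]).
apply: (@le_trans _ _ (ereal_inf (f @` [set x | M < eucl_norm x]))); last first.
  by apply: ereal_sup_ubound; exists [set x | M < eucl_norm x] => //; exists M.
apply: le_ereal_inf_tmp => _ [x xM <-]; rewrite lee_fin.
have [Vx1 Vy] := hM x xM.
have Wx0 : 0 < W x by rewrite powR_gt0// (lt_le_trans _ Vx1).
rewrite -/(W x); set rho := R0 / W x.
have rho0 : 0 < rho by rewrite divr_gt0.
pose a := ell_bump x nu rho rho.
have sa : smooth a by exact: smooth_bump.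
have ba : bsupp a by exact: bsupp_bump.
have [_ h2 /(_ erefl) h3] := hC x nu rho rho nu1 rho0 (lexx _); rewrite -/a in h2 h3.
have h4 := bump_damping_le mb' B0 b'B x nu1 rho0 (lexx _).
rewrite -/a ell_form_ball// in h4.
(* No oscillation: at energy V x the wave has no momentum near x. *)
have := hK (W x ^+ 2) 0 a sa ba.
rewrite -exprM W4.
set I := \int[mu]_x (a x ^+ 2) in h2 h3 *.
set Ib := \int[mu]_x (b' x ^+ 2 * a x ^+ 2) in h4 *.
set Q := \int[mu]_x _; set D := \int[mu]_x (dgrad 0 a x ^+ 2) => h1.
set Dl := \int[mu]_x _ in h3.
set J := \int[mu]_x _ in h4.
have D_0 : D = 0.
  rewrite /D (_ : (fun _ => _) = cst 0) ?Rintegral_cst ?mul0r//.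
  by apply/funext => y; rewrite /dgrad big1 ?expr0n// => i _; rewrite mxE mul0r.
have aC : Cc a by exact: smooth_Cc.
have lC : Cc (laplacian a) by apply: smooth_Cc; [exact: smooth_laplacian|exact: bsupp_laplacian].
have iI := Cc_sqr_integrable aC; have iD := Cc_sqr_integrable lC.
have hQ : Q <= 2 * eta * V x * I + 2^-1 * Dl.
  rewrite /I /Dl -RintegralZl// -RintegralZl// -RintegralD//; last 2 first.
  - exact: (integrableZl measurableT _ iI).
  - exact: (integrableZl measurableT _ iD).
  apply: le_Rintegral => //.
  - apply: (@Cc_sqr_integrable _ _ (fun y => (V y + 2^-1 * _ - _) * a y - 2^-1 * laplacian a y)).
    apply: CcD; last by apply: CcN; apply: CcMr => // y; exact: (@cvg_cst _ _ _ (nbhs y) _).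
    apply: CcMr => // y.
    exact: (cvgB (cvgD (@contV y) (@cvg_cst _ _ _ (nbhs y) _)) (@cvg_cst _ _ _ (nbhs y) _)).
  - exact: (integrableD measurableT (integrableZl measurableT (2 * eta * V x) iI)
                                    (integrableZl measurableT 2^-1 iD)).
  move=> y _ /=; rewrite big1 ?mulr0 ?addr0; last by move=> i _; rewrite mxE expr0n.
  set al := (V y - V x) * a y; set be := 2^-1 * laplacian a y.
  have h5 : al ^+ 2 <= eta * V x * a y ^+ 2.
    have [yE|yE] := pselect (eucl_ball x rho y).
      by rewrite /al exprMn ler_wpM2r ?sqr_ge0//; apply: Vy; apply/in_eucl_ball.
    rewrite /al /a /ell_bump bump_out ?mulr0 ?expr0n ?mulr0//.
    by rewrite ell_form_ball.
  have h6 : 2^-1 * laplacian a y ^+ 2 = 2 * be ^+ 2 by rewrite /be; field.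
  have := sqr_ge0 (al + be); rewrite h6.
  have -> : (al + be) ^+ 2 = 2 * al ^+ 2 + 2 * be ^+ 2 - (al - be) ^+ 2 by ring.
  by move: (a y ^+ 2) h5 => z; lra.
have I0 : 0 <= I by apply: Rintegral_ge0 => y _; exact: sqr_ge0.
have VI0 : 0 <= V x * I by rewrite mulr_ge0.
have hD : K * Dl <= 2^-1 * (V x * I).
  apply: le_trans (ler_wpM2l (ltW K0) h3) _.
  rewrite /rho expr_div_n W4 (_ : K * _ = (K * C) * (R0 ^- 4 * (V x * I))); last first.
    by field; rewrite !gt_eqF// (lt_le_trans ltr01).
  apply: le_trans (ler_wpM2r _ KCR) _; first by rewrite mulr_ge0// invr_ge0 exprn_ge0// ltW.
  by rewrite le_eqVlt; apply/orP; left; apply/eqP; field; rewrite gt_eqF.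
have hE : K * (2 * eta * V x * I) = 4^-1 * (V x * I).
  by rewrite /eta; field; rewrite gt_eqF.
have hI : I <= 4 * K * B * J.
  have Vx0 : 0 < V x by exact: lt_le_trans Vx1.
  rewrite -(ler_pM2l Vx0).
  have h5 := ler_wpM2l (ltW K0) hQ; rewrite mulrDr hE in h5.
  have h6 : V x * (K * Ib) <= V x * (K * (B * J)).
    by apply: ler_wpM2l => //; apply: ler_wpM2l => //; exact: ltW.
  rewrite D_0 in h1; lra.
have hJ : c * rho ^+ n <= 4 * K * B * J.
  apply: le_trans hI; rewrite -(ler_pM2l rho0); apply: le_trans h2.
  by rewrite mulrCA mulrA.
have mE : measurable (eucl_ball x rho) by exact: measurable_eucl_ball.
rewrite (mean_value_ae mE mb mb' bb').
have -> : \int[mu]_(y in eucl_ball x rho) b' y = J.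
  rewrite /J /Rintegral; congr fine; rewrite integral_mkcond; apply: eq_integral => y _ /=.
  by rewrite patchE indicE; case: ifP => _; rewrite ?mulr1 ?mulr0.
have fE := mu_eucl_ball_fin x rho0.
have m0 : 0 < fine (mu (eucl_ball x rho)).
  rewrite -lte_fin fineK//; apply: lt_le_trans (mu_eucl_ball_ge n_gt0 x rho0).
  by rewrite lte_fin exprn_gt0// divr_gt0// ltr0n.
have m1 : fine (mu (eucl_ball x rho)) <= 2 ^+ n * rho ^+ n.
  by rewrite -exprMn -lee_fin fineK// mu_eucl_ball_le.
rewrite [leRHS]mulrC ler_pdivlMr// mulrAC ler_pdivrMr ?mulr_gt0 ?exprn_gt0//.
apply: le_trans (ler_wpM2l (ltW c0) m1) _.
rewrite mulrCA [leRHS](_ : _ = 2 ^+ n * (4 * K * B * J)); last by move: (2 ^+ n : R) => z; ring.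
by rewrite ler_pM2l ?exprn_gt0.
Qed.

End turning_points.

Theorem theorem1p7 (R : realType) (d : nat) (V b : 'rV[R]_d -> R) :
  (1 <= d)%N ->
  cont_diff 2 V ->
  (forall x, 0 <= V x) ->
  V x @[x --> infty_nbhs R d] --> +oo ->
  grad V =o_ (infty_nbhs R d) (fun x => V x `^ (3 / 4)) ->
  b \in Lfun (lebesgue_rV R d) +oo%E ->
  {ae lebesgue_rV R d, forall x, 0 <= b x} ->
  uniformly_stable V b ->
  uniform_geometric_control b /\ turning_point_condition V b.
Proof.
move=> d0 V2 V0 Voo gV Lb b0 stab; have [cV _] := V2.
have mb := Lfun_measurable Lb.
have [b' [B [B0 mb' b'B bb']]] := bounded_version Lb b0.
split; first exact: (geometric_control d0 cV bb' mb mb' B0 b'B stab).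
exact: (turning_point d0 V2 V0 Voo gV bb' mb mb' B0 b'B stab).
Qed.
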